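(* Let $\mu$ be the measure on $\mathbb{R}^q$ constructed in the context from the graph $\mathcal{G}$, the maps $(T_{i,j})$, the positive probability vector $\chi$ and the transition matrix $P=\begin{pmatrix} P_1 & P_3 \\ P_4 & P_2 \end{pmatrix}$ (with $N\times N$ blocks). Assume that $P_1$ and $P_2$ are irreducible and $P_4=\mathbf{0}$; that for every $i\in\Psi$ both sets $\{j\in\Psi:p_{i,j}>0\}$ and $\{j\in\Psi:p_{i^+,j^+}>0\}$ have at least two elements; and that for every $(i,j)\in\Psi^2$ either $\mathcal{M}_{i,j}=\emptyset$ or $\mathcal{M}_{i,j}=\{(i,j),(i,j^+),(i^+,j^+)\}$. Let $r>0$, and let $s_{1,r},s_{2,r},s_r$ be as defined in the context. Then: (i) $D_r(\mu)$ exists and equals $s_r$, and $\underline{Q}_r^{s_r}(\mu)>0$; (ii) $\overline{Q}_r^{s_r}(\mu)<\infty$ if and only if $s_{1,r}\ne s_{2,r}$; (iii) there exists some $r_0>0$ such that $\overline{Q}_r^{s_r}(\mu)<\infty$ for every $r\in(0,r_0)$.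
   Context: Fix integers $q\ge1$, $N\ge2$. Let $\Psi=\{1,\ldots,N\}$, $\Omega=\{1,\ldots,2N\}$, $i^+:=i+N$ for $i\in\Psi$. Let $\mathcal{G}$ be a directed graph with vertex set $\Omega$, with at most one directed edge from any vertex to any vertex and at least one edge leaving each vertex. Let $G_1=\Omega$; for $k\ge2$, $G_k$ is the set of words $\sigma\in\Omega^k$ such that there is an edge from $\sigma_h$ to $\sigma_{h+1}$ for $1\le h\le k-1$; $G_\infty$ is the set of sequences in $\Omega^{\mathbb{N}}$ with the same property for all $h\ge1$. For $(i,j)\in\Psi^2$, $\mathcal{M}_{i,j}:=\{(i,j),(i,j^+),(i^+,j),(i^+,j^+)\}\cap G_2$. For a finite word $\sigma$ over $\Psi$, $\mathcal{T}(\sigma)$ is the set of words $\widetilde\sigma$ over $\Omega$ of the same length with $\widetilde\sigma_h\in\{\sigma_h,\sigma_h^+\}$ for all $h$. Put $\mathcal{S}_1=\Psi$, $\mathcal{S}_k=\{\sigma\in\Psi^k:\mathcal{T}(\sigma)\cap G_k\ne\emptyset\}$ for $k\ge2$. $\sigma|_k$ denotes the initial segment of length $k$. Let $J_i$, $i\in\Psi$, be non-empty, pairwise disjoint compact subsets of $\mathbb{R}^q$ with $\overline{\mathrm{int}(J_i)}=J_i$, and $J_{i^+}:=J_i$. For $(i,j)\in\mathcal{S}_2$ let $T_{i,j}$ be a contractive similarity of $\mathbb{R}^q$ with ratio $s_{i,j}$, and let $T_{\widetilde i,\widetilde j}:=T_{i,j}$ (hence $s_{\widetilde i,\widetilde j}=s_{i,j}$)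 for all $(\widetilde i,\widetilde j)\in\mathcal{M}_{i,j}$. Assume that $\bigcup_{j:(i,j)\in\mathcal{S}_2}T_{i,j}(J_j)\subset J_i$ for every $i\in\Psi$, and that the sets $T_{i,j}(J_j)$, $(i,j)\in\mathcal{S}_2$, are pairwise disjoint. For $\sigma\in\mathcal{S}_n\cup G_n$ let $T_\sigma=\mathrm{id}$ if $n=1$, $T_\sigma=T_{\sigma_1,\sigma_2}\circ\cdots\circ T_{\sigma_{n-1},\sigma_n}$ if $n>1$, and $J_\sigma=T_\sigma(J_{\sigma_n})$. Let $K=\bigcap_{k\ge1}\bigcup_{\sigma\in\mathcal{S}_k}J_\sigma$. Let $\chi=(\chi_i)_{i=1}^{2N}$ be a probability vector with all entries positive and $P=(p_{i,j})_{i,j=1}^{2N}$ a row-stochastic matrix with $p_{i,j}>0$ iff $(i,j)\in G_2$. Let $\nu$ be the unique Borel probability measure on $G_\infty$ with $\nu(\{\widetilde\tau\in G_\infty:\widetilde\tau|_n=\widetilde\sigma\})=\chi_{\widetilde\sigma_1}p_{\widetilde\sigma_1,\widetilde\sigma_2}\cdots p_{\widetilde\sigma_{n-1},\widetilde\sigma_n}$ for all $n$ and $\widetilde\sigma\in G_n$. Let $\pi:G_\infty\to K$, $\pi(\widetilde\sigma)$ being the unique point of $\bigcap_k J_{\widetilde\sigma|_k}$, and $\mu:=\nu\circ\pi^{-1}$. Spectral quantities. For $s>0$ let $A_1(s)=\big((p_{i,j}s_{i,j}^r)^s\big)_{i,j=1}^N$, $A_2(s)=\big((p_{i^+,j^+}s_{i^+,j^+}^r)^s\big)_{i,j=1}^N$,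 $A_3(s)=\big((p_{i,j^+}s_{i,j^+}^r)^s\big)_{i,j=1}^N$, $A_4(s)=\big((p_{i^+,j}s_{i^+,j}^r)^s\big)_{i,j=1}^N$ (an entry is $0$ when the corresponding transition probability is $0$), and $A(s)=\begin{pmatrix} A_1(s) & A_3(s) \\ A_4(s) & A_2(s) \end{pmatrix}$. Let $\psi_i(s)$, $\psi(s)$ be the spectral radii of $A_i(s)$, $A(s)$, and $\rho_i(s)=\psi_i(\frac{s}{s+r})$, $\rho(s)=\psi(\frac{s}{s+r})$. For $i=1,2$, $s_{i,r}$ is the unique positive number with $\rho_i(s_{i,r})=1$, and $s_r$ is the unique positive number with $\rho(s_r)=1$. Quantization. For a Borel probability measure $\mu$ on $\mathbb{R}^q$ and $k\ge1$, $e_{k,r}^r(\mu)=\inf\{\int d(x,\alpha)^r\,d\mu(x):\alpha\subset\mathbb{R}^q,\ 1\le\mathrm{card}(\alpha)\le k\}$, where $d(x,\alpha)$ is the Euclidean distance. For $s>0$, $\overline{Q}_r^s(\mu)=\limsup_{k\to\infty}k^{r/s}e_{k,r}^r(\mu)$ and $\underline{Q}_r^s(\mu)=\liminf_{k\to\infty}k^{r/s}e_{k,r}^r(\mu)$. $\overline{D}_r(\mu)$ and $\underline{D}_r(\mu)$ are the $\limsup$ and $\liminf$, as $k\to\infty$, of $\frac{\log k}{-\log e_{k,r}(\mu)}$; if they coincide, the common value is $D_r(\mu)$. *)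

(* Defs.v *)
From HB Require Import structures.
From mathcomp Require Import all_boot all_order all_algebra complex.
From mathcomp Require Import all_classical all_reals all_analysis.
Set Implicit Arguments.
Unset Strict Implicit.
Unset Printing Implicit Defensive.
Import Order.TTheory GRing.Theory Num.Theory.
Import numFieldNormedType.Exports.
Local Open Scope classical_set_scope.
Local Open Scope ring_scope.

Notation borelType T := (g_sigma_algebraType (@open T)).

(** Vertices are ['I_(N + N)]: a base index [i : 'I_N] stands for
    [lshift N i], and its twin [i^+] is [rshift N i], of value [N + i]. *)

Definition base N (i : 'I_(N + N)) : 'I_N :=
  match fintype.split i with inl j => j | inr j => j end.

Record digraph (N : nat) := Digraph {
  edge :> rel 'I_(N + N);
  digraph_gt1 : (1 < N)%N;
  edge_out : forall i, exists j, edge i j }.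

Section PathSpace.
Variables (N : nat) (G : digraph N).

Definition infinite_paths : set {ptws nat -> discrete_topology 'I_(N + N)} :=
  [set w | forall h, G (w h) (w h.+1)].

(** Indices start at 0. The topology is that induced by the product of the
    discrete topologies. *)
Definition path_space : Type := set_type infinite_paths.

Lemma path_space_inhabited : exists w, infinite_paths w.
Proof.
have [f fP] := choice (edge_out G).
have v0 : 'I_(N + N).
  by apply: (@Ordinal _ 0); rewrite addn_gt0 (ltnW (digraph_gt1 G)).
by exists (fun h => iter h f v0) => h; exact: fP.
Qed.

HB.instance Definition _ := Topological.copy path_space
  (initial_topology (\val : path_space -> {ptws nat -> discrete_topology 'I_(N + N)})).
HB.instance Definition _ := isPointed.Build path_space
  (let: exist w wP := cid path_space_inhabited in exist _ w (mem_set wP)).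

(** The set [M_{i,j}]. It is also the set of edges lying over the word [ij],
    so [ij] belongs to [S_2] exactly when it is non-empty. *)
Definition lifts (i j : 'I_N) : set ('I_(N + N) * 'I_(N + N)) :=
  [set (lshift N i, lshift N j); (lshift N i, rshift N j);
       (rshift N i, lshift N j); (rshift N i, rshift N j)]
  `&` [set p | G p.1 p.2].

Definition admissible2 (i j : 'I_N) : Prop := lifts i j !=set0.

Definition cylinder (w : seq 'I_(N + N)) : set path_space :=
  [set x | mkseq (\val x) (size w) = w].

End PathSpace.

Arguments cylinder {N} G w.

Section Euclidean.
Variables (R : realType) (q : nat).
Implicit Types (x y : 'rV[R]_q).

(** The library norm on row vectors is the sup norm, hence this one. *)
Definition enorm x : R := Num.sqrt (\sum_i x 0 i ^+ 2).

Definition edist_set x (alpha : set 'rV[R]_q) : R :=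
  inf [set enorm (x - a) | a in alpha].

Definition similarity (c : R) (T : 'rV[R]_q -> 'rV[R]_q) : Prop :=
  forall x y, enorm (T x - T y) = c * enorm (x - y).

Fixpoint word_map (I : Type) (T : I -> I -> 'rV[R]_q -> 'rV[R]_q)
    (i : I) (w : seq I) : 'rV[R]_q -> 'rV[R]_q :=
  if w is j :: w' then T i j \o word_map T j w' else id.

(** The set [J_w]; the value at the empty word is never used. *)
Definition word_set (I : Type) (T : I -> I -> 'rV[R]_q -> 'rV[R]_q)
    (J : I -> set 'rV[R]_q) (w : seq I) : set 'rV[R]_q :=
  if w is i :: w' then word_map T i w' @` J (last i w') else setT.

Definition coding N (G : digraph N) (T : 'I_N -> 'I_N -> 'rV[R]_q -> 'rV[R]_q)
    (J : 'I_N -> set 'rV[R]_q) (x : borelType (path_space G)) :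
    borelType 'rV[R]_q :=
  xget 0 (\bigcap_(k in [set k | (0 < k)%N])
    word_set (fun i j => T (base i) (base j)) (J \o @base N)
             (mkseq (\val (x : path_space G)) k)).

End Euclidean.

Arguments coding {R q N} G T J x.

Section Matrices.
Variable R : realType.

Definition irreducible_mx n (A : 'M[R]_n) : Prop :=
  forall i j, exists k, (0 < k)%N /\ 0 < (A ^+ k) i j.

Definition spectral_radius n (A : 'M[R]_n) : R :=
  sup [set Normc.normc l | l in
        [set l : R[i] | eigenvalue (map_mx (real_complex R) A) l]].

Variables (N : nat) (P : 'M[R]_(N + N)) (s : 'I_N -> 'I_N -> R).

Fixpoint path_prob (i : 'I_(N + N)) (w : seq 'I_(N + N)) : R :=
  if w is j :: w' then P i j * path_prob j w' else 1.

(** The matrix [A(t)]. As [0 `^ t = 0] for [t != 0], the entries with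
    [P i j = 0] vanish, whatever the value of [s] there. *)
Definition weight_mx (r t : R) : 'M[R]_(N + N) :=
  \matrix_(i, j) ((P i j * s (base i) (base j) `^ r) `^ t).

Definition rho1 (r u : R) : R :=
  spectral_radius (ulsubmx (weight_mx r (u / (u + r)))).
Definition rho2 (r u : R) : R :=
  spectral_radius (drsubmx (weight_mx r (u / (u + r)))).
Definition rho (r u : R) : R :=
  spectral_radius (weight_mx r (u / (u + r))).

Definition sdim1 (r : R) : R := xget 0 [set u | 0 < u /\ rho1 r u = 1].
Definition sdim2 (r : R) : R := xget 0 [set u | 0 < u /\ rho2 r u = 1].
Definition sdim (r : R) : R := xget 0 [set u | 0 < u /\ rho r u = 1].

End Matrices.

Section Quantization.
Variables (R : realType) (q : nat) (mu : set (borelType 'rV[R]_q) -> \bar R).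
Local Open Scope ereal_scope.

(** The [r]-th power [e_{k,r}^r] of the quantization error. *)
Definition quant_err_pow (r : R) (k : nat) : \bar R :=
  ereal_inf [set \int[mu]_x (edist_set x alpha `^ r)%:E | alpha in
    [set alpha : set 'rV[R]_q | alpha !=set0 /\ (alpha #<= `I_k)%card]].

Definition quant_err (r : R) (k : nat) : R :=
  (fine (quant_err_pow r k) `^ r^-1)%R.

Definition quant_ratio (r : R) (k : nat) : \bar R :=
  (ln k%:R / - ln (quant_err r k))%:E.

Definition upper_quant_dim (r : R) : \bar R := limn_esup (quant_ratio r).
Definition lower_quant_dim (r : R) : \bar R := limn_einf (quant_ratio r).

Definition upper_quant_coef (r s : R) : \bar R :=
  limn_esup (fun k => (k%:R `^ (r / s))%:E * quant_err_pow r k).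
Definition lower_quant_coef (r s : R) : \bar R :=
  limn_einf (fun k => (k%:R `^ (r / s))%:E * quant_err_pow r k).

End Quantization.

(* Main.v *)
(** Write [a i j = P i j * s i j ^ r] and [A(t) = (a i j ^ t)], so that
    [rho_i (u) = 1] reads "the block [A_i(t)] has radius 1" at [t = u / (u + r)],
    where [r / u = 1 / t - 1].  The radius of [A] is the larger of those of the two
    diagonal blocks, so [s_r] corresponds to [t = max t1 t2].

    The quantization error is controlled by counting words.  If the path space
    is covered by [k] cylinders of weight [chi * prod a] at most [e], one point in
    each set [J_w] gives [e_k^r <= C k e].  Conversely, if [2 k] pairwise
    incomparable base words have weight at least [e], the sets [J_w] have
    disjoint neighbourhoods of radius comparable to their size, [k] of these miss
    any given [k] points, and [e_k^r >= c k e].  So everything depends on the number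
    of words at which the weight first drops below [e], to be compared with [e^-t].
    This number is estimated by potentials: a function [U] of the weight and the
    last letter that is (super- or sub-)additive along the tree bounds the
    number of leaves.  Perron vectors of [A_i(t)] provide the potentials.

    If [t1 <> t2] the upper bound is [C e^-t]; for [t1 > t2] the potential is
    [C1 h w^t1 - C2 g w^t2] on the first block.  If [t1 = t2], a base word of length
    [n] has about [n] lifts, the sum of the [t]-th powers of their weights
    grows linearly with the depth, and as [x -> x ^ t] is concave this forces an
    additional factor [n ^ t], with [n] of order [log (1 / e)].  For small [r] the two
    values differ because [P_2] is stochastic while [P_1] is strictly
    substochastic. *)

Require Import Defs.
From HB Require Import structures.
From mathcomp Require Import all_boot all_order all_algebra complex.
From mathcomp Require Import all_classical all_reals all_analysis measurable_realfun.
From mathcomp Require Import ring lra.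
Set Implicit Arguments.
Unset Strict Implicit.
Unset Printing Implicit Defensive.
Import Order.TTheory GRing.Theory Num.Theory.
Import numFieldNormedType.Exports.
Local Open Scope classical_set_scope.
Local Open Scope ring_scope.

(** * Trees of words cut by a stopping rule *)

(** Covers consist of words over [Omega], packings of words over [Psi]. All lifts of a base word
    share one set [J_w]: treating them separately costs an upper bound only some extra points, but a
    lower bound needs separated sets, and there the masses of the lifts may be added. For a lower
    bound of order [e ^ (- t)] a single lift of each base word, running inside one copy of [Psi],
    suffices. The additional factor for equal exponents is invisible to any function of one weight
    and the last letter. The packing tree therefore carries a longer state, which separates the lift
    that never leaves the first copy from those that have left it and records the depth. Weights are
    normalised by dividing by [e]: a branch stops as soon as its weight is below 1, and since one
    letter costs at most a factor [m], it stops with a weight of at least [m]. Termination comes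
    from a uniform contraction [k < 1]. The root [t] of a radius is found without a continuity
    theorem: raising [t] by [d] multiplies the radius by a factor of at least [m ^ d] and at most
    [k ^ d]. *)

Section CutTree.
Variables (R : realType) (V : finType) (S : Type) (step : S -> V -> S).
Variables (vert : S -> V) (e : rel V) (P : pred S).
Hypothesis vert_step : forall st j, vert (step st j) = j.

(** [n] is fuel: the predicate [I] below expresses that it suffices to reach [P]
    along every branch. *)
Fixpoint cut n (st : S) : seq (seq V) :=
  if n is n'.+1 then
    if P st then [:: [::]] else
    flatten [seq [seq j :: u | u <- cut n' (step st j)]
            | j <- enum V & e (vert st) j]
  else [:: [::]].

Lemma cut_mem_cons n st j u : ~~ P st ->
  (j :: u \in cut n.+1 st) = e (vert st) j && (u \in cut n (step st j)).
Proof.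
move=> nP; rewrite /= (negbTE nP).
apply/flatten_mapP/andP => [[k + /mapP[v vin [-> ->]]]|[ej uin]].
  by rewrite mem_filter mem_enum => /andP[-> _].
by exists j; [rewrite mem_filter ej mem_enum | apply: map_f].
Qed.

Lemma cut_nil_mem n st : ~~ P st -> [::] \notin cut n.+1 st.
Proof. by move=> nP /=; rewrite (negbTE nP); apply/flatten_mapP => -[k _ /mapP[]]. Qed.

Lemma cut_path n st u : u \in cut n st -> path e (vert st) u.
Proof.
elim: n st u => [|n IH] st u; first by rewrite inE => /eqP ->.
have [Pst|nP] := boolP (P st); first by rewrite /= Pst inE => /eqP ->.
case: u => [|j u]; first by rewrite (negbTE (cut_nil_mem _ nP)).
by rewrite cut_mem_cons// => /andP[ej /IH]; rewrite vert_step /= ej.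
Qed.

Lemma cut_uniq n st : uniq (cut n st).
Proof.
elim: n st => [|n IH] st //=; case: ifP => // _.
have := filter_uniq (e (vert st)) (enum_uniq V).
elim: [seq j <- enum V | e (vert st) j] => [|j s IHs] //= /andP[js us].
rewrite cat_uniq IHs// map_inj_uniq ?IH//; last by move=> ? ? [].
rewrite andbT; apply/hasPn => u /flatten_mapP[k ks /mapP[v _ ->]].
by apply/mapP => -[w _ [kj _]]; rewrite -kj ks in js.
Qed.

Lemma cut_prefix n st u v : u \in cut n st -> v \in cut n st -> prefix u v -> u = v.
Proof.
elim: n st u v => [|n IH] st u v.
  by rewrite !inE => /eqP -> /eqP ->.
have [Pst|nP] := boolP (P st); first by rewrite /= Pst !inE => /eqP -> /eqP ->.
case: u => [|j u]; first by rewrite (negbTE (cut_nil_mem _ nP)).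
case: v => [|k v] //; rewrite !cut_mem_cons// => /andP[_ uin] /andP[_ vin].
rewrite prefix_cons => /andP[/eqP jk uv]; rewrite -jk in vin *.
by rewrite (IH _ _ _ uin vin).
Qed.

Variable I : nat -> S -> Prop.
Hypothesis I_fuel : forall st, I 0 st -> P st.
Hypothesis I_step : forall n st j,
  I n.+1 st -> ~~ P st -> e (vert st) j -> I n (step st j).

Lemma cut_stop n st u : I n st -> u \in cut n st ->
  P (foldl step st u) /\ exists m, I m (foldl step st u).
Proof.
elim: n st u => [|n IH] st u Ist.
  by rewrite inE => /eqP -> /=; split; [exact: I_fuel | exists 0%N].
have [Pst|nP] := boolP (P st).
  by rewrite /= Pst inE => /eqP ->; split => //; exists n.+1.
case: u => [|j u]; first by rewrite (negbTE (cut_nil_mem _ nP)).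
rewrite cut_mem_cons// => /andP[ej uin] /=; apply: IH uin.
exact: I_step.
Qed.

Lemma cut_cover n st (y : nat -> V) : I n st -> e (vert st) (y 0%N) ->
  (forall k, e (y k) (y k.+1)) -> exists k, mkseq y k \in cut n st.
Proof.
elim: n st y => [|n IH] st y Ist e0 ey; first by exists 0%N; rewrite inE.
have [Pst|nP] := boolP (P st); first by exists 0%N; rewrite /= Pst inE.
have [|||k kin] := IH (step st (y 0%N)) (fun k => y k.+1).
- exact: I_step.
- by rewrite vert_step.
- by move=> k; exact: ey.
exists k.+1; have -> : mkseq y k.+1 = y 0%N :: mkseq (fun k => y k.+1) k.
  by rewrite /mkseq /= (iotaDl 1 0) -map_comp.
by rewrite cut_mem_cons// e0.
Qed.

Lemma size_cutS n st : ~~ P st ->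
  size (cut n.+1 st) = (\sum_(j | e (vert st) j) size (cut n (step st j)))%N.
Proof.
move=> nP; rewrite /= (negbTE nP) size_flatten sumnE /shape -map_comp big_map.
rewrite big_filter big_enum_cond /=.
by apply: eq_bigr => j _; rewrite size_map.
Qed.

(** The value of [U] at the root is handed down to the children without increase of the total, and
    every leaf takes at least 1 of it. *)
Lemma cut_size_le (U : S -> R) n st :
  (forall m st', I m st' -> P st' -> 1 <= U st') ->
  (forall m st', I m.+1 st' -> ~~ P st' ->
     \sum_(j | e (vert st') j) U (step st' j) <= U st') ->
  I n st -> (size (cut n st))%:R <= U st.
Proof.
move=> U1 US; elim: n st => [|n IH] st Ist.
  by rewrite (U1 0%N)//; exact: I_fuel.
have [Pst|nP] := boolP (P st); first by rewrite /= Pst (U1 n.+1).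
rewrite size_cutS// natr_sum; apply: le_trans (US _ _ Ist nP).
by apply: ler_sum => j ej; apply: IH; exact: I_step.
Qed.

Lemma cut_size_ge (U : S -> R) n st :
  (forall m st', I m st' -> P st' -> U st' <= 1) ->
  (forall m st', I m.+1 st' -> ~~ P st' ->
     U st' <= \sum_(j | e (vert st') j) U (step st' j)) ->
  I n st -> U st <= (size (cut n st))%:R.
Proof.
move=> U1 US; elim: n st => [|n IH] st Ist.
  by rewrite (U1 0%N)//; exact: I_fuel.
have [Pst|nP] := boolP (P st); first by rewrite /= Pst (U1 n.+1).
rewrite size_cutS// natr_sum; apply: le_trans (US _ _ Ist nP) _.
by apply: ler_sum => j ej; apply: IH; exact: I_step.
Qed.

End CutTree.

(** * Perron vectors and spectral radii *)

Section Perron.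
Variable R : realType.

(** The action on columns, stated for plain functions so that potentials on letters serve as vectors
    without conversion. *)
Definition mulmv n (A : 'M[R]_n) (h : 'I_n -> R) (i : 'I_n) : R :=
  \sum_j A i j * h j.

Lemma mulmvM n (A B : 'M[R]_n) h i :
  mulmv (A *m B) h i = mulmv A (mulmv B h) i.
Proof.
rewrite /mulmv; under eq_bigr do rewrite mxE mulr_suml.
rewrite exchange_big; apply: eq_bigr => k _ /=.
by rewrite mulr_sumr; apply: eq_bigr => j _; rewrite mulrA.
Qed.

Lemma mulmvB n (A : 'M[R]_n) g h i :
  mulmv A (fun j => g j - h j) i = mulmv A g i - mulmv A h i.
Proof. by rewrite /mulmv -sumrB; apply: eq_bigr => j _; rewrite mulrBr. Qed.

Lemma mulmvZ n (A : 'M[R]_n) c h i : mulmv A (fun j => c * h j) i = c * mulmv A h i.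
Proof. by rewrite /mulmv mulr_sumr; apply: eq_bigr => j _; rewrite mulrCA. Qed.

Lemma mulmv_ge0 n (A : 'M[R]_n) h i :
  (forall i j, 0 <= A i j) -> (forall j, 0 <= h j) -> 0 <= mulmv A h i.
Proof. by move=> A0 h0; apply: sumr_ge0 => j _; rewrite mulr_ge0. Qed.

Lemma mulmv_gt0 n (A : 'M[R]_n) h i :
  (forall i j, 0 < A i j) -> (forall j, 0 <= h j) -> (exists j, 0 < h j) ->
  0 < mulmv A h i.
Proof.
move=> A0 h0 [j hj]; rewrite /mulmv (bigD1 j)//= ltr_pwDl ?mulr_gt0//.
by apply: sumr_ge0 => k _; rewrite mulr_ge0// ltW.
Qed.

(** Take [i] maximising [h / g]. *)
Lemma collatz_wielandt n (A : 'M[R]_n) (g h : 'I_n -> R) a b :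
  (0 < n)%N -> (forall i j, 0 <= A i j) ->
  (forall i, 0 < g i) -> (forall i, 0 < h i) ->
  (forall i, a * h i <= mulmv A h i) -> (forall i, mulmv A g i <= b * g i) ->
  exists i, a * g i <= mulmv A g i.
Proof.
move=> n0 A0 g0 h0 ah gb; have i0 : 'I_n by exact: Ordinal n0.
case: (@Order.TotalTheory.arg_maxP _ _ _ i0 xpredT (fun i => h i / g i) isT) => i _ imax.
exists i; rewrite -(ler_pM2l (divr_gt0 (h0 i) (g0 i))).
rewrite mulrCA divfK ?gt_eqF//; apply: (le_trans (ah i)).
rewrite /mulmv mulr_sumr; apply: ler_sum => j _.
rewrite mulrCA ler_wpM2l//.
by have jm : h j / g j <= h i / g i := imax j isT; rewrite -ler_pdivrMr.
Qed.

Lemma collatz_wielandt_le n (A : 'M[R]_n) (g h : 'I_n -> R) a b :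
  (0 < n)%N -> (forall i j, 0 <= A i j) ->
  (forall i, 0 < g i) -> (forall i, 0 < h i) ->
  (forall i, a * h i <= mulmv A h i) -> (forall i, mulmv A g i <= b * g i) ->
  a <= b.
Proof.
move=> n0 A0 g0 h0 ah gb.
have [i ai] := collatz_wielandt n0 A0 g0 h0 ah gb.
by rewrite -(ler_pM2r (g0 i)) (le_trans ai).
Qed.

Lemma collatz_wielandt_lt n (A : 'M[R]_n) (g h : 'I_n -> R) a b :
  (0 < n)%N -> (forall i j, 0 <= A i j) ->
  (forall i, 0 < g i) -> (forall i, 0 < h i) ->
  (forall i, a * h i <= mulmv A h i) -> (forall i, mulmv A g i < b * g i) ->
  a < b.
Proof.
move=> n0 A0 g0 h0 ah gb.
have [i ai] := collatz_wielandt n0 A0 g0 h0 ah (fun i => ltW (gb i)).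
by rewrite -(ltr_pM2r (g0 i)) (le_lt_trans ai).
Qed.

Lemma expmx_ge0 n (A : 'M[R]_n) k i j :
  (forall i j, 0 <= A i j) -> 0 <= (A ^+ k) i j.
Proof.
move=> A0; elim: k i j => [|k IH] i j.
  by rewrite expr0 mxE ler0n.
by rewrite exprS mxE sumr_ge0// => l _; rewrite mulr_ge0.
Qed.

(** [B] is a sum of consecutive powers of [A], long enough to contain for each pair a power with
    positive entry there; as a polynomial in [A] it commutes with [A]. *)
Lemma irreducible_positive n (A : 'M[R]_n) :
  (forall i j, 0 <= A i j) -> irreducible_mx A ->
  exists B : 'M[R]_n, A *m B = B *m A /\ forall i j, 0 < B i j.
Proof.
move=> A0 irr.
pose k ij := projT1 (cid (irr (ij.1 : 'I_n) (ij.2 : 'I_n))).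
have kP i j : 0 < (A ^+ k (i, j)) i j by rewrite /k; case: cid => /= m [].
pose M := (\max_ij k ij).+1.
exists (\sum_(m < M) A ^+ m); split.
  rewrite mulmx_sumr mulmx_suml; apply: eq_bigr => m _.
  by rewrite -[LHS]exprS exprSr.
move=> i j; rewrite summxE.
have kM : (k (i, j) < M)%N by rewrite ltnS; apply: (leq_bigmax (i, j)).
rewrite (bigD1 (Ordinal kM))//= ltr_pwDl ?kP//.
by apply: sumr_ge0 => m _; exact: expmx_ge0.
Qed.

Let simplex n : set 'rV[R]_n := [set x | (forall i, 0 <= x 0 i) /\ \sum_i x 0 i = 1].

Let sum_continuous n (c : 'I_n -> R) :
  continuous (fun x : 'rV[R]_n => \sum_j c j * x 0 j).
Proof.
move=> x; elim: (index_enum _) => [|j r IH].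
  rewrite (_ : (fun x : 'rV[R]_n => _) = fun=> 0); first exact: cst_continuous.
  by apply/funext => y; rewrite big_nil.
rewrite (_ : (fun x : 'rV[R]_n => _) =
  (fun x : 'rV[R]_n => c j * x 0 j + \sum_(j <- r) c j * x 0 j)).
  have cj : (fun y : 'rV[R]_n => c j * y 0 j) @ x --> c j * x 0 j.
    have cx := @coord_continuous R 1 n 0 j x.
    have cc : (fun=> c j) @ x --> c j by exact: cst_continuous.
    exact: (cvgM cc cx).
  exact: (cvgD cj IH).
by apply/funext => y; rewrite big_cons.
Qed.

Let simplex_compact n : compact (@simplex n).
Proof.
have -> : @simplex n = [set x : 'rV[R]_n | forall i, `[0, 1]%classic (x 0 i)]
    `&` [set x : 'rV[R]_n | \sum_i 1 * x 0 i = 1].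
  apply/seteqP; split=> x [x0 x1]; split => //=.
  - move=> i; rewrite in_itv/= x0/= -x1 (bigD1 i)//= lerDl.
    by apply: sumr_ge0 => j _; exact: x0.
  - by under eq_bigr do rewrite mul1r.
  - by move=> i; have /= := x0 i; rewrite in_itv/= => /andP[].
  - by rewrite -[RHS]x1; under [RHS]eq_bigr do rewrite mul1r.
apply: compact_closedI.
  exact: (@rV_compact R n (fun=> `[0, 1]%classic) (fun=> @segment_compact R 0 1)).
apply: (@closed_comp _ _ (fun x : 'rV[R]_n => \sum_j 1 * x 0 j) [set 1]).
  by move=> x _; exact: sum_continuous.
exact: closed_eq.
Qed.

(** Maximise the Collatz-Wielandt quotient [min_i (A y)_i / y_i] over the
    vectors [y = B x], [x] in the simplex: they are positive, so the quotient is
    continuous, and at a maximiser [A y - l y] must vanish, since otherwise [B]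
    would turn it into a positive vector. *)
Lemma perron n (A : 'M[R]_n) : (0 < n)%N ->
  (forall i j, 0 <= A i j) -> irreducible_mx A ->
  exists l h, (forall i, 0 < h i) /\ forall i, mulmv A h i = l * h i.
Proof.
move=> n0 A0 irr; have i0 : 'I_n := Ordinal n0.
have [B [AB B0]] := irreducible_positive A0 irr.
pose f i (x : 'rV[R]_n) := mulmv (A *m B) (x 0) i / mulmv B (x 0) i.
(* The default of the minimum is one of its own terms, hence harmless. *)
pose g (x : 'rV[R]_n) := \big[Num.min/f i0 x]_i f i x.
have simplexB x i : @simplex n x -> 0 < mulmv B (x 0) i.
  move=> [x0 x1]; apply: mulmv_gt0 => //; apply: contrapT => /forallNP xN.
  suff : \sum_i x 0 i = 0 by rewrite x1 => /eqP; rewrite oner_eq0.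
  apply: big1 => j _; apply/eqP; rewrite eq_le x0 andbT.
  by rewrite leNgt; apply/negP/xN.
have f_cont i x : @simplex n x -> {for x, continuous (f i)}.
  move=> sx; have yx0 : mulmv B (x 0) i != 0 by rewrite gt_eqF// simplexB.
  have cA := @sum_continuous n (fun j => (A *m B) i j) x.
  have cB := @sum_continuous n (fun j => B i j) x.
  exact: (cvgM cA (cvgV yx0 cB)).
have g_cont : {within @simplex n, continuous g}.
  apply: continuous_in_subspaceT => x; rewrite inE => sx.
  rewrite /g; elim: (index_enum _) => [|i s IH].
    rewrite (_ : (fun x : 'rV[R]_n => _) = f i0); first exact: f_cont.
    by apply/funext => y; rewrite big_nil.
  rewrite (_ : (fun x : 'rV[R]_n => _) =
    (fun x : 'rV[R]_n => Num.min (f i x) (\big[Num.min/f i0 x]_(j <- s) f j x))).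
    by apply: continuous_min => //; exact: f_cont.
  by apply/funext => y; rewrite big_cons.
have simplex0 : @simplex n !=set0.
  exists (delta_mx 0 i0); split => [i|].
    by rewrite mxE ler0n.
  rewrite (bigD1 i0)//= mxE !eqxx big1 ?addr0// => j ji0.
  by rewrite mxE (negbTE ji0) andbF.
have [x /[!inE] sx gmax] := EVT_max_rV simplex0 (@simplex_compact n) g_cont.
pose y := mulmv B (x 0); pose l := g x.
have y0 i : 0 < y i by exact: simplexB.
have ly i : l * y i <= mulmv A y i.
  by rewrite -ler_pdivlMr// -mulmvM /l /g; apply: bigmin_le_cond.
exists l, y; split => // i; apply: contrapT => Ayi.
pose d i := mulmv A y i - l * y i.
have By i' : 0 < mulmv B d i'.
  apply: mulmv_gt0 => // [j|]; first by rewrite subr_ge0.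
  exists i; rewrite lt_neqAle subr_ge0 ly andbT eq_sym subr_eq0.
  by apply/eqP.
pose S := \sum_i y i.
have S0 : 0 < S.
  by rewrite /S (bigD1 i0)//= ltr_pwDl// sumr_ge0// => j _; exact: ltW.
(* [y] scaled back into the simplex. The quotients [f j z] are those of the vector [B y], and
   commutation turns [B d > 0] into [f j z > l], against the maximality of [l]. *)
pose z := \row_i (S^-1 * y i).
have sz : @simplex n z.
  split => [j|]; first by rewrite mxE mulr_ge0 ?invr_ge0 ?ltW.
  by under eq_bigr do rewrite mxE; rewrite -mulr_sumr mulVf// gt_eqF.
have zE M j : mulmv M (z 0) j = S^-1 * mulmv M y j.
  by rewrite -mulmvZ /mulmv; apply: eq_bigr => k _; rewrite mxE.
have : l < g z; last by apply/negP; rewrite -leNgt gmax// inE.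
have fz j : l < f j z.
  rewrite /f ltr_pdivlMr; last exact: simplexB.
  rewrite !zE mulrCA ltr_pM2l ?invr_gt0// AB !mulmvM.
  rewrite -mulmvZ -subr_gt0 -mulmvB; exact: By.
rewrite /g; elim: (index_enum _) => [|j s IH]; first by rewrite big_nil.
by rewrite big_cons lt_min fz.
Qed.

End Perron.

Section SpectralRadius.
Variable R : realType.
Implicit Types (l : R) (z : R[i]).

Let cmx n (A : 'M[R]_n) : 'M[R[i]]_n := map_mx (real_complex R) A.

Lemma normc_real l : Normc.normc (l%:C)%C = `|l|.
Proof. by rewrite /Normc.normc /= expr0n addr0 sqrtr_sqr. Qed.

Lemma normc_ge0 z : 0 <= Normc.normc z.
Proof. by case: z => a b; exact: sqrtr_ge0. Qed.

Lemma normc_sum (I : Type) (r : seq I) (F : I -> R[i]) :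
  Normc.normc (\sum_(i <- r) F i) <= \sum_(i <- r) Normc.normc (F i).
Proof.
elim: r => [|i r IH]; first by rewrite !big_nil Normc.normc0.
by rewrite !big_cons (le_trans (le_normcD _ _))// lerD2l.
Qed.

Lemma spectral_radiusE n (A : 'M[R]_n) l : 0 <= l -> eigenvalue A l ->
  (forall z, eigenvalue (cmx A) z -> Normc.normc z <= l) ->
  spectral_radius A = l.
Proof.
move=> l0 lA Al; apply/eqP; rewrite eq_le; apply/andP; split.
  apply: ge_sup => [|_ [z zA <-]]; last exact: Al.
  exists l, (l%:C)%C; last by rewrite normc_real ger0_norm.
  by rewrite /= eigenvalue_map.
apply: ub_le_sup; first by exists l => _ [z zA <-]; exact: Al.
exists (l%:C)%C; first by rewrite /= eigenvalue_map.
by rewrite normc_real ger0_norm.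
Qed.

(** The moduli of a left eigenvector [v] are paired with [h]: with [S = sum |v_j| h_j > 0] the
    triangle inequality gives [|z| S <= sum |v_i| (A h)_i <= l S]. *)
Lemma eigenvalue_le n (A : 'M[R]_n) h l z :
  (forall i j, 0 <= A i j) -> (forall i, 0 < h i) ->
  (forall i, mulmv A h i <= l * h i) ->
  eigenvalue (cmx A) z -> Normc.normc z <= l.
Proof.
move=> A0 h0 Ah /eigenvalueP[v vA v0].
pose w i := Normc.normc (v 0 i).
have w0 i : 0 <= w i by exact: normc_ge0.
have zw j : Normc.normc z * w j <= \sum_i w i * A i j.
  have := congr1 (fun u : 'rV_n => Normc.normc (u 0 j)) vA.
  rewrite /cmx !mxE Normc.normcM => <-; apply: (le_trans (normc_sum _ _)).
  apply: ler_sum => i _; rewrite Normc.normcM mxE.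
  by rewrite -[X in _ * X <= _]/(Normc.normc ((A i j)%:C)%C) normc_real ger0_norm.
pose S := \sum_j w j * h j.
have S0 : 0 < S.
  rewrite lt_neqAle eq_sym sumr_ge0 ?andbT => [|j _]; last by rewrite mulr_ge0// ltW.
  apply: contra v0; rewrite psumr_eq0 => [/allP S0|j _]; last first.
    by rewrite mulr_ge0// ltW.
  apply/eqP/rowP => j; rewrite mxE; apply: Normc.eq0_normc; apply/eqP.
  by have := S0 j (mem_index_enum _); rewrite mulf_eq0 (gt_eqF (h0 j)) orbF.
rewrite -(ler_pM2r S0) mulr_sumr.
apply: (@le_trans _ _ (\sum_j (\sum_i w i * A i j) * h j)).
  by apply: ler_sum => j _; rewrite mulrA ler_wpM2r// ltW.
under eq_bigr do rewrite mulr_suml.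
rewrite exchange_big /= mulr_sumr; apply: ler_sum => i _.
under eq_bigr do rewrite -mulrA.
by rewrite -mulr_sumr mulrCA; exact: ler_wpM2l (w0 i) _ _ (Ah i).
Qed.

(** [eigenvalue] speaks of left eigenvectors, while [h] is a right one; both express that [A - l] is
    singular. *)
Lemma eigenvalue_mulmv n (A : 'M[R]_n) h l : (exists i, h i != 0) ->
  (forall i, mulmv A h i = l * h i) -> eigenvalue A l.
Proof.
move=> [i hi] Ah; rewrite /eigenvalue /eigenspace kermx_eq0 row_free_unit.
apply: contra hi => Au; have : (A - l%:M) *m (\col_j h j) = 0.
  rewrite mulmxBl mul_scalar_mx; apply/colP => j; rewrite !mxE -Ah.
  by apply/eqP; rewrite subr_eq0; apply/eqP; apply: eq_bigr => k _; rewrite mxE.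
by move/(congr1 (mulmx (invmx (A - l%:M)))); rewrite mulKmx// mulmx0 => /colP/(_ i); rewrite !mxE => ->.
Qed.

Lemma spectral_radius_perron n (A : 'M[R]_n) h l : (0 < n)%N ->
  (forall i j, 0 <= A i j) -> (forall i, 0 < h i) ->
  (forall i, mulmv A h i = l * h i) -> spectral_radius A = l.
Proof.
move=> n0 A0 h0 Ah; apply: spectral_radiusE.
- rewrite -(ler_pM2r (h0 (Ordinal n0))) mul0r -Ah mulmv_ge0// => j; exact: ltW.
- apply: eigenvalue_mulmv Ah; exists (Ordinal n0); by rewrite gt_eqF.
- by move=> z; apply: eigenvalue_le A0 h0 _ => i; rewrite Ah.
Qed.

Lemma eigenvalue_ublock (F : fieldType) m n (A : 'M[F]_m) B (D : 'M[F]_n) a :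
  eigenvalue (block_mx A B 0 D) a = eigenvalue A a || eigenvalue D a.
Proof.
rewrite !eigenvalue_root_char -rootM /char_poly /char_poly_mx.
rewrite map_block_mx scalar_mx_block opp_block_mx add_block_mx.
by rewrite map_mx0 subr0 det_ublock.
Qed.

Lemma spectral_radius_ublock m n (A : 'M[R]_m) B (D : 'M[R]_n) g h a d :
  (0 < m)%N -> (0 < n)%N ->
  (forall i j, 0 <= A i j) -> (forall i, 0 < g i) ->
  (forall i, mulmv A g i = a * g i) ->
  (forall i j, 0 <= D i j) -> (forall i, 0 < h i) ->
  (forall i, mulmv D h i = d * h i) ->
  spectral_radius (block_mx A B 0 D) = Num.max a d.
Proof.
move=> m0 n0 A0 g0 Ag D0 h0 Dh.
have ea : eigenvalue A a.
  by apply: eigenvalue_mulmv Ag; exists (Ordinal m0); rewrite gt_eqF.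
have ed : eigenvalue D d.
  by apply: eigenvalue_mulmv Dh; exists (Ordinal n0); rewrite gt_eqF.
apply: spectral_radiusE.
- rewrite le_max -(ler_pM2r (g0 (Ordinal m0))) mul0r -Ag mulmv_ge0// => j.
  exact: ltW.
- by rewrite eigenvalue_ublock; case: (leP a d) => _; rewrite ?ea ?ed ?orbT.
move=> z; rewrite /cmx map_block_mx map_mx0 eigenvalue_ublock le_max => /orP[e|e].
  by apply/orP; left; apply: eigenvalue_le A0 g0 _ e => i; rewrite Ag.
by apply/orP; right; apply: eigenvalue_le D0 h0 _ e => i; rewrite Dh.
Qed.

End SpectralRadius.

(** * Geometry of the sets J_w *)

Section EuclideanNorm.
Variables (R : realType) (q : nat).
Implicit Types x y : 'rV[R]_q.

Lemma enorm_ge0 x : 0 <= enorm x.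
Proof. exact: sqrtr_ge0. Qed.

Lemma enormN x : enorm (- x) = enorm x.
Proof. by congr Num.sqrt; apply: eq_bigr => i _; rewrite mxE sqrrN. Qed.

Lemma enormB x y : enorm (x - y) = enorm (y - x).
Proof. by rewrite -enormN opprB. Qed.

Lemma sqr_enorm x : enorm x ^+ 2 = \sum_i x 0 i ^+ 2.
Proof. by rewrite sqr_sqrtr// sumr_ge0// => i _; exact: sqr_ge0. Qed.

Lemma enorm_cauchy_schwarz x y : \sum_i x 0 i * y 0 i <= enorm x * enorm y.
Proof.
set b := \sum_i _; pose s := \sum_i x 0 i ^+ 2; pose t := \sum_i y 0 i ^+ 2.
have s0 : 0 <= s by apply: sumr_ge0 => i _; exact: sqr_ge0.
have t0 : 0 <= t by apply: sumr_ge0 => i _; exact: sqr_ge0.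
suff bst : b ^+ 2 <= s * t.
  rewrite /enorm -sqrtrM//; apply: (le_trans (ler_norm b)).
  by rewrite -sqrtr_sqr ler_wsqrtr.
have [t_eq0|tN0] := eqVneq t 0.
  rewrite t_eq0 mulr0 /b big1 ?expr0n// => i _.
  have : y 0 i ^+ 2 == 0.
    rewrite eq_le sqr_ge0 andbT -t_eq0 /t (bigD1 i)//= lerDl.
    by apply: sumr_ge0 => j _; exact: sqr_ge0.
  by rewrite sqrf_eq0 => /eqP ->; rewrite mulr0.
have t_gt0 : 0 < t by rewrite lt_neqAle eq_sym tN0.
have : 0 <= \sum_i (t * x 0 i - b * y 0 i) ^+ 2.
  by apply: sumr_ge0 => i _; exact: sqr_ge0.
have -> : \sum_i (t * x 0 i - b * y 0 i) ^+ 2 = t * (s * t - b ^+ 2).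
  transitivity (\sum_i (t ^+ 2 * x 0 i ^+ 2 - 2 * t * b * (x 0 i * y 0 i)
      + b ^+ 2 * y 0 i ^+ 2)); first by apply: eq_bigr => i _; ring.
  by rewrite big_split sumrB -!mulr_sumr -/s -/t -/b /=; ring.
by rewrite pmulr_rge0// subr_ge0.
Qed.

Lemma enormD x y : enorm (x + y) <= enorm x + enorm y.
Proof.
rewrite -(ler_pXn2r (ltn0Sn 1)) ?nnegrE ?addr_ge0 ?enorm_ge0//.
rewrite sqrrD !sqr_enorm.
under eq_bigr do rewrite mxE sqrrD.
rewrite !big_split /= lerD2r lerD2l -mulr2n lerMn2r /=.
exact: enorm_cauchy_schwarz.
Qed.

Lemma enorm_triangle z x y : enorm (x - y) <= enorm (x - z) + enorm (z - y).
Proof. by rewrite (le_trans _ (enormD _ _))// addrA subrK. Qed.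

Lemma normr_le_enorm x : `|x| <= enorm x.
Proof.
rewrite /Num.norm /= mx_normrE; apply: bigmax_le => [|[i j] _ /=].
  exact: enorm_ge0.
rewrite ord1 -sqrtr_sqr ler_wsqrtr// (bigD1 j)//= lerDl.
by apply: sumr_ge0 => k _; exact: sqr_ge0.
Qed.

Lemma enorm_le_normr x : enorm x <= Num.sqrt q%:R * `|x|.
Proof.
rewrite -(ler_pXn2r (ltn0Sn 1)) ?nnegrE ?enorm_ge0// ?mulr_ge0// ?sqrtr_ge0//.
rewrite sqr_enorm exprMn sqr_sqrtr// mulrC.
rewrite -[X in _ <= _ * X%:R](card_ord q) mulr_natr -sumr_const.
apply: ler_sum => i _; rewrite -real_normK ?num_real// lerXn2r ?nnegrE//.
rewrite [leRHS]/Num.norm /= mx_normrE.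
exact: (le_trans _ (le_bigmax _ (fun ij => `|x ij.1 ij.2|) (0, i))).
Qed.

End EuclideanNorm.

(** The source of constants that are uniform over letters, pairs or triples of letters: a minimum of
    finitely many, started at 1. *)
Lemma finite_uniform_pos (R : realType) (I : finType) (P : I -> R -> Prop) :
  (forall i, exists d, 0 < d /\ P i d) ->
  (forall i d d', d' <= d -> P i d -> P i d') ->
  exists d, 0 < d /\ forall i, P i d.
Proof.
move=> /choice[d dP] mono; exists (\big[Num.min/1]_i d i); split.
  by apply: lt_bigmin => // i _; case: (dP i).
by move=> i; apply: mono (proj2 (dP i)); exact: bigmin_le_cond.
Qed.

Lemma contraction_bound (R : realType) (I : finType) (e : rel I) (s : I -> I -> R) :
  (forall i j, e i j -> 0 < s i j < 1) ->
  exists k, [/\ 0 < k, k < 1 & forall i j, e i j -> s i j <= k].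
Proof.
move=> s01; have [d [d0 dP]] : exists d, 0 < d /\
    forall ij : I * I, e ij.1 ij.2 -> s ij.1 ij.2 <= 1 - d.
  apply: finite_uniform_pos => [[i j]|ij d d' dd' sd eij] /=.
    have [/s01/andP[_ s1]|_] := boolP (e i j); last by exists 1.
    by exists (1 - s i j); rewrite subr_gt0 s1 opprB addrC subrK.
  by rewrite (le_trans (sd eij))// lerB.
(* [1 - d] need not be positive; the maximum with 1/2 makes it so. *)
exists (Num.max (1 - d) 2^-1); split.
- by rewrite lt_max invr_gt0 ltr0n orbT.
- by rewrite gt_max ltrBlDr ltrDl d0 invf_lt1 ?ltr1n.
- by move=> i j eij; rewrite le_max (dP (i, j)).
Qed.

Lemma expr_small (R : realType) (k e : R) : 0 < k -> k < 1 -> 0 < e ->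
  exists n, k ^+ n < e.
Proof.
move=> k0 k1 e0.
have : k ^+ n @[n --> \oo] --> (0 : R) by apply: cvg_expr; rewrite gtr0_norm.
move=> /cvgrPdist_lt/(_ e e0)[n _ /(_ n (leqnn n))] /=.
by rewrite sub0r normrN ger0_norm ?exprn_ge0 ?ltW// => ?; exists n.
Qed.

Section WordSets.
Variables (R : realType) (q N : nat).
Variables (J : 'I_N -> set 'rV[R]_q) (T : 'I_N -> 'I_N -> 'rV[R]_q -> 'rV[R]_q).
Variables (s : 'I_N -> 'I_N -> R) (adm : rel 'I_N).
Hypothesis J_neq0 : forall i, J i !=set0.
Hypothesis J_disj : forall i j, i != j -> J i `&` J j = set0.
Hypothesis J_compact : forall i, compact (J i).
Hypothesis s_contr : forall i j, adm i j -> 0 < s i j < 1.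
Hypothesis T_sim : forall i j, adm i j -> similarity (s i j) (T i j).
Hypothesis T_sub : forall i j, adm i j -> T i j @` J j `<=` J i.
Hypothesis T_disj : forall i j k, adm i j -> adm i k -> j != k ->
  T i j @` J j `&` T i k @` J k = set0.

Fixpoint word_ratio (i : 'I_N) (w : seq 'I_N) : R :=
  if w is j :: w' then s i j * word_ratio j w' else 1.

Lemma word_ratio_gt0 i w : path adm i w -> 0 < word_ratio i w.
Proof.
elim: w i => [|j w IH] i //= /andP[ij jw].
by rewrite mulr_gt0 ?IH//; case/andP: (s_contr ij).
Qed.

Lemma word_ratio_le1 i w : path adm i w -> word_ratio i w <= 1.
Proof.
elim: w i => [|j w IH] i //= /andP[ij jw].
have /andP[s0 s1] := s_contr ij.
by apply: mulr_ile1; [exact: ltW | exact/ltW/word_ratio_gt0 | exact: ltW | exact: IH].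
Qed.

Lemma word_ratio_le k i w : (forall i j, adm i j -> s i j <= k) ->
  path adm i w -> word_ratio i w <= k ^+ size w.
Proof.
move=> sk; elim: w i => [|j w IH] i //= /andP[ij jw]; rewrite exprS.
by apply: ler_pM; [case/andP: (s_contr ij) => /ltW | exact/ltW/word_ratio_gt0
  | exact: sk | exact: IH].
Qed.

Lemma similarity_continuous c f : similarity c f -> continuous (f : 'rV[R]_q -> 'rV[R]_q).
Proof.
move=> sf x; apply/(@cvgrPdist_le _ _ _ (nbhs x)) => e e0.
pose M := `|c| * Num.sqrt q%:R + 1.
have M0 : 0 < M by rewrite ltr_wpDl// mulr_ge0// sqrtr_ge0.
near=> y; apply: (le_trans (normr_le_enorm _)); rewrite sf.
apply: (@le_trans _ _ (M * `|x - y|)).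
  rewrite mulrDl mul1r ler_wpDr// -mulrA.
  apply: (@le_trans _ _ (`|c| * enorm (x - y))).
    by rewrite ler_wpM2r ?enorm_ge0// ler_norm.
  by rewrite ler_wpM2l// enorm_le_normr.
rewrite mulrC -ler_pdivlMr//; near: y.
by apply: cvgr_dist_le => //; rewrite divr_gt0.
Unshelve. all: by end_near. Qed.

Lemma word_set1 i : word_set T J [:: i] = J i.
Proof. exact: image_id. Qed.

Lemma word_set_cons i j w :
  word_set T J (i :: j :: w) = T i j @` word_set T J (j :: w).
Proof. by rewrite /= image_comp. Qed.

Lemma word_set_neq0 i w : word_set T J (i :: w) !=set0.
Proof. exact: image_nonempty. Qed.

Lemma word_set_compact i w : path adm i w -> compact (word_set T J (i :: w)).
Proof.
elim: w i => [|j w IH] i; first by move=> _; rewrite word_set1.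
move=> /= /andP[ij jw]; rewrite -/(word_set T J (i :: j :: w)) word_set_cons.
apply: continuous_compact; last exact: IH.
by apply: continuous_subspaceT; exact: similarity_continuous (T_sim ij).
Qed.

Lemma word_set_sub i w : path adm i w -> word_set T J (i :: w) `<=` J i.
Proof.
elim: w i => [|j w IH] i; first by move=> _; rewrite word_set1.
move=> /andP[ij jw]; rewrite word_set_cons.
apply: subset_trans (T_sub ij); apply: image_subset; exact: IH.
Qed.

Lemma word_set_cat i u v : path adm i (u ++ v) ->
  word_set T J (i :: u ++ v) `<=` word_set T J (i :: u).
Proof.
elim: u i => [|j u IH] i; first by move=> /word_set_sub; rewrite word_set1.
rewrite [path _ _ _]/= => /andP[ij juv].
by rewrite cat_cons !word_set_cons; apply: image_subset; exact: IH.
Qed.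

Lemma word_set_diam : exists D, 0 < D /\ forall i w x y, path adm i w ->
  word_set T J (i :: w) x -> word_set T J (i :: w) y ->
  enorm (x - y) <= D * word_ratio i w.
Proof.
have bdJ i : exists M, forall x, J i x -> `|x| <= M.
  have [M [_ /(_ (M + 1))]] := compact_bounded (@J_compact i).
  by rewrite ltrDl ltr01 => /(_ isT) MJ; exists (M + 1).
have [M MJ] := choice bdJ.
pose D := 1 + \sum_i Num.sqrt q%:R * (`|M i| + `|M i|).
have DJ i : Num.sqrt q%:R * (M i + M i) <= D.
  have T0 j : 0 <= Num.sqrt q%:R * (`|M j| + `|M j|).
    by rewrite mulr_ge0// ?sqrtr_ge0// addr_ge0.
  rewrite /D (bigD1 i)//=; apply: ler_wpDl => //; apply: ler_wpDr.
    exact: sumr_ge0.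
  by rewrite ler_wpM2l ?sqrtr_ge0// lerD// ler_norm.
exists D; split.
  apply: ltr_pwDl => //; apply: sumr_ge0 => j _.
  by rewrite mulr_ge0// ?sqrtr_ge0// addr_ge0.
move=> i w; elim: w i => [|j w IH] i x y.
  rewrite word_set1 mulr1 => _ xJ yJ; apply: le_trans (DJ i).
  rewrite (le_trans (enorm_le_normr _))// ler_wpM2l ?sqrtr_ge0//.
  by rewrite (le_trans (ler_normB _ _))// lerD// MJ.
move=> /andP[ij jw]; rewrite word_set_cons => -[x' xw <-] [y' yw <-].
rewrite (T_sim ij) /= mulrCA ler_wpM2l ?IH//.
by case/andP: (s_contr ij) => /ltW.
Qed.

Lemma compact_disjoint_dist (A B : set 'rV[R]_q) : compact A -> compact B ->
  A `&` B = set0 ->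
  exists d, 0 < d /\ forall x y, A x -> B y -> d <= enorm (x - y).
Proof.
move=> cA cB AB0; have [AxB0|/set0P AxB0] := eqVneq (A `*` B) set0.
    exists 1; split => // x y Ax By; suff : (A `*` B) (x, y) by rewrite AxB0.
    by split.
have cf : {within A `*` B, continuous (fun z : 'rV[R]_q * 'rV[R]_q => `|z.1 - z.2|)}.
  apply: continuous_subspaceT => z; apply: cvg_norm.
  by apply: cvgB; [exact: cvg_fst | exact: cvg_snd].
have [[a b] /[!inE] -[/= Aa Bb] dmin] :=
  compact_EVT_min AxB0 (compact_setX cA cB) cf.
exists `|a - b|; split.
  rewrite normr_gt0 subr_eq0; apply/eqP => ab.
  have : (A `&` B) a by split => //; rewrite ab.
  by rewrite AB0.
move=> x y Ax By; apply: le_trans (normr_le_enorm _).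
by apply: (dmin (x, y)); rewrite inE.
Qed.

(** The common beginning is removed letter by letter, each [T i j] scaling distances exactly by
    [s i j]. At the first difference two distinct sets [J i], or two distinct images inside the same
    [J i], have positive distance by compactness, and the remaining ratio is at most 1. *)
Lemma word_set_separated : exists d, 0 < d /\ forall i u i' v x y,
  path adm i u -> path adm i' v ->
  ~~ prefix (i :: u) (i' :: v) -> ~~ prefix (i' :: v) (i :: u) ->
  word_set T J (i :: u) x -> word_set T J (i' :: v) y ->
  d * word_ratio i u <= enorm (x - y).
Proof.
have [d1 [d1_gt0 d1P]] : exists d, 0 < d /\ forall ij : 'I_N * 'I_N,
    ij.1 != ij.2 -> forall x y, J ij.1 x -> J ij.2 y -> d <= enorm (x - y).
  apply: finite_uniform_pos => [[i j] /=|ij d d' dd' P ne x y Jx Jy].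
    have [->|ij] := eqVneq i j; first by exists 1.
    have [d [d0 dP]] := compact_disjoint_dist (@J_compact i) (@J_compact j) (J_disj ij).
    by exists d.
  exact: le_trans dd' (P ne x y Jx Jy).
have cT i j : adm i j -> compact (T i j @` J j).
  move=> ij; apply: continuous_compact => //.
  by apply: continuous_subspaceT; exact: similarity_continuous (T_sim ij).
have [d2 [d2_gt0 d2P]] : exists d, 0 < d /\ forall ijk : 'I_N * 'I_N * 'I_N,
    adm ijk.1.1 ijk.1.2 -> adm ijk.1.1 ijk.2 -> ijk.1.2 != ijk.2 ->
    forall x y, (T ijk.1.1 ijk.1.2 @` J ijk.1.2) x ->
      (T ijk.1.1 ijk.2 @` J ijk.2) y -> d <= enorm (x - y).
  apply: finite_uniform_pos => [[[i j] k]|ijk d d' dd' P ij ik ne x y Jx Jy].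
    rewrite [_.1.1]/= [_.1.2]/= [_.2]/=.
    have [|ij] := boolP (adm i j); last by exists 1.
    have [|ik] := boolP (adm i k); last by exists 1.
    have [->|jk] := eqVneq j k; first by exists 1.
    move=> ik ij.
    have [d [d0 dP]] := compact_disjoint_dist (cT _ _ ij) (cT _ _ ik) (T_disj ij ik jk).
    by exists d.
  exact: le_trans dd' (P ij ik ne x y Jx Jy).
pose d := Num.min d1 d2; have d0 : 0 < d by rewrite lt_min d1_gt0.
exists d; split => // i u; elim: u i => [|j u IH] i i' v x y iu iv uv vu xu yv.
  have ii' : i != i'.
    by apply: contra uv => /eqP ->; rewrite prefix_cons eqxx prefix0s.
  rewrite mulr1 (@le_trans _ _ d1) ?ge_min ?lexx//.
  by apply: (d1P (i, i')) => //; [exact: word_set_sub xu | exact: word_set_sub yv].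
have [ii'|ii'] := eqVneq i i'; last first.
  apply: (@le_trans _ _ d1).
    rewrite (le_trans (ler_piMr (ltW d0) (word_ratio_le1 iu)))//.
    by rewrite ge_min lexx.
  by apply: (d1P (i, i')) => //; [exact: word_set_sub xu | exact: word_set_sub yv].
move: ii' iv uv vu yv => <- {i'}.
case: v => [|k v] iv uv vu yv; first by rewrite prefix_cons eqxx prefix0s in vu.
move: (iu) (iv) => /= /andP[ij ju] /andP[ik kv].
rewrite -/(word_ratio i (j :: u)).
move: xu yv; rewrite !word_set_cons => -[x' x'u <-] [y' y'v <-].
have [jk|jk] := eqVneq j k; last first.
  apply: (@le_trans _ _ d2).
    rewrite (le_trans (ler_piMr (ltW d0) (word_ratio_le1 iu)))//.
    by rewrite ge_min lexx orbT.
  apply: (d2P (i, j, k)) => //=.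
    by exists x' => //; exact: word_set_sub x'u.
  by exists y' => //; exact: word_set_sub y'v.
move: jk y'v kv uv vu {ik iv} => <- y'v jv; rewrite !prefix_cons !eqxx /= => uv vu.
rewrite (T_sim ij) mulrCA ler_wpM2l//; first by case/andP: (s_contr ij) => /ltW.
by apply: (IH j j v) => //; rewrite prefix_cons eqxx.
Qed.

End WordSets.

(** * The radius of the entrywise powers of a matrix *)

Lemma powR_decr (R : realType) (a x y : R) : 0 < a -> a <= 1 -> x <= y ->
  a `^ y <= a `^ x.
Proof.
move=> a0 a1 xy; rewrite /powR gt_eqF// ler_expR.
by rewrite ler_wnM2r// -ln1 ler_ln ?posrE.
Qed.

Section PowerMatrix.
Variables (R : realType) (n : nat) (b : 'M[R]_n) (k : R).
Hypothesis n_gt0 : (0 < n)%N.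
Hypothesis b_ge0 : forall i j, 0 <= b i j.
Hypothesis b_irr : irreducible_mx b.
Hypothesis k_gt0 : 0 < k.
Hypothesis k_lt1 : k < 1.
Hypothesis b_lek : forall i j, b i j <= k.

Definition pow_mx (t : R) : 'M[R]_n := \matrix_(i, j) (b i j `^ t).
Definition pow_radius t := spectral_radius (pow_mx t).

Lemma pow_mx_ge0 t i j : 0 <= pow_mx t i j.
Proof. by rewrite mxE powR_ge0. Qed.

(** An entry of a power is positive exactly when some path of that length has positive entries, so
    irreducibility is a matter of the support only. *)
Lemma irreducible_support (A : 'M[R]_n) : (forall i j, 0 <= A i j) ->
  (forall i j, 0 < b i j -> 0 < A i j) -> irreducible_mx A.
Proof.
move=> A0 bA i j; have [m [m0 bm]] := b_irr i j; exists m; split => // {m0}.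
elim: m i j bm => [|m IH] i j; first by rewrite !expr0.
rewrite !exprS !mxE => bm.
have [l /andP[bil blj]] : exists l, (0 < b i l) && (0 < (b ^+ m) l j).
  apply: contrapT => /forallNP nl; suff : \sum_l b i l * (b ^+ m) l j = 0.
    by move=> bm0; rewrite bm0 ltxx in bm.
  apply: big1 => l _; apply/eqP; rewrite mulf_eq0.
  have := nl l; rewrite !lt_def b_ge0 expmx_ge0// !andbT => /negP.
  by rewrite negb_and !negbK.
rewrite (bigD1 l)//= ltr_pwDl//; first by rewrite mulr_gt0 ?bA ?IH.
by apply: sumr_ge0 => l' _; rewrite mulr_ge0// expmx_ge0.
Qed.

Lemma pow_perron t : exists h, (forall i, 0 < h i) /\
  forall i, mulmv (pow_mx t) h i = pow_radius t * h i.
Proof.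
have irr : irreducible_mx (pow_mx t).
  apply: irreducible_support; first exact: pow_mx_ge0.
  by move=> i j bij; rewrite mxE powR_gt0.
have [l [h [h0 Ah]]] := perron n_gt0 (pow_mx_ge0 t) irr.
exists h; split => // i.
by rewrite /pow_radius (spectral_radius_perron n_gt0 (pow_mx_ge0 t) h0 Ah).
Qed.

Lemma exists_entry_bound : exists m, [/\ 0 < m, m <= k & forall i j, 0 < b i j -> m <= b i j].
Proof.
have [d [d0 dP]] : exists d, 0 < d /\ forall ij : 'I_n * 'I_n,
    0 < b ij.1 ij.2 -> d <= b ij.1 ij.2.
  apply: finite_uniform_pos => [[i j] /=|ij d d' dd' db /db]; last exact: le_trans.
  have [bij|_] := boolP (0 < b i j); last by exists 1.
  by exists (b i j).
exists (Num.min d k); split; first by rewrite lt_min d0.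
- by rewrite ge_min lexx orbT.
- by move=> i j bij; rewrite ge_min (dP (i, j)).
Qed.

Lemma pow_radius_gt0 t : 0 < pow_radius t.
Proof.
have [h [h0 Ah]] := pow_perron t; pose i := Ordinal n_gt0.
rewrite -(pmulr_lgt0 _ (h0 i)) -Ah.
have [m [m0 bm]] := b_irr i i.
have [j bij] : exists j, 0 < b i j.
  apply: contrapT => /forallNP nb; case: m m0 bm => // m _.
  rewrite exprS mxE big1 ?ltxx// => j _.
  have /negP := nb j; rewrite -leNgt => bij.
  by rewrite (le_anti (introT andP (conj bij (b_ge0 i j)))) mul0r.
rewrite /mulmv (bigD1 j)//= ltr_pwDl//; first by rewrite mxE mulr_gt0 ?powR_gt0.
by apply: sumr_ge0 => l _; rewrite mulr_ge0 ?pow_mx_ge0// ltW.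
Qed.

(** Entrywise the power [t'] of [b] is at most [k ^ (t' - t)] times the power [t], and the Perron
    vectors of both matrices transfer this to the radii. As [0 ^ 0 = 1], the condition [0 < t] is
    what keeps zero entries zero. *)
Lemma pow_radius_upper t t' : 0 < t -> t <= t' ->
  pow_radius t' <= k `^ (t' - t) * pow_radius t.
Proof.
move=> t0 tt'; have [h [h0 Ah]] := pow_perron t; have [h' [h'0 Ah']] := pow_perron t'.
apply: (@collatz_wielandt_le _ _ (pow_mx t') h h' _ _ n_gt0) => //.
- exact: pow_mx_ge0.
- by move=> i; rewrite Ah'.
move=> i; rewrite -mulrA -Ah /mulmv mulr_sumr; apply: ler_sum => j _.
rewrite mulrA ler_pM2r ?h0// !mxE.
have t'N0 : t' != 0 by rewrite gt_eqF// (lt_le_trans t0).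
have [->|bN0] := eqVneq (b i j) 0.
  by rewrite (powR0 t'N0) mulr_ge0 ?powR_ge0.
have -> : b i j `^ t' = b i j `^ (t' - t) * b i j `^ t.
    by rewrite -powRD ?subrK// bN0 implybT.
  rewrite ler_wpM2r ?powR_ge0//.
by apply: ge0_ler_powR; rewrite ?nnegrE ?subr_ge0// ltW.
Qed.

(** The opposite estimate, with the least positive entry in place of the largest; it stands in for
    continuity when the root is located. *)
Lemma pow_radius_lower m t t' : 0 < m -> (forall i j, 0 < b i j -> m <= b i j) ->
  0 < t -> t <= t' -> m `^ (t' - t) * pow_radius t <= pow_radius t'.
Proof.
move=> m0 mb t0 tt'; have [h [h0 Ah]] := pow_perron t; have [h' [h'0 Ah']] := pow_perron t'.
apply: (@collatz_wielandt_le _ _ (pow_mx t') h' h _ _ n_gt0) => //.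
- exact: pow_mx_ge0.
- move=> i; rewrite -mulrA -Ah /mulmv mulr_sumr; apply: ler_sum => j _.
  rewrite mulrA ler_pM2r ?h0// !mxE.
  have [->|bN0] := eqVneq (b i j) 0.
    by rewrite (powR0 (lt0r_neq0 t0)) mulr0 powR_ge0.
  have b0 : 0 < b i j by rewrite lt_def bN0 b_ge0.
  have -> : b i j `^ t' = b i j `^ (t' - t) * b i j `^ t.
    by rewrite -powRD ?subrK// bN0 implybT.
  rewrite ler_wpM2r ?powR_ge0//.
  by apply: ge0_ler_powR; rewrite ?nnegrE ?subr_ge0// ?mb// ltW.
- by move=> i; rewrite Ah'.
Qed.

Lemma pow_radius_decr t t' : 0 < t -> t < t' -> pow_radius t' < pow_radius t.
Proof.
move=> t0 tt'; apply: le_lt_trans (pow_radius_upper t0 (ltW tt')) _.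
rewrite gtr_pMl ?pow_radius_gt0//.
have : k `^ (t' - t) < 1 `^ (t' - t).
  by apply: gt0_ltr_powR; rewrite ?nnegrE ?subr_gt0// ltW.
by rewrite powR1.
Qed.

Lemma powR_logarithm (m x : R) : 0 < m -> m < 1 -> 0 < x -> m `^ (ln x / ln m) = x.
Proof.
move=> m0 m1 x0; rewrite /powR gt_eqF// divfK ?lnK ?posrE//.
by rewrite lt_eqF// ln_lt0// m0.
Qed.

(** With two positive entries in each row the radius exceeds 1 near [t = 0]. *)
Lemma pow_radius_root :
  (forall i, (1 < #|[pred j | (0 < b i j)%R]|)%N) ->
  (forall i, \sum_j b i j < 1) ->
  exists t, [/\ 0 < t, t < 1 & pow_radius t = 1].
Proof.
move=> row2 row1.
have [m [m0 mk mb]] := exists_entry_bound.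
have m1 : m < 1 by exact: le_lt_trans k_lt1.
have lnm : ln m < 0 by rewrite ln_lt0// m0.
have r1 t : 1 <= t -> pow_radius t < 1.
  move=> t1; have [h [h0 Ah]] := pow_perron t.
  apply: (@collatz_wielandt_lt _ _ (pow_mx t) (fun=> 1) h _ _ n_gt0) => //.
  - exact: pow_mx_ge0.
  - by move=> i; rewrite Ah.
  move=> i; rewrite mulr1; apply: le_lt_trans (row1 i).
  apply: ler_sum => j _; rewrite mulr1 mxE.
  have [->|bN0] := eqVneq (b i j) 0.
    by rewrite powR0// gt_eqF// (lt_le_trans ltr01).
  rewrite -[leRHS](@powRr1 _ (b i j))//; apply: powR_decr => //.
    by rewrite lt_def bN0 b_ge0.
  by rewrite (le_trans (b_lek i j))// ltW.
(* The root will be the supremum of [S]. *)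
pose S := [set t | 0 < t /\ 1 <= pow_radius t].
have S1 : ubound S 1.
  by move=> t [t0 rt]; rewrite leNgt; apply/negP => /ltW/r1; rewrite ltNge rt.
have S0 : S !=set0.
  (* Chosen so that [m ^ t = 1/2]: two positive entries in a row then contribute at least 1, and the
     constant vector 1 shows that the radius is at least 1. *)
  pose t := ln 2^-1 / ln m; have t0 : 0 < t.
    by rewrite /t nmulr_rgt0 ?invr_lt0// ln_lt0// invr_gt0 ltr0n invf_lt1 ?ltr1n.
  exists t; split => //; have [h [h0 Ah]] := pow_perron t.
  apply: (@collatz_wielandt_le _ _ (pow_mx t) h (fun=> 1) _ _ n_gt0) => //.
  - exact: pow_mx_ge0.
  - move=> i; rewrite mulr1 /mulmv.
    rewrite (bigID (fun j => 0 < b i j)) /= ler_wpDr//.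
      by apply: sumr_ge0 => j _; rewrite mulr_ge0 ?pow_mx_ge0.
    apply: (@le_trans _ _ (\sum_(j | 0 < b i j) 2^-1)).
      rewrite sumr_const -[leRHS]mulr_natl ler_pdivlMr ?ltr0n// mul1r ler_nat.
      exact: row2.
    apply: ler_sum => j bij; rewrite mulr1 mxE -(powR_logarithm m0 m1 (x := 2^-1)) ?invr_gt0//.
    by apply: ge0_ler_powR; rewrite ?nnegrE ?mb// ltW.
  - by move=> i; rewrite Ah.
have hS : has_sup S by split => //; exists 1.
have [t' [t'0 rt']] := S0.
have [t tub tadh] : exists2 t, (forall y, S y -> y <= t) &
    forall d, 0 < d -> exists2 y, S y & t - d < y.
  exists (sup S); first by move=> y Sy; apply: ub_le_sup => //; exists 1.
  by move=> d d0; exact: sup_adherent.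
have t'S : t' <= t by exact: tub.
have t0 : 0 < t by exact: lt_le_trans t'S.
have rt : pow_radius t = 1.
  apply/eqP; rewrite eq_le; apply/andP; split; rewrite leNgt; apply/negP => rt.
    (* If the radius at [t] exceeds 1, take [m ^ d] equal to its inverse: the lower estimate puts
       [t + d] into [S], beyond the supremum. *)
    have rt0 : 0 < (pow_radius t)^-1 by rewrite invr_gt0 pow_radius_gt0.
    have [d d0 md] : exists2 d, 0 < d & m `^ d = (pow_radius t)^-1.
      exists (ln (pow_radius t)^-1 / ln m); last exact: powR_logarithm.
      by rewrite nmulr_rgt0 ?invr_lt0// ln_lt0// rt0 invf_lt1 ?pow_radius_gt0.
    suff : S (t + d) by move=> /tub; rewrite leNgt ltrDl d0.
    split; first by rewrite addr_gt0.
    apply: le_trans (pow_radius_lower m0 mb t0 (t' := t + d) _); last by rewrite lerDl ltW.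
    have -> : t + d - t = d by rewrite addrAC subrr add0r.
    have rN0 : pow_radius t != 0 by rewrite gt_eqF ?pow_radius_gt0.
    by rewrite md (mulVf rN0) lexx.
  (* If the radius at [t] is below 1, let [x = m ^ d] lie strictly between. A point [y] of [S] in
     the interval from [t - d] to [t] forces the radius at [t] to be at least [m ^ (t - y) >= x]. *)
  have [x rx x1] : exists2 x, pow_radius t < x & x < 1.
    by exists ((pow_radius t + 1) / 2); rewrite midf_lt.
  have x0 : 0 < x by exact: lt_trans (pow_radius_gt0 t) rx.
  have [d d0 md] : exists2 d, 0 < d & m `^ d = x.
    exists (ln x / ln m); last exact: powR_logarithm.
    by rewrite nmulr_rgt0 ?invr_lt0// ln_lt0// x0.
  have [y [y0 ry] ty] := tadh d d0.
  have yt : y <= t by apply: tub.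
  have := pow_radius_lower m0 mb y0 yt; apply/negP; rewrite -ltNge.
  apply: (lt_le_trans rx); rewrite -[leLHS]mulr1.
  apply: ler_pM => //; first exact: ltW.
  by rewrite -md; apply: powR_decr => //; [exact: ltW | rewrite lerBlDr -lerBlDl ltW].
exists t; split => //; rewrite ltNge; apply/negP => /r1; by rewrite rt ltxx.
Qed.

End PowerMatrix.

(** * Bounds for the quantization error *)

Section QuantizationBounds.
Variables (R : realType) (q : nat).

Lemma size_le_card (X : choiceType) (A : set X) (s : seq X) k :
  (A #<= `I_k)%card -> uniq s -> (forall x, x \in s -> A x) -> (size s <= k)%N.
Proof.
move=> /pcard_leP[f] us sA; rewrite -(size_map f) -[leqRHS](size_iota 0).
apply: uniq_leq_size.
  rewrite map_inj_in_uniq// => x y xs ys.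
  by apply: (@inj _ _ _ f); rewrite inE; exact: sA.
move=> _ /mapP[x xs ->]; rewrite mem_iota add0n /=.
by have := @funS _ _ _ _ f x (sA x xs).
Qed.

Section SetDistance.
Variable alpha : set 'rV[R]_q.
Hypothesis alpha0 : alpha !=set0.

Lemma edist_set_has_inf x : has_inf [set enorm (x - a) | a in alpha].
Proof.
split; first exact: image_nonempty.
by exists 0 => _ [a _ <-]; exact: enorm_ge0.
Qed.

Lemma edist_set_le x a : alpha a -> edist_set x alpha <= enorm (x - a).
Proof.
move=> aa; apply: ge_inf; first by case: (edist_set_has_inf x).
by exists a.
Qed.

Lemma le_edist_set x c : (forall a, alpha a -> c <= enorm (x - a)) ->
  c <= edist_set x alpha.
Proof.
move=> cx; apply: lb_le_inf; first by case: (edist_set_has_inf x).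
by move=> _ [a aa <-]; exact: cx.
Qed.

Lemma edist_set_ge0 x : 0 <= edist_set x alpha.
Proof. by apply: le_edist_set => a _; exact: enorm_ge0. Qed.

Lemma edist_set_continuous : continuous (fun x : 'rV[R]_q => edist_set x alpha).
Proof.
have lip x y : edist_set x alpha - enorm (x - y) <= edist_set y alpha.
  apply: le_edist_set => a aa; rewrite lerBlDl.
  exact: le_trans (edist_set_le x aa) (enorm_triangle y _ _).
move=> x; apply/(@cvgrPdist_le _ _ _ (nbhs x)) => e e0.
pose M : R := Num.sqrt q%:R + 1.
have M0 : 0 < M by rewrite ltr_wpDl// sqrtr_ge0.
near=> y; apply: (@le_trans _ _ (M * `|x - y|)).
  apply: (@le_trans _ _ (enorm (x - y))).
    rewrite ler_norml; apply/andP; split.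
      by rewrite lerBrDr addrC enormB; exact: lip.
    by rewrite lerBlDr -lerBlDl; exact: lip.
  rewrite (le_trans (enorm_le_normr _))// ler_wpM2r//.
  by rewrite /M lerDl.
rewrite mulrC -ler_pdivlMr//; near: y.
by apply: cvgr_dist_le => //; rewrite divr_gt0.
Unshelve. all: by end_near. Qed.

Lemma edist_set_measurable r : measurable_fun [set: borelType 'rV[R]_q]
  (fun x : borelType 'rV[R]_q => (edist_set x alpha `^ r)%:E).
Proof.
apply/measurable_EFinP.
apply: (measurableT_comp (measurable_powR r)).
apply: (@measurability _ _ _ _ _ _ _ (RGenOpens.measurableE R)).
move=> _ [B [a [b ->]] <-]; rewrite setTI; apply: sub_sigma_algebra.
apply: open_comp; last exact: interval_open.
by move=> x _; exact: edist_set_continuous.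
Qed.

End SetDistance.

Variables (d : measure_display) (X : measurableType d) (nu : probability X R).
Variable f : X -> borelType 'rV[R]_q.
Hypothesis mf : measurable_fun setT f.
Let mu := pushforward nu f.

Lemma integral_step (I : Type) (s : seq I) (c : I -> R) (A : I -> set X) :
  (forall u, 0 <= c u) -> (forall u, measurable (A u)) ->
  (\int[nu]_x (\sum_(u <- s) c u * \1_(A u) x)%:E =
   \sum_(u <- s) (c u)%:E * nu (A u))%E.
Proof.
move=> c0 mA; under eq_integral do rewrite -sumEFin.
rewrite ge0_integral_sum//.
- apply: eq_bigr => u _.
  under eq_integral do rewrite EFinM.
  rewrite ge0_integralZl//; last 2 first.
  + by apply/measurable_EFinP; exact: measurable_indic.
  + by rewrite lee_fin.
  by rewrite integral_indic// setIT.
- by move=> u; apply/measurable_EFinP; apply: measurable_funM => //; exact: measurable_indic.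
- by move=> u x _; rewrite lee_fin mulr_ge0.
Qed.

Lemma step_measurable (I : Type) (s : seq I) (c : I -> R) (A : I -> set X) :
  (forall u, measurable (A u)) ->
  measurable_fun setT (fun x => (\sum_(u <- s) c u * \1_(A u) x)%:E).
Proof.
move=> mA; apply/measurable_EFinP; apply: measurable_sum => u.
by apply: measurable_funM => //; exact: measurable_indic.
Qed.

Let integral_pushforward_edist alpha r : alpha !=set0 ->
  (\int[mu]_x (edist_set x alpha `^ r)%:E =
   \int[nu]_x (edist_set (f x) alpha `^ r)%:E)%E.
Proof.
move=> alpha0; rewrite ge0_integral_pushforward//.
  exact: edist_set_measurable.
by move=> y _; rewrite lee_fin powR_ge0.
Qed.

Let edist_comp_measurable alpha r : alpha !=set0 ->
  measurable_fun setT (fun x => (edist_set (f x) alpha `^ r)%:E).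
Proof.
move=> alpha0.
exact: (measurableT_comp (@edist_set_measurable _ alpha0 r) mf).
Qed.

(** The centres [p u] form the set [alpha]. Overlaps of the sets [A u] do no harm, since the sum
    over all of them dominates the integrand anyway. *)
Lemma quant_err_pow_le (I : eqType) (s : seq I) (c : I -> R) (p : I -> 'rV[R]_q)
    (A : I -> set X) r k : 0 < r -> s != [::] -> (size s <= k)%N ->
  (forall u, measurable (A u)) ->
  (forall x, exists2 u, u \in s & A u x /\ enorm (f x - p u) <= c u) ->
  (quant_err_pow mu r k <= \sum_(u <- s) (c u `^ r)%:E * nu (A u))%E.
Proof.
move=> r0 s0 sk mA cover.
pose alpha : set 'rV[R]_q := [set nth 0 (map p s) i | i in `I_(size s)].
have alphaP u : u \in s -> alpha (p u).
  move=> us; exists (index (p u) (map p s)); last by rewrite nth_index ?map_f.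
  by rewrite /= -(size_map p) index_mem map_f.
have alpha0 : alpha !=set0.
  case: s s0 {sk cover} @alpha alphaP => // u s _ alpha alphaP.
  by exists (p u); apply: alphaP; rewrite inE eqxx.
apply: (@le_trans _ _ (\int[mu]_x (edist_set x alpha `^ r)%:E)%E).
  apply: ereal_inf_lbound; exists alpha => //; split => //.
  apply: (@card_le_trans _ _ _ `I_(size s)); last by rewrite card_le_II.
  exact: card_image_le.
rewrite integral_pushforward_edist// -integral_step//; last first.
  by move=> u; exact: powR_ge0.
apply: ge0_le_integral => //.
- by move=> x _; rewrite lee_fin powR_ge0.
- exact: edist_comp_measurable.
- exact: step_measurable.
move=> x _; rewrite lee_fin; have [u us [Aux fxu]] := cover x.
rewrite (big_rem u)//= indicE mem_set// mulr1 ler_wpDr//.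
  by apply: sumr_ge0 => v _; rewrite mulr_ge0// powR_ge0.
apply: (ge0_ler_powR (ltW r0)); rewrite ?nnegrE ?edist_set_ge0//.
  exact: le_trans (enorm_ge0 _) fxu.
by apply: le_trans fxu; apply: edist_set_le => //; exact: alphaP.
Qed.

(** Pigeonhole: an index is bad if some point of [alpha] comes within [c u] of the image of [B u].
    By separation distinct bad indices use distinct points, so at most [k] of the [2 k] indices are
    bad, and each good one contributes at least [e]. *)
Lemma quant_err_pow_ge (I : choiceType) (s : seq I) (c : I -> R) (B : I -> set X)
    r k e : 0 < r -> uniq s -> (2 * k <= size s)%N -> 0 <= e ->
  (forall u, u \in s -> 0 <= c u) -> (forall u, measurable (B u)) ->
  (forall u v x y a, u \in s -> v \in s -> B u x -> B v y ->
    enorm (f x - a) < c u -> enorm (f y - a) < c v -> u = v) ->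
  (forall u v x, u \in s -> v \in s -> B u x -> B v x -> u = v) ->
  (forall u, u \in s -> (e%:E <= (c u `^ r)%:E * nu (B u))%E) ->
  ((k%:R * e)%:E <= quant_err_pow mu r k)%E.
Proof.
move=> r0 us sk e0 c0 mB sep disj ec.
apply/ereal_infP => _ [alpha [alpha0 alphak] <-].
pose bad u := `[< exists a, exists x, [/\ alpha a, B u x & enorm (f x - a) < c u] >].
have [g gP] : exists g : I -> 'rV[R]_q, forall u, bad u ->
    exists x, [/\ alpha (g u), B u x & enorm (f x - g u) < c u].
  have : forall u, exists a, bad u ->
      exists x, [/\ alpha a, B u x & enorm (f x - a) < c u].
    move=> u; have [/asboolP[a aP]|_] := boolP (bad u); last by exists 0.
    by exists a.
  by move=> /choice[g gP]; exists g.
have badk : (size [seq u <- s | bad u] <= k)%N.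
  rewrite -(size_map g); apply: size_le_card alphak _ _.
    rewrite map_inj_in_uniq ?filter_uniq// => u v.
    rewrite !mem_filter => /andP[/gP[x [_ ux xg]] us'] /andP[/gP[y [_ vy yg]] vs] guv.
    by apply: (sep u v x y (g u)) => //; rewrite guv.
  by move=> _ /mapP[u + ->]; rewrite mem_filter => /andP[/gP[x []]].
pose good := [seq u <- s | ~~ bad u].
have goodk : (k <= size good)%N.
  move: sk; rewrite -(count_predC bad s) -!size_filter mul2n -addnn => sk.
  by rewrite -(leq_add2l k) (leq_trans sk)// leq_add2r.
rewrite integral_pushforward_edist//.
apply: (@le_trans _ _ (\int[nu]_x (\sum_(u <- good) c u `^ r * \1_(B u) x)%:E)%E).
  rewrite integral_step => [|u|//]; last exact: powR_ge0.
  apply: (@le_trans _ _ (\sum_(u <- good) e%:E)%E).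
    rewrite sumEFin lee_fin big_const_seq iter_addr_0 count_predT.
    by rewrite -[leRHS]mulr_natl ler_wpM2r ?ler_nat.
  rewrite big_seq [leRHS]big_seq; apply: lee_sum => u.
  by rewrite mem_filter => /andP[_]; exact: ec.
apply: ge0_le_integral => //.
- by move=> x _; rewrite lee_fin sumr_ge0// => u _; rewrite mulr_ge0// powR_ge0.
- exact: step_measurable.
- exact: edist_comp_measurable.
move=> x _; rewrite lee_fin.
have [[u [ug Bux]]|noB] := pselect (exists u, u \in good /\ B u x); last first.
  rewrite big_seq big1 ?powR_ge0// => u ug; rewrite indicE memNset ?mulr0// => Bux.
  by apply: noB; exists u.
have ug' : u \in s by move: ug; rewrite mem_filter => /andP[].
rewrite (bigD1_seq u)//= ?filter_uniq// indicE mem_set// mulr1.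
rewrite big_seq_cond big1 ?addr0 => [|v /andP[vg vu]]; last first.
  rewrite indicE memNset ?mulr0// => Bvx; case/eqP: vu.
  by apply: (disj v u x) => //; move: vg; rewrite mem_filter => /andP[].
apply: (ge0_ler_powR (ltW r0)); rewrite ?nnegrE ?edist_set_ge0 ?c0//.
apply: le_edist_set => // a aa; rewrite leNgt; apply/negP => xa.
move: ug; rewrite mem_filter => /andP[/negP + _]; apply.
by apply/asboolP; exists a, x.
Qed.

End QuantizationBounds.

(** * Words over the two alphabets and cylinders of the path space *)

Section BaseIndex.
Variable N : nat.

Lemma base_lshift (i : 'I_N) : base (lshift N i) = i.
Proof. by rewrite /base -[lshift _ _]/(unsplit (inl i)) unsplitK. Qed.

Lemma base_rshift (i : 'I_N) : base (rshift N i) = i.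
Proof. by rewrite /base -[rshift _ _]/(unsplit (inr i)) unsplitK. Qed.

Lemma baseP (i : 'I_(N + N)) : i = lshift N (base i) \/ i = rshift N (base i).
Proof.
rewrite -(splitK i); case: (fintype.split i) => j.
  by left; rewrite base_lshift.
by right; rewrite base_rshift.
Qed.

Variable G : digraph N.

Definition adm : rel 'I_N := fun i j => `[< admissible2 G i j >].

Lemma edge_adm i j : G i j -> adm (base i) (base j).
Proof.
move=> ij; apply/asboolP; exists (i, j); split => //=.
by case: (baseP i) => <-; case: (baseP j) => <-; tauto.
Qed.

Lemma path_adm i w : path G i w -> path adm (base i) (map (@base N) w).
Proof. by elim: w i => //= j w IH i /andP[/edge_adm -> /IH]. Qed.

End BaseIndex.

Lemma word_set_map (R : realType) q (I I' : Type) (g : I -> I')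
    (T : I' -> I' -> 'rV[R]_q -> 'rV[R]_q) (J : I' -> set 'rV[R]_q) w :
  word_set (fun i j => T (g i) (g j)) (J \o g) w = word_set T J (map g w).
Proof.
case: w => //= i w; rewrite last_map /=.
congr (image _ _); elim: w i => //= j w IH i.
by rewrite IH.
Qed.

Section PathMeasure.
Variables (N : nat) (G : digraph N).
Local Notation X := (path_space G).
Implicit Types (x : X).

Lemma path_edge x k : G (\val x k) (\val x k.+1).
Proof. by have := valP x; rewrite inE => /(_ k). Qed.

Lemma path_mkseq x k : path G (\val x 0%N) (mkseq (fun h => \val x h.+1) k).
Proof.
suff H h : path G (\val x h) (mkseq (fun m => \val x (h + m).+1) k).
  exact: (H 0%N).
elim: k h => // k IH h; rewrite /mkseq /= addn0 path_edge /=.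
rewrite (iotaDl 1 0) -map_comp.
have -> : map ((fun m => \val x (h + m).+1) \o addn 1) (iota 0 k) =
    mkseq (fun m => \val x (h.+1 + m).+1) k.
  by apply: eq_map => m /=; rewrite add1n addnS.
exact: IH.
Qed.

Lemma mkseq_cons (T : Type) (f : nat -> T) k :
  mkseq f k.+1 = f 0%N :: mkseq (fun h => f h.+1) k.
Proof. by rewrite /mkseq /= (iotaDl 1 0) -map_comp. Qed.

Lemma mkseqD (T : Type) (f : nat -> T) k l :
  mkseq f (k + l) = mkseq f k ++ mkseq (fun h => f (k + h)%N) l.
Proof. by rewrite /mkseq iotaD map_cat add0n -[X in iota X l]addn0 iotaDl -map_comp. Qed.

Lemma coord_open k v : open [set x : X | \val x k = v].
Proof.
pose pr := fun f : {ptws nat -> discrete_topology 'I_(N + N)} => f k.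
have -> : [set x : X | \val x k = v] = (\val : X -> _) @^-1` (pr @^-1` [set v]) by [].
apply: open_comp => [x _|]; first exact: initial_continuous.
apply: open_comp => [f _|]; last exact: discrete_open.
exact: (@proj_continuous nat (fun=> discrete_topology 'I_(N + N)) k).
Qed.

Lemma cylinder_mkseq x y n :
  cylinder G (mkseq (\val x) n) y <-> mkseq (\val y) n = mkseq (\val x) n.
Proof. by rewrite /cylinder /= size_mkseq. Qed.

Lemma cylinder_open w : open (cylinder G w).
Proof.
elim/last_ind: w => [|w v IH].
  rewrite (_ : cylinder G [::] = setT); first exact: openT.
  by apply/seteqP; split.
rewrite (_ : cylinder G (rcons w v) =
    cylinder G w `&` [set x : X | \val x (size w) = v]).
  by apply: openI => //; exact: coord_open.
apply/seteqP; split=> x; rewrite /cylinder /= size_rcons mkseqS.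
  by move=> /rcons_inj[-> ->].
by move=> [-> ->].
Qed.

Lemma cylinder_measurable w :
  measurable (cylinder G w : set (borelType X)).
Proof. by apply: sub_sigma_algebra; exact: cylinder_open. Qed.

End PathMeasure.

(** * The coding map *)

Section Coding.
Variables (R : realType) (q N : nat) (G : digraph N).
Variables (J : 'I_N -> set 'rV[R]_q) (T : 'I_N -> 'I_N -> 'rV[R]_q -> 'rV[R]_q).
Variables (s : 'I_N -> 'I_N -> R).
Hypothesis J_neq0 : forall i, J i !=set0.
Hypothesis J_compact : forall i, compact (J i).
Hypothesis s_contr : forall i j, adm G i j -> 0 < s i j < 1.
Hypothesis T_sim : forall i j, adm G i j -> similarity (s i j) (T i j).
Hypothesis T_sub : forall i j, adm G i j -> T i j @` J j `<=` J i.
Implicit Types x : path_space G.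

Definition base_word x k : seq 'I_N := mkseq (fun h => base (\val x h)) k.

Lemma base_wordE x k : base_word x k = map (@base N) (mkseq (\val x) k).
Proof. by rewrite /base_word /mkseq -map_comp. Qed.

Lemma base_word_path x k :
  path (adm G) (base (\val x 0%N)) (mkseq (fun h => base (\val x h.+1)) k).
Proof. by have := path_adm (path_mkseq x k); rewrite /mkseq -map_comp. Qed.

Lemma base_word_set_sub x k l : (0 < k <= l)%N ->
  word_set T J (base_word x l) `<=` word_set T J (base_word x k).
Proof.
case: k l => // k [//|l] /andP[_]; rewrite ltnS => kl.
rewrite /base_word !mkseq_cons -(subnKC kl) mkseqD.
apply: (word_set_cat T_sub); rewrite -mkseqD subnKC//; exact: base_word_path.
Qed.

(** [coding] is a choice from an intersection, which must be shown non-empty: the sets are nested,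
    compact and non-empty, and a cluster point of points chosen in them lies in all of them. *)
Lemma coding_word_set x k : (0 < k)%N ->
  word_set T J (base_word x k) (coding G T J x).
Proof.
move=> k0; suff [y yP] : exists y, forall l, (0 < l)%N -> word_set T J (base_word x l) y.
  have : (\bigcap_(l in [set l | (0 < l)%N])
      word_set (fun i j => T (base i) (base j)) (J \o @base N) (mkseq (\val x) l))
      (coding G T J x).
    apply: xgetPex; exists y => l /= l0.
    by rewrite word_set_map -base_wordE; exact: yP.
  by move=> /(_ k k0); rewrite word_set_map -base_wordE.
have [y yP] : exists y : nat -> 'rV[R]_q, forall l, word_set T J (base_word x l.+1) (y l).
  suff /choice[y yP] : forall l, exists y, word_set T J (base_word x l.+1) y.
    by exists y.
  by move=> l; rewrite /base_word mkseq_cons; exact: word_set_neq0.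
have K l : compact (word_set T J (base_word x l.+1)).
  by rewrite /base_word mkseq_cons; apply: (word_set_compact J_compact T_sim); exact: base_word_path.
have evl l : (y @ \oo) (word_set T J (base_word x l.+1)).
  exists l => // m /= lm; apply: (@base_word_set_sub x l.+1 m.+1 _ _ (yP m)).
  by rewrite ltnS.
have [p [_ clp]] := K 0%N (y @ \oo) _ (evl 0%N).
exists p => -[//|l] _.
have cl : closed (word_set T J (base_word x l.+1)).
  by apply: compact_closed (K l); exact: norm_hausdorff.
apply: cl => A Ap.
exact: clp (evl l) Ap.
Qed.

Lemma coding_word_set_cylinder x i w : cylinder G (i :: w) x ->
  word_set T J (base i :: map (@base N) w) (coding G T J x).
Proof.
move=> xw; have := @coding_word_set x (size (i :: w)) isT.
by rewrite base_wordE xw.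
Qed.

(** The map is continuous: a cylinder of depth [n + 1] is sent into a set of diameter at most
    [D * k ^ n], so the preimage of an open set is a union of cylinders. *)
Lemma coding_measurable : measurable_fun setT (coding G T J).
Proof.
apply: (@measurability _ _ (borelType (path_space G)) (borelType 'rV[R]_q)
  setT (coding G T J) (@open 'rV[R]_q)) => //.
move=> _ [U oU <-]; rewrite setTI.
apply: sub_sigma_algebra.
have -> : coding G T J @^-1` U =
    \bigcup_(w in [set w | cylinder G w `<=` coding G T J @^-1` U]) cylinder G w.
  apply/seteqP; split=> [x Ux|x [w wU xw]]; last exact: wU.
  have [e e0 eU] : exists2 e, 0 < e & forall y, `|coding G T J x - y| < e -> U y.
    have /nbhs_ballP[e e0 eU] : nbhs (coding G T J x : 'rV[R]_q) U.
      exact: open_nbhs_nbhs.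
    by exists e => // y xy; apply: eU; rewrite -ball_normE.
  have [D [D0 DP]] := word_set_diam J_compact s_contr T_sim.
  have [k [k0 k1 sk]] := contraction_bound s_contr.
  have [n kn] := expr_small k0 k1 (divr_gt0 e0 D0).
  exists (mkseq (\val x) n.+1); last exact/cylinder_mkseq.
  move=> x' /cylinder_mkseq xx'; apply: eU; apply: (le_lt_trans (normr_le_enorm _)).
  have x'n : base_word x' n.+1 = base_word x n.+1.
    by rewrite !base_wordE xx'.
  have := coding_word_set x (ltn0Sn n); have := coding_word_set x' (ltn0Sn n).
  rewrite x'n /base_word mkseq_cons => y1 y2.
  have pn := base_word_path x n.
  apply: (le_lt_trans (DP _ _ _ _ pn y2 y1)); rewrite mulrC -ltr_pdivlMr//.
  apply: le_lt_trans kn.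
  by have := word_ratio_le s_contr sk pn; rewrite size_mkseq.
by apply: bigcup_open => w _; exact: cylinder_open.
Qed.

End Coding.

Fixpoint path_weight (R : realType) (V : Type) (a : V -> V -> R) i (w : seq V) : R :=
  if w is j :: w' then a i j * path_weight a j w' else 1.

(** * The quantization error in terms of lists of words *)

Section QuantizationOfCoding.
Variables (R : realType) (q N : nat) (G : digraph N).
Variables (J : 'I_N -> set 'rV[R]_q) (T : 'I_N -> 'I_N -> 'rV[R]_q -> 'rV[R]_q).
Variables (s : 'I_N -> 'I_N -> R).
Hypothesis J_neq0 : forall i, J i !=set0.
Hypothesis J_disj : forall i j, i != j -> J i `&` J j = set0.
Hypothesis J_compact : forall i, compact (J i).
Hypothesis s_contr : forall i j, adm G i j -> 0 < s i j < 1.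
Hypothesis T_sim : forall i j, adm G i j -> similarity (s i j) (T i j).
Hypothesis T_sub : forall i j, adm G i j -> T i j @` J j `<=` J i.
Hypothesis T_disj : forall i j k, adm G i j -> adm G i k -> j != k ->
  T i j @` J j `&` T i k @` J k = set0.
Variables (chi : 'I_(N + N) -> R) (P : 'M[R]_(N + N)).
Hypothesis chi_gt0 : forall i, 0 < chi i.
Hypothesis P_ge0 : forall i j, 0 <= P i j.
Variable nu : probability (borelType (path_space G)) R.
Hypothesis nuE : forall i w, sorted G (i :: w) ->
     nu (cylinder G (i :: w)) = (chi i * path_prob P i w)%:E.
Let mu := pushforward nu (coding G T J).
Let m_coding := coding_measurable J_neq0 J_compact s_contr T_sim T_sub.

Lemma path_prob_ge0 i w : 0 <= path_prob P i w.
Proof. by elim: w i => //= j w IH i; rewrite mulr_ge0. Qed.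

Lemma path_weightE r i w : path G i w ->
  path_weight (fun i j => P i j * s (base i) (base j) `^ r) i w =
  path_prob P i w * word_ratio s (base i) (map (@base N) w) `^ r.
Proof.
elim: w i => [|j w IH] i /=; first by rewrite powR1 mulr1.
move=> /andP[ij jw]; rewrite IH// powRM; last 2 first.
- by case/andP: (s_contr (edge_adm ij)) => /ltW.
- by apply/ltW/(word_ratio_gt0 s_contr)/path_adm.
by rewrite mulrACA.
Qed.

(** The [r]-th power of the diameter bound times the mass of the cylinder is [D ^ r] times [chi]
    times the path weight, so each word costs at most [D ^ r * e]. *)
Lemma quant_err_pow_coding_le : exists D, 0 < D /\
  forall r k e (L : seq ('I_(N + N) * seq 'I_(N + N))), 0 < r ->
    (0 < size L <= k)%N ->
    (forall p, p \in L -> path G p.1 p.2) ->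
    (forall x, exists2 p, p \in L & cylinder G (p.1 :: p.2) x) ->
    (forall p, p \in L -> chi p.1 *
      path_weight (fun i j => P i j * s (base i) (base j) `^ r) p.1 p.2 <= e) ->
  (quant_err_pow mu r k <= (D `^ r * (k%:R * e))%:E)%E.
Proof.
have [D [D0 DP]] := word_set_diam J_compact s_contr T_sim.
exists D; split => // r k e L r0 /andP[L0 Lk] Lpath Lcover Le.
pose u (p : 'I_(N + N) * seq 'I_(N + N)) := map (@base N) p.2.
have [c cP] : exists c, forall p : 'I_(N + N) * seq 'I_(N + N),
    word_set T J (base p.1 :: u p) (c p).
  suff /choice[c cP] : forall p, exists y, word_set T J (base p.1 :: u p) y.
    by exists c.
  by move=> p; exact: word_set_neq0.
have := @quant_err_pow_le R q _ _ nu _ m_coding _ L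
  (fun p => D * word_ratio s (base p.1) (u p)) c
  (fun p => cylinder G (p.1 :: p.2)) r k r0.
move=> /(_ _ Lk (fun=> cylinder_measurable _)) => H.
apply: (le_trans (H _ _)).
- by rewrite -size_eq0 -lt0n.
- move=> x; have [p pL xp] := Lcover x; exists p => //; split => //.
  apply: DP (cP p); first exact/path_adm/Lpath.
  exact: (coding_word_set_cylinder J_neq0 J_compact T_sim T_sub xp).
apply: (@le_trans _ _ (\sum_(p <- L) (D `^ r * e)%:E)%E).
  rewrite big_seq [leRHS]big_seq; apply: lee_sum => p pL.
  rewrite nuE; last exact: Lpath.
  have w0 := word_ratio_gt0 s_contr (path_adm (Lpath p pL)).
  rewrite -EFinM lee_fin (powRM _ (ltW D0) (ltW w0)).
  rewrite -mulrA ler_wpM2l ?powR_ge0//.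
  apply: le_trans (Le p pL); rewrite path_weightE ?Lpath// le_eqVlt.
  by apply/orP; left; apply/eqP; rewrite mulrC mulrA.
rewrite sumEFin lee_fin big_const_seq iter_addr_0 count_predT.
have [p pL] : exists p, p \in L by case: (L) L0 => // p L' _; exists p; rewrite inE eqxx.
have e0 : 0 <= e.
  apply: le_trans (Le p pL); rewrite path_weightE ?Lpath//.
  apply: mulr_ge0; first exact: ltW.
  by rewrite mulr_ge0 ?path_prob_ge0 ?powR_ge0.
rewrite -[leLHS]mulr_natl mulrCA ler_wpM2l ?powR_ge0//.
by rewrite ler_wpM2r ?ler_nat.
Qed.

(** Collects all lifts of [w], because they are all coded into the same set [J_w]. *)
Definition base_cylinder (w : seq 'I_N) : set (path_space G) :=
  [set x | base_word x (size w) = w].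

Lemma base_cylinder_measurable w :
  measurable (base_cylinder w : set (borelType (path_space G))).
Proof.
apply: sub_sigma_algebra; elim/last_ind: w => [|w v IH].
  rewrite (_ : base_cylinder [::] = setT); first exact: openT.
  by apply/seteqP; split.
rewrite (_ : base_cylinder (rcons w v) = base_cylinder w `&`
  \bigcup_(i in [set i | base i = v]) [set x | \val x (size w) = i]).
  by apply: openI => //; apply: bigcup_open => i _; exact: coord_open.
apply/seteqP; split=> x; rewrite /base_cylinder /= size_rcons /base_word mkseqS.
  by move=> /rcons_inj[-> xv]; split => //; exists (\val x (size w)).
by move=> [xw [i iv xi]]; rewrite xw -iv -xi.
Qed.

Lemma base_cylinder_prefix x u v :
  base_cylinder u x -> base_cylinder v x -> prefix u v \/ prefix v u.
Proof.
rewrite /base_cylinder /= => xu xv.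
have [uv|/ltnW vu] := leqP (size u) (size v).
  by left; rewrite -xu -xv -(subnKC uv) /base_word mkseqD prefix_prefix.
by right; rewrite -xu -xv -(subnKC vu) /base_word mkseqD prefix_prefix.
Qed.

Lemma quant_err_pow_coding_ge : exists d, 0 < d /\
  forall r k e (L : seq ('I_N * seq 'I_N)), 0 < r -> 0 <= e ->
    uniq L -> (2 * k <= size L)%N ->
    (forall p, p \in L -> path (adm G) p.1 p.2) ->
    (forall p p', p \in L -> p' \in L ->
      prefix (p.1 :: p.2) (p'.1 :: p'.2) -> p = p') ->
    (forall p, p \in L ->
      (e%:E <= (word_ratio s p.1 p.2 `^ r)%:E * nu (base_cylinder (p.1 :: p.2)))%E) ->
  ((d `^ r * (k%:R * e))%:E <= quant_err_pow mu r k)%E.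
Proof.
have [d [d0 dP]] := word_set_separated J_disj J_compact s_contr T_sim T_sub T_disj.
(* Half of the separation constant: a point too close to both of two word sets would put their
   points at a distance below the mean of the two lower bounds that separation gives, once for
   either word. *)
exists (d / 2); split => [|r k e L r0 e0 uL kL Lpath Lpre Le].
  by rewrite divr_gt0.
have := @quant_err_pow_ge R q _ _ nu _ m_coding _ L
  (fun p => d / 2 * word_ratio s p.1 p.2)
  (fun p => base_cylinder (p.1 :: p.2)) r k ((d / 2) `^ r * e) r0 uL kL.
rewrite mulrCA => H; apply: H.
- by rewrite mulr_ge0 ?powR_ge0.
- move=> p pL; apply/ltW/mulr_gt0; first by rewrite divr_gt0.
  exact: (word_ratio_gt0 s_contr (Lpath p pL)).
- by move=> p; exact: base_cylinder_measurable.
- move=> p p' x y a pL p'L px p'y fxa fya; apply: contrapT => /eqP pp'.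
  have np : ~~ prefix (p.1 :: p.2) (p'.1 :: p'.2).
    by apply: contra pp' => /Lpre ->.
  have np' : ~~ prefix (p'.1 :: p'.2) (p.1 :: p.2).
    by apply: contra pp' => /Lpre ->.
  have xJ : word_set T J (p.1 :: p.2) (coding G T J x).
    rewrite -[p.1 :: p.2](px : base_word x _ = _).
    exact: (coding_word_set J_neq0 J_compact T_sim T_sub).
  have yJ : word_set T J (p'.1 :: p'.2) (coding G T J y).
    rewrite -[p'.1 :: p'.2](p'y : base_word y _ = _).
    exact: (coding_word_set J_neq0 J_compact T_sim T_sub).
  have d1 := dP _ _ _ _ _ _ (Lpath _ pL) (Lpath _ p'L) np np' xJ yJ.
  have d2 := dP _ _ _ _ _ _ (Lpath _ p'L) (Lpath _ pL) np' np yJ xJ.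
  have := enorm_triangle a (coding G T J x) (coding G T J y).
  rewrite (enormB a); rewrite enormB in d2; move: d1 d2 fxa fya; lra.
- move=> p p' x pL p'L px p'x.
  by case: (base_cylinder_prefix px p'x) => /Lpre ->.
move=> p pL; have w0 := word_ratio_gt0 s_contr (Lpath p pL).
have d20 : 0 < d / 2 by rewrite divr_gt0.
rewrite (powRM _ (ltW d20) (ltW w0)) EFinM [X in (_ <= X * _)%E]EFinM -muleA.
by rewrite lee_pmul2l ?lte_fin ?powR_gt0//; exact: Le.
Qed.

(** Lifts of the same base word have the same length, so distinct ones have disjoint cylinders and
    their masses add up. *)
Lemma base_cylinder_ge i0 u (L : seq (seq 'I_(N + N))) : uniq L ->
  (forall l, l \in L -> path G i0 l /\ map (@base N) l = u) ->
  ((chi i0 * \sum_(l <- L) path_prob P i0 l)%:E <= nu (base_cylinder (base i0 :: u)))%E.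
Proof.
move=> uL LP; rewrite -[leRHS]mule1 muleC.
have -> : (1 * nu (base_cylinder (base i0 :: u)) =
    \int[nu]_x (\sum_(v <- [:: base i0 :: u]) 1 * \1_(base_cylinder v) x)%:E)%E.
  by rewrite integral_step ?big_seq1// => v; exact: base_cylinder_measurable.
have -> : ((chi i0 * \sum_(l <- L) path_prob P i0 l)%:E =
    \int[nu]_x (\sum_(l <- L) 1 * \1_(cylinder G (i0 :: l)) x)%:E)%E.
  rewrite integral_step// => [|l]; last exact: cylinder_measurable.
  rewrite mulr_sumr -sumEFin big_seq [RHS]big_seq; apply: eq_bigr => l lL.
  by rewrite mul1e nuE//; case: (LP l lL).
apply: ge0_le_integral => //.
- by move=> x _; rewrite lee_fin sumr_ge0// => l _; rewrite mul1r.
- by apply: step_measurable => l; exact: cylinder_measurable.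
- by apply: step_measurable => l; exact: base_cylinder_measurable.
move=> x _; rewrite lee_fin big_seq1 mul1r.
have [[l [lL xl]]|nl] := pselect (exists l, l \in L /\ cylinder G (i0 :: l) x); last first.
  rewrite big_seq big1 ?indicE ?ler0n// => l lL; rewrite indicE memNset ?mulr0// => xl.
  by apply: nl; exists l.
rewrite (bigD1_seq l)//= big_seq_cond big1 => [|l' /andP[l'L ll']].
  rewrite addr0 mul1r !indicE !mem_set//.
  have [_ lu] := LP l lL.
  have sz : size (base i0 :: u) = size (i0 :: l) by rewrite -lu /= size_map.
  rewrite -[base_cylinder _ x]/(base_word x (size (base i0 :: u)) = _) sz base_wordE.
  by rewrite (xl : mkseq _ _ = _) /= lu.
rewrite indicE memNset ?mulr0// => xl'; case/eqP: ll'.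
have [_ lu] := LP l lL; have [_ l'u] := LP l' l'L.
have sl : size l = size l' by rewrite -(size_map (@base N) l) lu -l'u size_map.
suff : i0 :: l' = i0 :: l by case.
rewrite -[i0 :: l'](xl' : mkseq _ _ = _) -[i0 :: l](xl : mkseq _ _ = _).
by rewrite /= sl.
Qed.

End QuantizationOfCoding.

Arguments base_cylinder {N} G w.

(** * From estimates of the error to dimensions and coefficients *)

Section LimSupInf.
Variable R : realType.
Implicit Types u : (\bar R)^nat.
Local Open Scope ereal_scope.

Lemma limn_esup_le_near u K c : (forall k, (K <= k)%N -> u k <= c) -> limn_esup u <= c.
Proof.
move=> uc; apply: (@le_trans _ _ (ereal_sup (u @` [set k | (K <= k)%N]))).
  apply: ereal_inf_lbound; exists [set k | (K <= k)%N] => //; exact: nbhs_infty_ge.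
by apply: ge_ereal_sup => _ [k Kk <-]; exact: uc.
Qed.

Lemma limn_einf_ge_near u K c : (forall k, (K <= k)%N -> c <= u k) -> c <= limn_einf u.
Proof.
move=> uc; rewrite /limn_einf leeNr; apply: (@limn_esup_le_near _ K) => k Kk.
by rewrite leeN2 uc.
Qed.

Lemma limn_esup_lty u : limn_esup u < +oo ->
  exists K (M : R), forall k, (K <= k)%N -> u k <= M%:E.
Proof.
move=> /ereal_inf_lt[_ [V [K _ KV] <-]] supV.
(* The supremum may be [-oo]; the maximum with 0 makes it finite. *)
exists K, (fine (Order.max 0 (ereal_sup (u @` V)))) => k Kk.
apply: (@le_trans _ _ (ereal_sup (u @` V))).
  by apply: ereal_sup_ubound; exists k => //; exact: KV.
rewrite fineK ?le_max ?lexx ?orbT// fin_real// (@lt_le_trans _ _ 0) ?le_max ?lexx ?ltNyr//=.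
by rewrite gt_max supV ltry.
Qed.

End LimSupInf.

Section QuantizationAsymptotics.
Variables (R : realType) (q : nat) (mu : set (borelType 'rV[R]_q) -> \bar R).

Lemma powR_kV (k : nat) (x : R) : (0 < k)%N -> k%:R `^ x * k%:R `^ (- x) = 1 :> R.
Proof. by move=> k0; rewrite powRN mulfV// gt_eqF// powR_gt0// ltr0n. Qed.

Lemma lower_quant_coef_gt0 r s c K : 0 < c ->
  (forall k, (K <= k)%N -> (0 < k)%N ->
    ((c * k%:R `^ (- (r / s)))%:E <= quant_err_pow mu r k)%E) ->
  (0 < lower_quant_coef mu r s)%E.
Proof.
move=> c0 cE; apply: (@lt_le_trans _ _ c%:E); first by rewrite lte_fin.
apply: (@limn_einf_ge_near _ _ K.+1) => k Kk; have k0 : (0 < k)%N by exact: leq_trans Kk.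
have := cE k (ltnW Kk) k0; rewrite -(lee_pmul2l (x := (k%:R `^ (r / s))%:E))//.
  by rewrite -EFinM mulrCA powR_kV// mulr1.
by rewrite lte_fin powR_gt0// ltr0n.
Qed.

Lemma upper_quant_coef_lty r s C K :
  (forall k, (K <= k)%N -> (0 < k)%N ->
    (quant_err_pow mu r k <= (C * k%:R `^ (- (r / s)))%:E)%E) ->
  (upper_quant_coef mu r s < +oo)%E.
Proof.
move=> CE; apply: (@le_lt_trans _ _ C%:E); last exact: ltry.
apply: (@limn_esup_le_near _ _ K.+1) => k Kk; have k0 : (0 < k)%N by exact: leq_trans Kk.
have := CE k (ltnW Kk) k0; rewrite -(lee_pmul2l (x := (k%:R `^ (r / s))%:E))//.
  by rewrite -EFinM mulrCA powR_kV// mulr1.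
by rewrite lte_fin powR_gt0// ltr0n.
Qed.

Lemma upper_quant_coef_infinite r s :
  (forall M : R, forall K, exists2 k, (K <= k)%N && (0 < k)%N &
    ((M * k%:R `^ (- (r / s)))%:E <= quant_err_pow mu r k)%E) ->
  ~ (upper_quant_coef mu r s < +oo)%E.
Proof.
move=> inf /limn_esup_lty[K [M KM]].
have [k /andP[Kk k0] /=] := inf (M + 1) K.
rewrite -(lee_pmul2l (x := (k%:R `^ (r / s))%:E))//; last first.
  by rewrite lte_fin powR_gt0// ltr0n.
rewrite -EFinM mulrCA powR_kV// mulr1 => /le_trans/(_ (KM k Kk)).
by rewrite lee_fin gerDl ler10.
Qed.

Lemma quant_ratio_bounds r s u c C k : 0 < r -> 0 < c -> 0 < C -> (0 < k)%N ->
  ((c * k%:R `^ (- (r / s)))%:E <= quant_err_pow mu r k)%E ->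
  (quant_err_pow mu r k <= (C * k%:R `^ (- (r / u)))%:E)%E ->
  exists y, quant_ratio mu r k = (ln k%:R / y)%:E /\
    ln k%:R / u - ln C / r <= y <= ln k%:R / s - ln c / r.
Proof.
move=> r0 c0 C0 k0 cE EC; exists (- ln (quant_err mu r k)); split => //.
have kr (x : R) : 0 < k%:R `^ x by rewrite powR_gt0// ltr0n.
have Efin : quant_err_pow mu r k \is a fin_num.
  rewrite fin_real// (le_lt_trans EC) ?ltry// andbT.
  by rewrite (lt_le_trans _ cE)// ltNyr.
rewrite -(fineK Efin) !lee_fin in cE EC.
have E0 : 0 < fine (quant_err_pow mu r k) by apply: lt_le_trans cE; rewrite mulr_gt0.
rewrite /quant_err ln_powR.
have lnE (x a : R) : 0 < a -> ln (a * k%:R `^ (- (r / x))) = ln a - r / x * ln k%:R.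
  by move=> a0; rewrite lnM ?posrE// ln_powR mulNr.
have E1 : ln c - r / s * ln k%:R <= ln (fine (quant_err_pow mu r k)).
  by rewrite -lnE// ler_ln ?posrE// mulr_gt0.
have E2 : ln (fine (quant_err_pow mu r k)) <= ln C - r / u * ln k%:R.
  by rewrite -lnE// ler_ln ?posrE// mulr_gt0.
have rV : 0 < r^-1 by rewrite invr_gt0.
have := ler_wpM2l (ltW rV) E1; have := ler_wpM2l (ltW rV) E2.
have rr x : r^-1 * (r / x * ln k%:R) = ln k%:R / x.
  by rewrite mulrA mulrA mulVf ?gt_eqF// mul1r mulrC.
rewrite !mulrBr !rr ![r^-1 * ln _]mulrC; lra.
Qed.

Lemma ln_nat_large (A : R) : exists K, forall k, (K <= k)%N -> A <= ln k%:R.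
Proof.
exists (Num.truncn (expR A)).+1 => k Kk.
have k0 : (0 < k)%N by exact: leq_trans Kk.
rewrite -ler_expR lnK ?posrE ?ltr0n// ltW//.
by apply: (lt_le_trans (truncnS_gt _)); rewrite ler_nat.
Qed.

(** The upper estimate is asked only for exponents [u > s], since at [s] itself it fails when the
    two critical exponents coincide. This is enough, as constants vanish after division by
    [ln k]. *)
Lemma quant_dim_eq r s : 0 < r -> 0 < s ->
  (exists c K, 0 < c /\ forall k, (K <= k)%N -> (0 < k)%N ->
    ((c * k%:R `^ (- (r / s)))%:E <= quant_err_pow mu r k)%E) ->
  (forall u, s < u -> exists C K, 0 < C /\ forall k, (K <= k)%N -> (0 < k)%N ->
    (quant_err_pow mu r k <= (C * k%:R `^ (- (r / u)))%:E)%E) ->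
  lower_quant_dim mu r = s%:E /\ upper_quant_dim mu r = s%:E.
Proof.
move=> r0 s0 [c [K1 [c0 cE]]] CE.
have close (e : R) : 0 < e -> exists K, forall k, (K <= k)%N ->
    ((s - e)%:E <= quant_ratio mu r k <= (s + e)%:E)%E.
  move=> e0; have [C [K2 [C0 EC]]] := CE (s + e / 2) ltac:(lra).
  set u := s + e / 2 in EC; have u0 : 0 < u by rewrite /u; lra.
  set o := ln C / r; set p := ln c / r.
  (* In this order the four thresholds ensure [ln k >= 0], the positivity of the denominator [y],
     the lower bound [s - e] and the upper bound [s + e]. *)
  have [K3 LK] := ln_nat_large (Num.max (Num.max 0 (u * (o + 1)))
    (Num.max (- (s * ((s - e) * p)) / e) (u * (2 * (s + e) * o) / e))).
  exists (maxn K1 (maxn K2 K3)).+1 => k.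
  rewrite gtn_max gtn_max => /andP[K1k /andP[K2k K3k]].
  have k0 : (0 < k)%N by exact: leq_ltn_trans K1k.
  have [y [-> /andP[yu ys]]] := quant_ratio_bounds r0 c0 C0 k0
    (cE k (ltnW K1k) k0) (EC k (ltnW K2k) k0).
  have := LK k (ltnW K3k); rewrite !ge_max => /andP[/andP[L0 L1] /andP[L2 L3]].
  rewrite -/o -/p in yu ys; set L := ln k%:R in yu ys L0 L1 L2 L3 *.
  have LuE : L = u * (L / u) by rewrite mulrC divfK// gt_eqF.
  have LsE : L = s * (L / s) by rewrite mulrC divfK// gt_eqF.
  have y0 : 0 < y.
    apply: lt_le_trans yu; rewrite subr_gt0 ltr_pdivlMr// mulrC.
    by apply: lt_le_trans L1; rewrite ltr_pM2l// ltrDl.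
  rewrite !lee_fin ler_pdivlMr// ler_pdivrMr//; apply/andP; split.
    have [se|se] := leP s e.
      by apply: le_trans L0; rewrite mulr_le0_ge0 ?subr_le0// ltW.
    have se0 : 0 < s - e by rewrite subr_gt0.
    apply: (@le_trans _ _ ((s - e) * (L / s - p))); first by rewrite ler_pM2l.
    rewrite {2}LsE; move: L2; rewrite ler_pdivrMr// {1}LsE -mulrN -mulrA ler_pM2l//.
    by set X := L / s; lra.
  have se0 : 0 < s + e by rewrite addr_gt0.
  apply: (@le_trans _ _ ((s + e) * (L / u - o))); last by rewrite ler_pM2l.
  rewrite {1}LuE; move: L3; rewrite ler_pdivrMr// {1}LuE -[X in _ <= X -> _]mulrA ler_pM2l//.
  by rewrite /u; set X := L / _; lra.
have up : (upper_quant_dim mu r <= s%:E)%E.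
  apply/lee_addgt0Pr => e e0; have [K cK] := close e e0.
  apply: (@limn_esup_le_near _ _ K) => k /cK/andP[_].
  by rewrite -EFinD.
have lo : (s%:E <= lower_quant_dim mu r)%E.
  apply/lee_addgt0Pr => e e0; have [K cK] := close e e0.
  rewrite -leeBlDr//; apply: (@limn_einf_ge_near _ _ K) => k /cK/andP[+ _].
  by rewrite -EFinB.
have lu := limn_einf_sup (quant_ratio mu r).
split; apply/eqP; rewrite eq_le ?lo ?up ?andbT /=.
  exact: le_trans lu up.
exact: le_trans lo lu.
Qed.

End QuantizationAsymptotics.

(** * Counting words *)

Section Threshold.
Variables (R : realType) (V : finType) (e : rel V) (a : V -> V -> R) (m k : R).
Hypothesis m_gt0 : 0 < m.
Hypothesis k_gt0 : 0 < k.
Hypothesis k_lt1 : k < 1.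
Hypothesis a_bound : forall i j, e i j -> m <= a i j <= k.

Let step (st : R * V) (j : V) : R * V := (st.1 * a st.2 j, j).
Let vert (st : R * V) : V := st.2.
Let P (st : R * V) : bool := st.1 < 1.
(** The second clause says that [n] further letters bring the weight below 1. The first survives
    each step because only weights of at least 1 are multiplied, by at least [m]. *)
Let I n (st : R * V) : Prop := m <= st.1 /\ st.1 * k ^+ n < 1.

Let foldl_step w i u :
  foldl step (w, i) u = (w * path_weight a i u, last i u).
Proof.
elim: u w i => [|j u IH] w i /=; first by rewrite mulr1.
by rewrite IH /= mulrA.
Qed.

Let I_fuel st : I 0 st -> P st.
Proof. by case=> _; rewrite mulr1. Qed.

Let I_step n st j : I n.+1 st -> ~~ P st -> e (vert st) j -> I n (step st j).
Proof.
rewrite /P -leNgt => -[_ wk] w1 /a_bound/andP[ma ak]; split => /=.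
  by rewrite -[leLHS]mul1r; apply: ler_pM => //; exact: ltW.
apply: le_lt_trans wk; rewrite exprS mulrA ler_pM2r ?exprn_gt0//.
by rewrite ler_pM2l// (lt_le_trans ltr01).
Qed.

Let vert_step st j : vert (step st j) = j. Proof. by []. Qed.

Let fuel w i : m <= w -> exists n, I n (w, i).
Proof.
move=> mw; have w0 : 0 < w by exact: lt_le_trans mw.
have [n kn] := expr_small k_gt0 k_lt1 (e := w^-1) ltac:(by rewrite invr_gt0).
by exists n; split => //=; rewrite mulrC -ltr_pdivlMr// mul1r.
Qed.

Let cutP n w i u : I n (w, i) -> u \in cut step vert e P n (w, i) ->
  path e i u /\ m <= w * path_weight a i u < 1.
Proof.
move=> Iw uin; split; first exact: (cut_path vert_step uin).
have [Pu [n' [mu _]]] := cut_stop I_fuel I_step Iw uin.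
by move: Pu mu; rewrite foldl_step /P /= => -> ->.
Qed.

(** Leaves have [m <= w < 1] and inner nodes [1 <= w], so the two conditions on [U] concern separate
    ranges of the weight. *)
Lemma threshold_cover (U : R -> V -> R) w i :
  (forall w i, m <= w -> w < 1 -> 1 <= U w i) ->
  (forall w i, 1 <= w -> \sum_(j | e i j) U (w * a i j) j <= U w i) ->
  m <= w ->
  exists L : seq (seq V), [/\ (size L)%:R <= U w i,
    (forall u, u \in L -> path e i u /\ w * path_weight a i u < 1) &
    (forall y : nat -> V, y 0%N = i -> (forall n, e (y n) (y n.+1)) ->
      exists n, mkseq (fun h => y h.+1) n \in L)].
Proof.
move=> U1 US mw; have [n In] := fuel i mw.
exists (cut step vert e P n (w, i)); split.
- apply: (cut_size_le I_fuel I_step (U := fun st => U st.1 st.2)) In.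
    by move=> _ st [mst _]; exact: U1.
  by move=> _ st _; rewrite /P -leNgt => /US.
- by move=> u /(cutP In)[pu /andP[]].
- move=> y y0 ey; apply: (cut_cover vert_step I_step (y := fun h => y h.+1) In).
    by rewrite /vert /= -y0.
  by move=> h; exact: ey.
Qed.

Lemma threshold_packing (U : R -> V -> R) w i :
  (forall w i, m <= w -> w < 1 -> U w i <= 1) ->
  (forall w i, 1 <= w -> U w i <= \sum_(j | e i j) U (w * a i j) j) ->
  m <= w ->
  exists L : seq (seq V), [/\ U w i <= (size L)%:R, uniq L,
    (forall u, u \in L -> path e i u /\ m <= w * path_weight a i u) &
    (forall u v, u \in L -> v \in L -> prefix u v -> u = v)].
Proof.
move=> U1 US mw; have [n In] := fuel i mw.
exists (cut step vert e P n (w, i)); split.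
- apply: (cut_size_ge I_fuel I_step (U := fun st => U st.1 st.2)) In.
    by move=> _ st [mst _]; exact: U1.
  by move=> _ st _; rewrite /P -leNgt => /US.
- exact: cut_uniq.
- by move=> u /(cutP In)[pu /andP[]].
- by move=> u v; exact: cut_prefix.
Qed.

End Threshold.

Section BlockVectors.
Variables (R : realType) (N : nat).

Definition glue (T : Type) (f g : 'I_N -> T) (i : 'I_(N + N)) : T :=
  match fintype.split i with inl j => f j | inr j => g j end.

Lemma glue_lshift T (f g : 'I_N -> T) i : glue f g (lshift N i) = f i.
Proof. by rewrite /glue -[lshift _ _]/(unsplit (inl i)) unsplitK. Qed.

Lemma glue_rshift T (f g : 'I_N -> T) i : glue f g (rshift N i) = g i.
Proof. by rewrite /glue -[rshift _ _]/(unsplit (inr i)) unsplitK. Qed.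

Lemma ord_shift_ind (Q : 'I_(N + N) -> Prop) :
  (forall i, Q (lshift N i)) -> (forall i, Q (rshift N i)) -> forall i, Q i.
Proof. by move=> Ql Qr i; case: (baseP i) => ->. Qed.

Lemma exists_lower_bound (h : 'I_N -> R) : (forall i, 0 < h i) ->
  exists c, 0 < c /\ forall i, c <= h i.
Proof.
move=> h0; apply: finite_uniform_pos => [i|i d d' /le_trans]; last exact.
by exists (h i).
Qed.

Lemma exists_upper_bound n (h : 'I_n -> R) : exists c, 0 < c /\ forall i, h i <= c.
Proof.
exists (1 + \sum_i `|h i|); split; first by rewrite ltr_pwDl// sumr_ge0.
move=> i; rewrite (bigD1 i)//= ler_wpDl// ler_wpDr ?ler_norm//.
exact: sumr_ge0.
Qed.

End BlockVectors.

(** * Covers: upper bounds for the number of cylinders *)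

Section Growth.
Variables (R : realType) (N : nat) (G : digraph N).
Variables (s : 'I_N -> 'I_N -> R) (chi : 'I_(N + N) -> R) (P : 'M[R]_(N + N)).
Hypothesis s_contr : forall i j, adm G i j -> 0 < s i j < 1.
Hypothesis chi_gt0 : forall i, 0 < chi i.
Hypothesis chi_sum : \sum_i chi i = 1.
Hypothesis P_ge0 : forall i j, 0 <= P i j.
Hypothesis P_sum : forall i, \sum_j P i j = 1.
Hypothesis P_edge : forall i j, 0 < P i j <-> G i j.
Hypothesis P4_eq0 : forall i j, P (rshift N i) (lshift N j) = 0.

Definition edge_weight r i j : R := P i j * s (base i) (base j) `^ r.

Lemma edge_weight_gt0 r i j : G i j -> 0 < edge_weight r i j.
Proof.
move=> ij; rewrite mulr_gt0 ?powR_gt0//; first exact/P_edge.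
by case/andP: (s_contr (edge_adm ij)).
Qed.

Lemma not_edge_eq0 i j : ~~ G i j -> P i j = 0.
Proof.
move=> nij; apply/eqP; rewrite eq_le P_ge0 andbT leNgt.
by apply: contra nij => /P_edge.
Qed.

Lemma edge_weight_eq0 r i j : ~~ G i j -> edge_weight r i j = 0.
Proof. by move=> /not_edge_eq0 P0; rewrite /edge_weight P0 mul0r. Qed.

Lemma edge_weight_ge0 r i j : 0 <= edge_weight r i j.
Proof. by rewrite mulr_ge0 ?powR_ge0. Qed.

Lemma P_le1 i j : P i j <= 1.
Proof. by rewrite -(P_sum i) (bigD1 j)//= lerDl sumr_ge0. Qed.

(** The factor [P i j] is kept so that the bound can be summed over [j]: entire row sums, not only
    single weights, are at most [k]. *)
Lemma edge_weight_contraction r : 0 < r -> exists k, [/\ 0 < k, k < 1 &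
  forall i j, edge_weight r i j <= k * P i j].
Proof.
move=> r0; have [k [k0 k1 sk]] := contraction_bound s_contr.
exists (k `^ r); split; first by rewrite powR_gt0.
  have : k `^ r < 1 `^ r by apply: gt0_ltr_powR; rewrite ?nnegrE// ltW.
  by rewrite powR1.
move=> i j; have [ij|/not_edge_eq0 P0] := boolP (G i j); last first.
  by rewrite /edge_weight P0 mul0r mulr0.
rewrite /edge_weight mulrC ler_wpM2r//.
have /andP[s0 _] := s_contr (edge_adm ij).
apply: ge0_ler_powR; rewrite ?nnegrE ?(ltW r0) ?(ltW s0) ?(ltW k0)//.
exact/sk/edge_adm.
Qed.

Lemma edge_weight_bounds r : 0 < r -> exists m k, [/\ 0 < m, m < 1, 0 < k, k < 1 &
  forall i j, G i j -> m <= edge_weight r i j <= k].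
Proof.
move=> r0; have [k [k0 k1 wk]] := edge_weight_contraction r0.
pose b := \matrix_(i, j) edge_weight r i j.
have [m [m0 mk mb]] := exists_entry_bound b k0.
exists m, k; split => //; first exact: le_lt_trans k1.
move=> i j ij; have := mb i j; rewrite mxE => -> /=; last exact: edge_weight_gt0.
by rewrite (le_trans (wk i j))// ler_piMr ?P_le1// ltW.
Qed.

Definition cover_growth r t := exists C e0, [/\ 0 < C, 0 < e0 &
  forall e, 0 < e -> e <= e0 -> exists L : seq ('I_(N + N) * seq 'I_(N + N)),
    [/\ (0 < size L)%N, (size L)%:R <= C * e `^ (- t),
      (forall p, p \in L -> path G p.1 p.2),
      (forall x, exists2 p, p \in L & cylinder G (p.1 :: p.2) x) &
      (forall p, p \in L -> chi p.1 * path_weight (edge_weight r) p.1 p.2 <= e)]].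

Lemma chi_le1 i : chi i <= 1.
Proof. by rewrite -chi_sum (bigD1 i)//= lerDl sumr_ge0// => j _; exact: ltW. Qed.

(** One tree is grown from each first letter [i], with initial weight [chi i / e]; stopping below 1
    means that [chi] times the path weight is below [e]. *)
Lemma cover_growth_potential r t m k C (U : R -> 'I_(N + N) -> R) :
  0 < t -> 0 < m -> m < 1 -> 0 < k -> k < 1 ->
  (forall i j, G i j -> m <= edge_weight r i j <= k) ->
  (forall w i, m <= w -> w < 1 -> 1 <= U w i) ->
  (forall w i, 1 <= w -> \sum_(j | G i j) U (w * edge_weight r i j) j <= U w i) ->
  (forall w i, 1 <= w -> U w i <= C * w `^ t) ->
  cover_growth r t.
Proof.
move=> t0 m0 m1 k0 k1 mk U1 US UC.
have [c [c0 cchi]] : exists c, 0 < c /\ forall i, c <= chi i.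
  apply: finite_uniform_pos => [i|i d d' /le_trans]; last exact.
  by exists (chi i).
have N0 : (0 < N + N)%N by rewrite addn_gt0 (ltnW (digraph_gt1 G)).
have C0 : 0 <= C.
  pose i0 := Ordinal N0.
  have [L [LU _ _]] := threshold_cover m0 k0 k1 mk i0 U1 US (ltW m1).
  have := le_trans LU (UC 1 i0 (lexx 1)); rewrite powR1 mulr1; exact: le_trans.
(* For [e <= c] every initial weight is at least 1. The summand 1 makes the constant positive, since
   [C] is only known to be non-negative. *)
exists ((N + N)%:R * C + 1), c; split => // [|e e0 ec].
  by rewrite ltr_wpDl// mulr_ge0.
have w1 i : 1 <= chi i / e by rewrite ler_pdivlMr// mul1r (le_trans ec).
have /choice[L LP] : forall i, exists L : seq (seq 'I_(N + N)),
    [/\ (size L)%:R <= U (chi i / e) i,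
    (forall u, u \in L -> path G i u /\ chi i / e * path_weight (edge_weight r) i u < 1) &
    (forall y : nat -> 'I_(N + N), y 0%N = i -> (forall n, G (y n) (y n.+1)) ->
      exists n, mkseq (fun h => y h.+1) n \in L)].
  move=> i; apply: (threshold_cover m0 k0 k1 mk (U := U)) => //.
  exact: le_trans (ltW m1) (w1 i).
pose LL := flatten [seq [seq (i, u) | u <- L i] | i <- enum 'I_(N + N)].
have LLP p : reflect (p.2 \in L p.1) (p \in LL).
  apply: (iffP flatten_mapP) => [[i _ /mapP[u uL ->]] //|pL].
  by exists p.1; [rewrite mem_enum | apply/mapP; exists p.2 => //; case: (p)].
have cover x : exists2 p, p \in LL & cylinder G (p.1 :: p.2) x.
  have [_ _ Lx] := LP (\val x 0%N).
  have [n nL] := Lx (\val x) erefl (path_edge x).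
  exists (\val x 0%N, mkseq (fun h => \val x h.+1) n); first exact/LLP.
  by rewrite -mkseq_cons; apply/cylinder_mkseq.
exists LL; split => //.
- have [p pL _] := cover point.
  by case: (LL) pL.
- rewrite size_flatten sumnE /shape -map_comp big_map big_enum /= natr_sum.
  apply: (@le_trans _ _ (\sum_(i < N + N) C * e `^ (- t))).
    apply: ler_sum => i _; rewrite size_map; have [LU _ _] := LP i.
    apply: (le_trans LU); apply: (le_trans (UC _ _ (w1 i))).
    rewrite ler_wpM2l// powRM ?invr_ge0 ?(ltW e0) ?(ltW (chi_gt0 i))//.
    rewrite -powR_inv1 ?(ltW e0)// -powRrM mulN1r -[leRHS]mul1r.
    rewrite ler_wpM2r ?powR_ge0//.
    have : chi i `^ t <= 1 `^ t.
      apply: ge0_ler_powR; rewrite ?nnegrE ?(ltW t0) ?(ltW (chi_gt0 i)) ?chi_le1//.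
    by rewrite powR1.
  rewrite sumr_const card_ord -[leLHS]mulr_natl mulrDl mulrA lerDl mul1r.
  exact: powR_ge0.
- by move=> p /LLP pL; have [_ /(_ _ pL)[]] := LP p.1.
- move=> p /LLP pL; have [_ /(_ _ pL)[_ +] _] := LP p.1.
  by rewrite mulrAC ltr_pdivrMr// mul1r => /ltW.
Qed.

Lemma cover_growth_superharmonic r t (H : 'I_(N + N) -> R) : 0 < r -> 0 < t ->
  (forall i, 0 < H i) ->
  (forall i, \sum_j edge_weight r i j `^ t * H j <= H i) ->
  cover_growth r t.
Proof.
move=> r0 t0 H0 HS; have [m [k [m0 m1 k0 k1 mk]]] := edge_weight_bounds r0.
have [c [c0 cH]] : exists c, 0 < c /\ forall i, c <= H i.
  apply: finite_uniform_pos => [i|i d d' /le_trans]; last exact.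
  by exists (H i).
have [D [D0 HD]] := exists_upper_bound H.
have mt : 0 < m `^ t by rewrite powR_gt0.
pose C := (m `^ t * c)^-1; have C0 : 0 < C by rewrite invr_gt0 mulr_gt0.
apply: (@cover_growth_potential r t m k (C * D) (fun w i => C * (w `^ t * H i))) => //.
- move=> w i mw w1; rewrite /C mulrC ler_pdivlMr ?mulr_gt0// mul1r.
  apply: ler_pM => //; try exact: ltW.
  apply: ge0_ler_powR; rewrite ?nnegrE ?(ltW t0) ?(ltW m0)//.
  exact: le_trans (ltW m0) mw.
- move=> w i w1; have w0 : 0 <= w by exact: le_trans ler01 w1.
  rewrite -mulr_sumr ler_pM2l//; apply: le_trans (ler_wpM2l (powR_ge0 w t) (HS i)).
  rewrite big_mkcond /= mulr_sumr; apply: ler_sum => j _; case: ifP => _.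
    by rewrite powRM ?edge_weight_ge0// mulrA.
  by rewrite !mulr_ge0 ?powR_ge0// ltW.
- by move=> w i _; rewrite -mulrA ler_pM2l// mulrC ler_wpM2r ?powR_ge0.
Qed.

Definition block1 r : 'M[R]_N := \matrix_(i, j) edge_weight r (lshift N i) (lshift N j).
Definition block2 r : 'M[R]_N := \matrix_(i, j) edge_weight r (rshift N i) (rshift N j).

(** A strictly subcritical first block has a slack [1 - l1]; multiplying its Perron vector by a
    large [C] makes this slack pay for all transitions into the second block. *)
Lemma cover_growth_sub r t h1 h2 l1 l2 : 0 < r -> 0 < t ->
  (forall i, 0 < h1 i) -> (forall i, mulmv (pow_mx (block1 r) t) h1 i = l1 * h1 i) ->
  (forall i, 0 < h2 i) -> (forall i, mulmv (pow_mx (block2 r) t) h2 i = l2 * h2 i) ->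
  l1 < 1 -> l2 <= 1 -> cover_growth r t.
Proof.
move=> r0 t0 h10 E1 h20 E2 l11 l21.
pose M i := \sum_j edge_weight r (lshift N i) (rshift N j) `^ t * h2 j.
have M0 i : 0 <= M i by apply: sumr_ge0 => j _; rewrite mulr_ge0 ?powR_ge0// ltW.
have [D [D0 MD]] := exists_upper_bound M.
have [c [c0 ch]] := exists_lower_bound h10.
have d0 : 0 < 1 - l1 by rewrite subr_gt0.
pose C := D / ((1 - l1) * c); have C0 : 0 < C by rewrite divr_gt0// mulr_gt0.
apply: (@cover_growth_superharmonic r t (glue (fun i => C * h1 i) h2)) => //.
  by apply: ord_shift_ind => i; rewrite ?glue_lshift ?glue_rshift// mulr_gt0.
apply: ord_shift_ind => i; rewrite ?glue_lshift ?glue_rshift big_split_ord /=.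
  under eq_bigr do rewrite glue_lshift.
  under [X in _ + X]eq_bigr do rewrite glue_rshift.
  have -> : \sum_j edge_weight r (lshift N i) (lshift N j) `^ t * (C * h1 j) =
      C * (l1 * h1 i).
    rewrite -E1 /mulmv mulr_sumr; apply: eq_bigr => j _; rewrite !mxE; ring.
  rewrite -/(M i); apply: (@le_trans _ _ (C * (l1 * h1 i) + C * ((1 - l1) * c))).
    by rewrite lerD2l /C divfK ?gt_eqF ?mulr_gt0.
  rewrite -mulrDr ler_pM2l//.
  have := ler_wpM2l (ltW d0) (ch i); lra.
under eq_bigr do rewrite glue_lshift.
under [X in _ + X]eq_bigr do rewrite glue_rshift.
rewrite big1 ?add0r => [|j _]; last first.
  by rewrite /edge_weight P4_eq0 mul0r powR0 ?mul0r// gt_eqF.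
apply: (@le_trans _ _ (l2 * h2 i)).
  by rewrite -E2 /mulmv le_eqVlt; apply/orP; left; apply/eqP; apply: eq_bigr => j _; rewrite !mxE.
by rewrite ler_piMl// ltW.
Qed.

(** The loss term [C2 g w^t2] absorbs the walks that leave the first block. *)
Lemma cover_growth_first r t1 t2 h g h2 l : 0 < r -> 0 < t2 -> t2 < t1 ->
  (forall i, 0 < h i) -> (forall i, mulmv (pow_mx (block1 r) t1) h i = h i) ->
  (forall i, 0 < g i) -> (forall i, mulmv (pow_mx (block1 r) t2) g i = l * g i) ->
  1 < l ->
  (forall i, 0 < h2 i) -> (forall i, mulmv (pow_mx (block2 r) t2) h2 i = h2 i) ->
  cover_growth r t1.
Proof.
move=> r0 t20 t21 h0 Eh g0 Eg l1 h20 E2.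
have t10 : 0 < t1 by exact: lt_trans t21.
have [m [k [m0 m1 k0 k1 mk]]] := edge_weight_bounds r0.
have [c [c0 ch]] := exists_lower_bound h0.
have [cg [cg0 cgg]] := exists_lower_bound g0.
have [c2 [c20 ch2]] := exists_lower_bound h20.
have [D [D0 hD]] := exists_upper_bound h.
have [Dg [Dg0 gD]] := exists_upper_bound g.
have [D2 [D20 h2D]] := exists_upper_bound h2.
(* [C3] lifts the second-block potential to at least 1 at the leaves. [C2] makes the gain
   [C2 (l - 1) g w^t2] of the loss term exceed the transitions [M i w^t2] into the second block.
   [C1] then compensates the loss term at the leaves. *)
pose C3 := (m `^ t2 * c2)^-1.
have C30 : 0 < C3 by rewrite invr_gt0 mulr_gt0 ?powR_gt0.
pose M i := \sum_j edge_weight r (lshift N i) (rshift N j) `^ t2 * (C3 * h2 j).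
have [DM [DM0 MD]] := exists_upper_bound M.
have d0 : 0 < l - 1 by rewrite subr_gt0.
pose C2 := DM / ((l - 1) * cg).
have C20 : 0 < C2 by rewrite divr_gt0 ?mulr_gt0.
pose C1 := (1 + C2 * Dg) / (m `^ t1 * c).
have C10 : 0 < C1.
  by apply: divr_gt0; [apply: addr_gt0 => //|]; apply: mulr_gt0 => //; exact: powR_gt0.
pose U w := glue (fun i => C1 * h i * w `^ t1 - C2 * g i * w `^ t2)
                 (fun i => C3 * h2 i * w `^ t2).
have mw_t (w t : R) : 0 < t -> m <= w -> m `^ t <= w `^ t.
  move=> t0 mw; apply: ge0_ler_powR; rewrite ?nnegrE ?(ltW t0) ?(ltW m0)//.
  exact: le_trans (ltW m0) mw.
apply: (@cover_growth_potential r t1 m k (C1 * D + C3 * D2) U) => //.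
- move=> w i mw w1; have w0 : 0 <= w by exact: le_trans (ltW m0) mw.
  move: i; apply: ord_shift_ind => i; rewrite /U ?glue_lshift ?glue_rshift.
    have wt2 : w `^ t2 <= 1.
      have : w `^ t2 <= 1 `^ t2.
        by apply: ge0_ler_powR; rewrite ?nnegrE ?(ltW t20)// ltW.
      by rewrite powR1.
    have : C2 * g i * w `^ t2 <= C2 * Dg.
      rewrite -mulrA ler_pM2l// -[leRHS]mulr1.
      by apply: ler_pM; rewrite ?powR_ge0// ltW.
    suff : 1 + C2 * Dg <= C1 * h i * w `^ t1 by lra.
    have -> : 1 + C2 * Dg = C1 * (c * m `^ t1).
      by rewrite /C1 [c * _]mulrC divfK// gt_eqF// mulr_gt0 ?powR_gt0.
    by rewrite -mulrA ler_pM2l//; apply: ler_pM; rewrite ?powR_ge0 ?mw_t// ltW.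
  have -> : 1 = C3 * (c2 * m `^ t2).
    by rewrite /C3 [c2 * _]mulrC mulVf// gt_eqF// mulr_gt0 ?powR_gt0.
  by rewrite -mulrA ler_pM2l//; apply: ler_pM; rewrite ?powR_ge0 ?mw_t// ltW.
- move=> w i w1; have w0 : 0 <= w by exact: le_trans ler01 w1.
  have pm t i' j : (w * edge_weight r i' j) `^ t = w `^ t * edge_weight r i' j `^ t.
    by rewrite powRM// edge_weight_ge0.
  (* Letters without an edge have weight 0, where [U] vanishes, so the sum may run over all
     letters. *)
  have -> : \sum_(j | G i j) U (w * edge_weight r i j) j =
      \sum_j (U (w * edge_weight r i j) j).
    rewrite big_mkcond /=; apply: eq_bigr => j _; case: ifPn => // nij.
    rewrite edge_weight_eq0// mulr0; case: (baseP j) => ->.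
      by rewrite /U glue_lshift !powR0 ?gt_eqF// !mulr0 subr0.
    by rewrite /U glue_rshift !powR0 ?gt_eqF// !mulr0.
  have -> : \sum_j (U (w * edge_weight r i j) j) =
      \sum_j (C1 * h j * (w * edge_weight r i (lshift N j)) `^ t1 -
              C2 * g j * (w * edge_weight r i (lshift N j)) `^ t2) +
      \sum_j C3 * h2 j * (w * edge_weight r i (rshift N j)) `^ t2.
    rewrite big_split_ord /=; congr (_ + _); apply: eq_bigr => j _.
      exact: glue_lshift.
    exact: glue_rshift.
  rewrite /U; move: i; apply: ord_shift_ind => i; rewrite ?glue_lshift ?glue_rshift.
    have -> : \sum_(j < N) (C1 * h j * (w * edge_weight r (lshift N i) (lshift N j)) `^ t1 -
        C2 * g j * (w * edge_weight r (lshift N i) (lshift N j)) `^ t2) =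
        C1 * w `^ t1 * h i - C2 * w `^ t2 * (l * g i).
      rewrite -Eh -Eg /mulmv !mulr_sumr -sumrB; apply: eq_bigr => j _.
      by rewrite !mxE !pm; ring.
    have -> : \sum_(j < N) C3 * h2 j * (w * edge_weight r (lshift N i) (rshift N j)) `^ t2 =
        w `^ t2 * M i.
      rewrite /M mulr_sumr; apply: eq_bigr => j _.
      by rewrite !pm; ring.
    suff : M i <= C2 * ((l - 1) * g i).
      by move=> /(ler_wpM2l (powR_ge0 w t2)); lra.
    apply: (le_trans (MD i)); rewrite -[leLHS](divfK (x := (l - 1) * cg)).
      by rewrite -/C2 !ler_pM2l.
    by rewrite gt_eqF// mulr_gt0.
  rewrite big1 ?add0r => [|j _]; last first.
    rewrite /edge_weight P4_eq0 mul0r mulr0 !powR0 ?gt_eqF//; ring.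
  rewrite -E2 /mulmv mulr_sumr mulr_suml le_eqVlt; apply/orP; left; apply/eqP.
  by apply: eq_bigr => j _; rewrite !mxE !pm; ring.
- move=> w i w1; have w0 : 0 < w by exact: lt_le_trans ltr01 w1.
  have wt : w `^ t2 <= w `^ t1 by apply: ler_powR => //; exact: ltW.
  have X0 := powR_ge0 w t1; have Y0 := powR_ge0 w t2.
  move: i; apply: ord_shift_ind => i; rewrite /U ?glue_lshift ?glue_rshift.
    apply: (@le_trans _ _ (C1 * h i * w `^ t1)).
      by rewrite gerBl; apply: mulr_ge0 => //; exact/ltW/mulr_gt0.
    apply: (@le_trans _ _ (C1 * D * w `^ t1)).
      by rewrite ler_wpM2r// ler_pM2l.
    by rewrite mulrDl lerDl; apply: mulr_ge0 => //; exact/ltW/mulr_gt0.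
  apply: (@le_trans _ _ (C3 * D2 * w `^ t1)).
    by apply: ler_pM => //; [exact/ltW/mulr_gt0 | rewrite ler_pM2l].
  rewrite mulrDl lerDr; apply: mulr_ge0 => //; exact/ltW/mulr_gt0.
Qed.

End Growth.

(** * Packings: lower bounds for the number of base words *)

Section Packing.
Variables (R : realType) (N : nat) (G : digraph N).
Variables (s : 'I_N -> 'I_N -> R) (chi : 'I_(N + N) -> R) (P : 'M[R]_(N + N)).
Hypothesis s_contr : forall i j, adm G i j -> 0 < s i j < 1.
Hypothesis chi_gt0 : forall i, 0 < chi i.
Hypothesis P_ge0 : forall i j, 0 <= P i j.
Hypothesis P_sum : forall i, \sum_j P i j = 1.
Hypothesis P_edge : forall i j, 0 < P i j <-> G i j.
Variable nu : probability (borelType (path_space G)) R.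
Hypothesis nuE : forall i w, sorted G (i :: w) ->
     nu (cylinder G (i :: w)) = (chi i * path_prob P i w)%:E.

Local Notation edge_weight := (edge_weight s P).

Definition packing r (e : R) (L : seq ('I_N * seq 'I_N)) :=
  [/\ uniq L, (forall p, p \in L -> path (adm G) p.1 p.2),
    (forall p p', p \in L -> p' \in L ->
      prefix (p.1 :: p.2) (p'.1 :: p'.2) -> p = p') &
    (forall p, p \in L ->
      (e%:E <= (word_ratio s p.1 p.2 `^ r)%:E *
        nu (base_cylinder G (p.1 :: p.2)))%E)].

(** Stated for any list of lifts: a single lift is enough for the order [e ^ (- t)], while equal
    exponents call for all of [lift_words u]. *)
Lemma base_cylinder_weight r e i0 u (L : seq (seq 'I_(N + N))) : uniq L ->
  path (adm G) (base i0) u ->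
  (forall l, l \in L -> path G i0 l /\ map (@base N) l = u) ->
  e <= chi i0 * \sum_(l <- L) path_weight (edge_weight r) i0 l ->
  (e%:E <= (word_ratio s (base i0) u `^ r)%:E * nu (base_cylinder G (base i0 :: u)))%E.
Proof.
move=> uL pu LP eL.
apply: le_trans (lee_wpmul2l _ (base_cylinder_ge nuE uL LP)); last first.
  by rewrite lee_fin powR_ge0.
rewrite -EFinM lee_fin; apply: (le_trans eL); rewrite mulrCA ler_pM2l//.
rewrite mulr_sumr big_seq [leRHS]big_seq; apply: ler_sum => l lL.
have [pl lu] := LP l lL.
by rewrite (path_weightE s_contr) ?lu// mulrC.
Qed.

Lemma packing_singleton_start r e i0 (L : seq (seq 'I_N)) : uniq L ->
  (forall u, u \in L -> path (adm G) i0 u) ->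
  (forall u v, u \in L -> v \in L -> prefix u v -> u = v) ->
  (forall u, u \in L ->
    (e%:E <= (word_ratio s i0 u `^ r)%:E * nu (base_cylinder G (i0 :: u)))%E) ->
  packing r e [seq (i0, u) | u <- L].
Proof.
move=> uL Lpath Lpre Le; split.
- by rewrite map_inj_uniq// => u v [].
- by move=> _ /mapP[u uin ->]; exact: Lpath.
- move=> _ _ /mapP[u uin ->] /mapP[v vin ->] /=.
  by rewrite eqxx /= => /Lpre ->.
- by move=> _ /mapP[u uin ->]; exact: Le.
Qed.

Definition packing_growth r t := exists c c1 e0, [/\ 0 < c, 0 < c1, 0 < e0 &
  forall e, 0 < e -> e <= e0 -> exists2 L, packing r (c1 * e) L &
    c * e `^ (- t) <= (size L)%:R].

(** Only the lifts inside the copy [emb] are counted; there the Perron vector gives a potential that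
    is exactly additive along the tree. *)
Lemma packing_growth_block r t (emb : 'I_N -> 'I_(N + N)) h :
  0 < r -> 0 < t -> (forall i, base (emb i) = i) ->
  (forall i, 0 < h i) ->
  (forall i, \sum_j edge_weight r (emb i) (emb j) `^ t * h j = h i) ->
  packing_growth r t.
Proof.
move=> r0 t0 embK h0 Eh.
have [m [k [m0 m1 k0 k1 mk]]] := edge_weight_bounds s_contr P_ge0 P_sum P_edge r0.
have [D [D0 hD]] := exists_upper_bound h.
pose i0 : 'I_N := Ordinal (ltnW (digraph_gt1 G)).
pose E : rel 'I_N := fun i j => G (emb i) (emb j).
pose a i j := edge_weight r (emb i) (emb j).
have aE i u : path_weight a i u = path_weight (edge_weight r) (emb i) (map emb u).
  by elim: u i => //= j u IH i; rewrite IH.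
have aP i j : E i j -> m <= a i j <= k by exact: mk.
have Epath i u : path E i u -> path G (emb i) (map emb u).
  elim: u i => //= j u IH i /andP[ij pu].
  by apply/andP; split => //; exact: IH.
(* The tree starts at [i0] with weight [1 / e], and stopped words have weight at least [m]; division
   by [D] brings the potential below 1 at the leaves. *)
exists (h i0 / D), (chi (emb i0) * m), 1; split => //.
- exact: divr_gt0.
- exact: mulr_gt0.
move=> e e0 e1.
have w1 : 1 <= e^-1 by rewrite invf_ge1.
have [|||L [LU uL LP Lpre]] := @threshold_packing R _ E a m k m0 k0 k1 aP
    (fun w i => D^-1 * (w `^ t * h i)) e^-1 i0.
- move=> w i mw wlt1; rewrite mulrC ler_pdivrMr// mul1r -[leRHS]mul1r.
  apply: ler_pM; rewrite ?powR_ge0// ?(ltW (h0 i))//.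
  have : w `^ t <= 1 `^ t.
    apply: ge0_ler_powR; rewrite ?nnegrE ?(ltW t0) ?(ltW wlt1)//.
    exact: le_trans (ltW m0) mw.
  by rewrite powR1.
- move=> w i wge1; have wge0 : 0 <= w by exact: le_trans ler01 wge1.
  rewrite -mulr_sumr ler_pM2l ?invr_gt0// -Eh mulr_sumr [leRHS]big_mkcond /=.
  apply: ler_sum => j _; case: ifPn => [_|nij].
    by rewrite (powRM _ wge0 (edge_weight_ge0 s P_ge0 _ _ _)) mulrA.
  by rewrite (edge_weight_eq0 s P_ge0 P_edge)// powR0 ?mul0r ?mulr0// gt_eqF.
- exact: le_trans (ltW m1) w1.
exists [seq (i0, u) | u <- L].
  apply: packing_singleton_start => // u uin.
    have := path_adm (Epath _ _ (LP u uin).1); rewrite embK -map_comp.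
    by rewrite map_id_in// => j _ /=; rewrite embK.
  have [/Epath pu mu] := LP u uin.
  have ub : map (@base N) (map emb u) = u.
    by rewrite -map_comp map_id_in// => j _ /=; rewrite embK.
  rewrite -[i0 in word_ratio _ i0]embK -[i0 in base_cylinder _ (i0 :: _)]embK.
  apply: (@base_cylinder_weight r _ (emb i0) u [:: map emb u]) => //.
  - by have := path_adm pu; rewrite ub.
  - by move=> l; rewrite inE => /eqP ->.
  rewrite big_seq1 -aE -mulrA ler_pM2l//.
  by move: mu; rewrite mulrC ler_pdivlMr.
rewrite size_map; apply: le_trans LU.
rewrite -(powR_inv1 (ltW e0)) -powRrM mulN1r le_eqVlt; apply/orP; left; apply/eqP.
by ring.
Qed.

End Packing.

(** * The additional factor for equal exponents *)

Section EqualDimensions.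
Variables (R : realType) (N : nat) (G : digraph N).
Variables (s : 'I_N -> 'I_N -> R) (chi : 'I_(N + N) -> R) (P : 'M[R]_(N + N)).
Hypothesis s_contr : forall i j, adm G i j -> 0 < s i j < 1.
Hypothesis chi_gt0 : forall i, 0 < chi i.
Hypothesis P_ge0 : forall i j, 0 <= P i j.
Hypothesis P_sum : forall i, \sum_j P i j = 1.
Hypothesis P_edge : forall i j, 0 < P i j <-> G i j.
Hypothesis G_lifts : forall i j, adm G i j ->
  [/\ G (lshift N i) (lshift N j), G (lshift N i) (rshift N j) &
      G (rshift N i) (rshift N j)].
Hypothesis adm_out : forall i, exists j, adm G i j.
Variable nu : probability (borelType (path_space G)) R.
Hypothesis nuE : forall i w, sorted G (i :: w) ->
     nu (cylinder G (i :: w)) = (chi i * path_prob P i w)%:E.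
Local Notation edge_weight := (edge_weight s P).

(** The lifts of [i :: u] that start in the first copy, without their first letter. *)
Fixpoint lift_words (u : seq 'I_N) : seq (seq 'I_(N + N)) :=
  if u is j :: u' then
    map (@rshift N N) u :: [seq lshift N j :: l | l <- lift_words u']
  else [:: [::]].

Lemma lift_words_uniq u : uniq (lift_words u).
Proof.
elim: u => //= j u IH; rewrite map_inj_uniq ?IH ?andbT; last by move=> ? ? [].
apply/mapP => -[l _ /(congr1 (head (rshift N j)))/= /eqP].
by rewrite eq_rlshift.
Qed.

Lemma lift_words_base u l : l \in lift_words u -> map (@base N) l = u.
Proof.
have br v : map (@base N) (map (@rshift N N) v) = v.
  by rewrite -map_comp map_id_in// => j _ /=; rewrite base_rshift.
elim: u l => [|j u IH] l /=; first by rewrite inE => /eqP ->.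
rewrite inE => /orP[/eqP ->|/mapP[l' /IH l'u ->]] /=.
  by rewrite base_rshift br.
by rewrite base_lshift l'u.
Qed.

Lemma path_rshift i u : path (adm G) i u -> path G (rshift N i) (map (@rshift N N) u).
Proof.
elim: u i => //= j u IH i /andP[/G_lifts[_ _ ij] /IH ->].
by rewrite ij.
Qed.

Lemma lift_words_path i u l : path (adm G) i u -> l \in lift_words u ->
  path G (lshift N i) l.
Proof.
elim: u i l => [|j u IH] i l /=; first by rewrite inE => _ /eqP ->.
move=> /andP[/G_lifts[ll lr _] ju]; rewrite inE => /orP[/eqP ->|/mapP[l' l'u ->]] /=.
  by rewrite lr path_rshift.
by rewrite ll; exact: IH l'u.
Qed.

(** A crude tangent line to the concave power, with free parameter [c]. Being affine in [x], it can
    be summed over the lifts of a word and carried along the tree. *)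
Lemma tangent_powR (t x c : R) : 0 < t -> t < 1 -> 0 < x -> 0 < c ->
  x `^ t <= x * c `^ (t - 1) + c `^ t.
Proof.
move=> t0 t1 x0 c0; have [xc|cx] := leP x c.
  rewrite ler_wpDl ?mulr_ge0 ?powR_ge0 ?(ltW x0)//.
  by apply: ge0_ler_powR; rewrite ?nnegrE ?(ltW t0) ?(ltW x0) ?(ltW c0).
rewrite ler_wpDr ?powR_ge0//.
have -> : x `^ t = x * x `^ (t - 1).
  by rewrite -{2}(powRr1 (ltW x0)) -powRD ?gt_eqF ?implybT// addrC subrK.
rewrite ler_pM2l// -[t - 1]opprB !powRN lef_pV2 ?posrE ?powR_gt0//.
by apply: ge0_ler_powR; rewrite ?nnegrE ?subr_ge0 ?(ltW t1) ?(ltW x0) ?(ltW c0) ?(ltW cx).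
Qed.

Section Blowup.
Variables (r t : R) (h1 h2 : 'I_N -> R).
Hypotheses (r_gt0 : 0 < r) (t_gt0 : 0 < t) (t_lt1 : t < 1).
Let a1 i j := edge_weight r (lshift N i) (lshift N j).
Let a2 i j := edge_weight r (rshift N i) (rshift N j).
Let a3 i j := edge_weight r (lshift N i) (rshift N j).
Hypothesis h1_gt0 : forall i, 0 < h1 i.
Hypothesis h2_gt0 : forall i, 0 < h2 i.
Hypothesis h1_eq : forall i, \sum_j a1 i j `^ t * h1 j = h1 i.
Hypothesis h2_eq : forall i, \sum_j a2 i j `^ t * h2 j = h2 i.

(** In a state [(X, Y, z, d, v)], for a word [u] of length [d] ending in [v],
    [X] is the weight of the lift of [u] that stays in the first copy, [Y] is
    the sum of the weights of the other lifts and [z] is the sum of their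
    [t]-th powers. *)
Let St := (R * R * R * nat * 'I_N)%type.
Let step (st : St) (j : 'I_N) : St :=
  let: (X, Y, z, d, v) := st in
  (X * a1 v j, Y * a2 v j + X * a3 v j, z * a2 v j `^ t + (X * a3 v j) `^ t, d.+1, j).
Let vert (st : St) : 'I_N := st.2.
Let stop (st : St) : bool := let: (X, Y, _, _, _) := st in X + Y < 1.

Let vert_step st j : vert (step st j) = j.
Proof. by case: st => [[[[X Y] z] d] v]. Qed.

(** Ties the state to the actual lifts. The term in [Y] is for the induction; it vanishes for the
    initial state, where [Y = 0]. *)
Let lift_weight_step X Y z d v u :
  let: (X', Y', _, _, _) := foldl step (X, Y, z, d, v) u in
  X' + Y' = X * (\sum_(l <- lift_words u) path_weight (edge_weight r) (lshift N v) l)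
    + Y * path_weight (edge_weight r) (rshift N v) (map (@rshift N N) u).
Proof.
elim: u X Y z d v => [|j u IH] X Y z d v /=; first by rewrite big_seq1 !mulr1.
have := IH (X * a1 v j) (Y * a2 v j + X * a3 v j)
  (z * a2 v j `^ t + (X * a3 v j) `^ t) d.+1 j.
case: (foldl _ _ _) => [[[[X' Y'] z'] d'] v'] ->.
rewrite big_cons big_map /= -mulr_sumr /a1 /a2 /a3; ring.
Qed.

Variables (m k : R) (B M : nat).
Hypotheses (m_gt0 : 0 < m) (m_lt1 : m < 1) (k_gt0 : 0 < k) (k_lt1 : k < 1).
Hypothesis m_le : forall i j, G i j -> m <= edge_weight r i j.
Hypothesis k_ge : forall i j, edge_weight r i j <= k * P i j.
Hypothesis kB : k ^+ B <= m.
Hypothesis M_gt0 : (0 < M)%N.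
Variable i0 : 'I_N.
(** The initial weight [1 / e] for [e = m ^ M], so that [M] is proportional to [ln (1 / e)]. *)
Let X0 := (m ^+ M)^-1.

Let X0_gt0 : 0 < X0. Proof. by rewrite invr_gt0 exprn_gt0. Qed.

(** The two estimates in terms of [d] confine the depth at stopping between [M] and [B * M + 1]. The
    last clause is the tangent inequality summed over the [d] lifts counted in [Y], for all [c] at
    once because a step rescales [c]. *)
Let I n (st : St) : Prop := let: (X, Y, z, d, v) := st in
  [/\ 0 < X, 0 <= Y & m <= X + Y] /\
  [/\ (X + Y) * k ^+ n < 1, X + Y <= k ^+ d * X0, m ^+ d * X0 <= X,
      (d <= (B * M).+1)%N &
      forall c, 0 < c -> z <= Y * c `^ (t - 1) + d%:R * c `^ t].

Let I_fuel st : I 0 st -> stop st.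
Proof. by case: st => [[[[X Y] z] d] v] [_ []]; rewrite expr0 mulr1. Qed.

(** The lift in the first copy has two continuations over the same base letter, so the sum [a1 + a3]
    must be contracted; this holds because the row of [P] sums to 1. *)
Let a_gt0 i j : adm G i j -> [/\ m <= a1 i j, m <= a2 i j, m <= a3 i j & a1 i j + a3 i j <= k] /\ a2 i j <= k.
Proof.
move=> /G_lifts[ll lr rr]; split; first split; try exact: m_le.
  rewrite /a1 /a3; apply: (le_trans (lerD (k_ge _ _) (k_ge _ _))).
  rewrite -mulrDr ler_piMr ?(ltW k_gt0)// -(P_sum (lshift N i)) big_split_ord /=.
  by apply: lerD; rewrite (bigD1 j)//= lerDl sumr_ge0.
by apply: (le_trans (k_ge _ _)); rewrite ler_piMr ?(ltW k_gt0)// (P_le1 P_ge0 P_sum).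
Qed.

(** At depth [B * M + 1] the total weight is at most [k * m ^ M * X0 = k < 1], by the choice of
    [B]. *)
Let depth_le X Y d : 1 <= X + Y -> X + Y <= k ^+ d * X0 -> (d <= B * M)%N.
Proof.
move=> XY1 XYd; rewrite leqNgt; apply/negP => dBM.
have kd : k ^+ d <= k * m ^+ M.
  apply: (@le_trans _ _ (k ^+ (B * M).+1)).
    by rewrite ler_wiXn2l// ltW.
  by rewrite exprS ler_pM2l// exprM lerXn2r ?nnegrE ?exprn_ge0 ?(ltW k_gt0) ?(ltW m_gt0).
have := le_trans XY1 XYd; apply/negP; rewrite -ltNge.
apply: (@le_lt_trans _ _ (k * m ^+ M * X0)); first by rewrite ler_pM2r.
by rewrite /X0 mulfK ?gt_eqF ?exprn_gt0.
Qed.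

Let I_step n st j : I n.+1 st -> ~~ stop st -> adm G (vert st) j -> I n (step st j).
Proof.
case: st => [[[[X Y] z] d] v] [[X_gt0 Y_ge0 mXY] [fuel XYk mX dB zc]].
rewrite /stop -leNgt /vert /= => XY1 vj.
have [[m1 m2 m3 k13] k2] := a_gt0 vj.
have a1_gt0 : 0 < a1 v j by exact: lt_le_trans m1.
have a2_gt0 : 0 < a2 v j by exact: lt_le_trans m2.
have a3_gt0 : 0 < a3 v j by exact: lt_le_trans m3.
have XY' : X * a1 v j + (Y * a2 v j + X * a3 v j) <= k * (X + Y).
  have e1 : X * (a1 v j + a3 v j) <= X * k by rewrite ler_pM2l.
  have e2 : Y * a2 v j <= Y * k by rewrite ler_wpM2l.
  by move: e1 e2; rewrite mulrDr mulrDr ![k * _]mulrC; lra.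
split; split.
- exact: mulr_gt0.
- by apply: addr_ge0; [rewrite mulr_ge0 ?(ltW a2_gt0) | exact/ltW/mulr_gt0].
- apply: (@le_trans _ _ (m * (X + Y))); first by rewrite ler_peMr// ltW.
  have e1 : X * m <= X * a1 v j by rewrite ler_pM2l.
  have e2 : Y * m <= Y * a2 v j by rewrite ler_wpM2l.
  have e3 : 0 < X * a3 v j by rewrite mulr_gt0.
  by move: e1 e2 e3; rewrite mulrDr ![m * _]mulrC; lra.
- apply: le_lt_trans fuel; rewrite exprS mulrA [(X + Y) * k]mulrC.
  by rewrite ler_pM2r ?exprn_gt0.
- by apply: (le_trans XY'); rewrite exprS -mulrA ler_pM2l.
- rewrite exprS -mulrA mulrC; apply: ler_pM => //.
    by rewrite mulr_ge0// ?exprn_ge0// ltW.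
  exact: ltW.
- by rewrite ltnS; exact: depth_le XY1 XYk.
- move=> c c0.
  (* The old lifts are multiplied by [a2], so their estimate is taken at [c / a2]; the lift that has
     just left the first copy is estimated by its own tangent at [c]. *)
  have ca0 : 0 < c / a2 v j by rewrite divr_gt0.
  have pt0 : 0 < a2 v j `^ t by rewrite powR_gt0.
  have := zc _ ca0; rewrite -(ler_pM2r pt0) mulrDl.
  have -> : Y * (c / a2 v j) `^ (t - 1) * a2 v j `^ t = Y * a2 v j * c `^ (t - 1).
    rewrite powRM ?invr_ge0 ?(ltW c0) ?(ltW a2_gt0)//.
    rewrite -(powR_inv1 (ltW a2_gt0)) -powRrM -mulrA -mulrA -powRD; last first.
      by rewrite (lt0r_neq0 a2_gt0) implybT.
    have -> : -1 * (t - 1) + t = 1 by ring.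
    by rewrite powRr1 ?(ltW a2_gt0)//; ring.
  have -> : d%:R * (c / a2 v j) `^ t * a2 v j `^ t = d%:R * c `^ t.
    by rewrite -mulrA -powRM ?divfK ?gt_eqF// ltW.
  have := tangent_powR t_gt0 t_lt1 (mulr_gt0 X_gt0 a3_gt0) c0.
  rewrite -[d.+1]addn1 natrD; move: (c `^ (t - 1)) (c `^ t) => x y; lra.
Qed.

Variables (D2 c3 : R).
Hypothesis h2_le : forall i, h2 i <= D2.
Hypothesis c3_gt0 : 0 < c3.
Hypothesis c3_le : forall i, c3 * h1 i <= \sum_j a3 i j `^ t * h2 j.

(** Bounds [z * h2] at a leaf: the tangent invariant at [c = 1 / M], with [Y <= 1] and
    [d <= B * M + 1], gives [z <= (B + 2) M ^ (1 - t)]. *)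
Let W := D2 * ((B + 2)%:R * M%:R `^ (1 - t)).

Let D2_gt0 : 0 < D2. Proof. exact: lt_le_trans (h2_gt0 i0) (h2_le i0). Qed.

Let M_gt0R : 0 < M%:R :> R. Proof. by rewrite ltr0n. Qed.

Let W_gt0 : 0 < W.
Proof. by rewrite !mulr_gt0 ?powR_gt0// ltr0n addn2. Qed.

(** The second term is a credit for what [z] has yet to receive from the first copy: each step
    spends one unit [c3 X^t h1], covered by the newly leaving lift. At the root the credit is
    proportional to [M], at the leaves it is used up. *)
Let U (st : St) : R := let: (X, Y, z, d, v) := st in
  W^-1 * (z * h2 v + c3 * X `^ t * h1 v * (M - d)%:R).

Let U_stop n st : I n st -> stop st -> U st <= 1.
Proof.
case: st => [[[[X Y] z] d] v] [[X_gt0 Y_ge0 mXY] [fuel XYk mX dB zc]].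
rewrite /stop /= => XY1; rewrite mulrC ler_pdivrMr// mul1r.
have Md : (M <= d)%N.
  rewrite leqNgt; apply/negP => dM.
  have : m ^+ M <= m ^+ d by rewrite ler_wiXn2l ?(ltW m_gt0) ?(ltW m_lt1) ?(ltnW dM).
  apply/negP; rewrite -ltNge -[ltRHS]mul1r -ltr_pdivrMr ?exprn_gt0//.
  by apply: (le_lt_trans mX); apply: le_lt_trans XY1; rewrite lerDl.
move: Md; rewrite -subn_eq0 => /eqP ->; rewrite mulr0 addr0.
have zW : z <= (B + 2)%:R * M%:R `^ (1 - t).
  have MV0 : 0 < M%:R^-1 :> R by rewrite invr_gt0.
  apply: (le_trans (zc _ MV0)).
  have -> : (M%:R^-1 : R) `^ (t - 1) = M%:R `^ (1 - t).
    by rewrite -(powR_inv1 (ltW M_gt0R)) -powRrM; congr powR; ring.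
  have -> : (M%:R^-1 : R) `^ t = M%:R^-1 * M%:R `^ (1 - t).
    rewrite -(powR_inv1 (ltW M_gt0R)) -powRrM -powRD; last by rewrite (lt0r_neq0 M_gt0R) implybT.
    by congr powR; ring.
  rewrite mulrA -mulrDl ler_wpM2r ?powR_ge0// natrD addrC.
  have Y1 : Y <= 1 by apply: ltW; apply: le_lt_trans XY1; rewrite lerDr ltW.
  suff : d%:R / M%:R <= B%:R + 1 :> R by move: Y1; lra.
  rewrite ler_pdivrMr// natr1 -natrM ler_nat mulSn.
  by rewrite (leq_trans dB)// -add1n leq_add2r.
(* The invariant does not record the sign of [z]. *)
have [z0|z0] := leP 0 z.
  by rewrite /W mulrC; apply: ler_pM => //; rewrite ltW.
by apply: (@le_trans _ _ 0); [rewrite nmulr_rle0// ltW | rewrite ltW].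
Qed.

Let U_step n st : I n.+1 st -> ~~ stop st ->
  U st <= \sum_(j | adm G (vert st) j) U (step st j).
Proof.
case: st => [[[[X Y] z] d] v] [[X_gt0 Y_ge0 mXY] _] _; rewrite /vert /=.
rewrite -mulr_sumr ler_pM2l ?invr_gt0//.
have nadm j : ~~ adm G v j -> [/\ a1 v j = 0, a2 v j = 0 & a3 v j = 0].
  move=> nvj; split; apply: (edge_weight_eq0 s P_ge0 P_edge); apply: contra nvj;
    by move=> /edge_adm; rewrite ?base_lshift ?base_rshift.
have t_neq0 : t != 0 by rewrite gt_eqF.
rewrite big_mkcond /=.
have -> : \sum_j (if adm G v j then (z * a2 v j `^ t + (X * a3 v j) `^ t) * h2 j +
      c3 * (X * a1 v j) `^ t * h1 j * (M - d.+1)%:R else 0) =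
    z * h2 v + X `^ t * (\sum_j a3 v j `^ t * h2 j) +
      c3 * X `^ t * h1 v * (M - d.+1)%:R.
  rewrite -{1}h2_eq -{1}h1_eq !mulr_sumr mulr_suml -!big_split /=.
  apply: eq_bigr => j _; case: ifPn => [vj|/nadm[-> -> ->]]; last first.
    by rewrite !(powR0 t_neq0) !(mul0r, mulr0, addr0).
  have [[m1 _ m3 _] _] := a_gt0 vj.
  have a1_ge0 : 0 <= a1 v j by exact: le_trans (ltW m_gt0) m1.
  have a3_ge0 : 0 <= a3 v j by exact: le_trans (ltW m_gt0) m3.
  rewrite (powRM _ (ltW X_gt0) a3_ge0) (powRM _ (ltW X_gt0) a1_ge0).
  move: (a1 v j `^ t) (a2 v j `^ t) (a3 v j `^ t) (X `^ t) (M - d.+1)%:R => *; ring.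
suff key : c3 * X `^ t * h1 v * (M - d)%:R <=
    X `^ t * (\sum_j a3 v j `^ t * h2 j) + c3 * X `^ t * h1 v * (M - d.+1)%:R.
  by rewrite -[leRHS]addrA; exact: (lerD (lexx (z * h2 v)) key).
(* Subtraction is truncated, so this also holds once the credit is exhausted. *)
have Md : (M - d)%:R <= (M - d.+1)%:R + 1 :> R.
  by rewrite natr1 ler_nat subnS; case: (M - d)%N.
have hX : 0 <= c3 * X `^ t * h1 v.
  by rewrite !mulr_ge0 ?powR_ge0 ?(ltW c3_gt0) ?(ltW (h1_gt0 v)).
apply: (le_trans (ler_wpM2l hX Md)); rewrite mulrDr mulr1 addrC.
apply: lerD => //; apply: le_trans (ler_wpM2l (powR_ge0 X t) (c3_le v)).
by rewrite mulrCA mulrA.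
Qed.

(** The root value of [U] is of order [M X0^t / M^(1 - t)], that is [M ^ t * e ^ (- t)] with
    [e = m ^ M]. *)
Lemma packing_of_equal_radii : exists2 L,
  packing s nu r (chi (lshift N i0) * m * m ^+ M) L &
  c3 * h1 i0 / (D2 * (B + 2)%:R) * (M%:R `^ t * (m ^+ M) `^ (- t)) <= (size L)%:R.
Proof.
have X01 : 1 <= X0.
  by rewrite /X0 invf_ge1 ?exprn_gt0//; apply: exprn_ile1; exact: ltW.
have [n kn] : exists n, k ^+ n < X0^-1 by apply: (expr_small k_gt0 k_lt1); rewrite invr_gt0; exact: X0_gt0.
pose st0 : St := (X0, 0, 0, 0%N, i0).
have I0 : I n st0.
  split; split.
  - exact: X0_gt0.
  - exact: lexx.
  - by rewrite addr0; exact: le_trans (ltW m_lt1) X01.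
  - by rewrite addr0 mulrC -ltr_pdivlMr// mul1r.
  - by rewrite addr0 expr0 mul1r.
  - by rewrite expr0 mul1r.
  - by [].
  - by move=> c _; rewrite !mul0r addr0.
pose C := cut step vert (adm G) stop n st0.
exists [seq (i0, u) | u <- C].
  apply: packing_singleton_start.
  - exact: cut_uniq.
  - by move=> u uC; exact: (cut_path vert_step uC).
  - by move=> u v; exact: cut_prefix.
  move=> u uC; have pu : path (adm G) i0 u by exact: (cut_path vert_step uC).
  rewrite -[i0 in word_ratio _ i0](base_lshift i0) -[i0 in base_cylinder _ (i0 :: _)](base_lshift i0).
  apply: (base_cylinder_weight s_contr chi_gt0 nuE (lift_words_uniq u)).
  - by rewrite base_lshift.
  - by move=> l lu; rewrite (lift_words_path pu lu) (lift_words_base lu).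
  rewrite -mulrA ler_pM2l//.
  have [_ [n' In']] := cut_stop I_fuel I_step I0 uC.
  have := lift_weight_step X0 0 0 0%N i0 u; rewrite -/st0.
  case: (foldl _ _ _) In' => [[[[X Y] z] d] v] [[_ _ mXY] _] XYE.
  move: mXY; rewrite XYE mul0r addr0 mulrC -ler_pdivrMr// /X0 invrK => /le_trans; apply.
  exact: lexx.
rewrite size_map.
have := cut_size_ge I_fuel I_step U_stop U_step I0.
apply: le_trans; rewrite /= mul0r add0r subn0 /X0 /W.
have -> : ((m ^+ M)^-1 : R) `^ t = (m ^+ M) `^ (- t).
  by rewrite -powR_inv1 ?exprn_ge0 ?(ltW m_gt0)// -powRrM mulN1r.
have -> : M%:R `^ t = M%:R / M%:R `^ (1 - t) :> R.
  apply: (mulIf (x := M%:R `^ (1 - t))); first by rewrite gt_eqF ?powR_gt0.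
  rewrite divfK ?gt_eqF ?powR_gt0// -powRD; last by rewrite (lt0r_neq0 M_gt0R) implybT.
  by rewrite addrC subrK powRr1.
rewrite !invfM le_eqVlt; apply/orP; left; apply/eqP; ring.
Qed.

End Blowup.

(** Supplies constants independent of [M]. In particular [c3] is positive because every base letter
    has an admissible successor, over which a passage to the second copy exists. *)
Lemma packing_blowup r t h1 h2 : 0 < r -> 0 < t -> t < 1 ->
  (forall i, 0 < h1 i) -> (forall i, 0 < h2 i) ->
  (forall i, \sum_j edge_weight r (lshift N i) (lshift N j) `^ t * h1 j = h1 i) ->
  (forall i, \sum_j edge_weight r (rshift N i) (rshift N j) `^ t * h2 j = h2 i) ->
  exists c c1 m, [/\ 0 < c, 0 < c1, 0 < m, m < 1 & forall M, (0 < M)%N ->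
    exists2 L, packing s nu r (c1 * m ^+ M) L &
      c * (M%:R `^ t * (m ^+ M) `^ (- t)) <= (size L)%:R].
Proof.
move=> r0 t0 t1 h10 h20 E1 E2.
have [m [k' [m0 m1 _ _ mk]]] := edge_weight_bounds s_contr P_ge0 P_sum P_edge r0.
have [k [k0 k1 wk]] := edge_weight_contraction s_contr P_ge0 P_edge r0.
have [B kB] := expr_small k0 k1 m0.
have [D2 [D20 h2D]] := exists_upper_bound h2.
have [D1 [D10 h1D]] := exists_upper_bound h1.
pose i0 : 'I_N := Ordinal (ltnW (digraph_gt1 G)).
pose S i := \sum_j edge_weight r (lshift N i) (rshift N j) `^ t * h2 j.
have S0 i : 0 < S i.
  have [j ij] := adm_out i; have [_ lr _] := G_lifts ij.
  rewrite /S (bigD1 j)//= ltr_pwDl//.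
    by rewrite mulr_gt0 ?powR_gt0// (edge_weight_gt0 s_contr P_edge).
  by apply: sumr_ge0 => l _; rewrite mulr_ge0 ?powR_ge0// ltW.
have [cS [cS0 Sc]] := exists_lower_bound S0.
pose c3 := cS / D1; have c30 : 0 < c3 by rewrite divr_gt0.
have c3S i : c3 * h1 i <= S i.
  apply: le_trans (Sc i); rewrite /c3 mulrAC ler_pdivrMr// ler_pM2l//.
exists (c3 * h1 i0 / (D2 * (B + 2)%:R)), (chi (lshift N i0) * m), m; split => //.
- by apply: divr_gt0; apply: mulr_gt0; rewrite ?h10 ?ltr0n ?addn2.
- exact: mulr_gt0.
move=> M M0; apply: (@packing_of_equal_radii r t h1 h2 t0 t1 h10 h20 E1 E2 m k B M) => //.
- by move=> i j /mk/andP[].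
- exact: ltW.
Qed.

End EqualDimensions.

(** * The quantization dimension and coefficients *)

Section Rates.
Variables (R : realType) (q N : nat) (G : digraph N).
Variables (s : 'I_N -> 'I_N -> R) (chi : 'I_(N + N) -> R) (P : 'M[R]_(N + N)).
Variable nu : probability (borelType (path_space G)) R.
Variable mu : set (borelType 'rV[R]_q) -> \bar R.
Variables (D d : R).
Hypotheses (D_gt0 : 0 < D) (d_gt0 : 0 < d).
Hypothesis err_le : forall r k e (L : seq ('I_(N + N) * seq 'I_(N + N))), 0 < r ->
    (0 < size L <= k)%N ->
    (forall p, p \in L -> path G p.1 p.2) ->
    (forall x, exists2 p, p \in L & cylinder G (p.1 :: p.2) x) ->
    (forall p, p \in L -> chi p.1 * path_weight (edge_weight s P r) p.1 p.2 <= e) ->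
  (quant_err_pow mu r k <= (D `^ r * (k%:R * e))%:E)%E.
Hypothesis err_ge : forall r k e L, 0 < r -> 0 <= e -> packing s nu r e L ->
    (2 * k <= size L)%N ->
  ((d `^ r * (k%:R * e))%:E <= quant_err_pow mu r k)%E.

Let powR_inv_exp (x t : R) : 0 <= x -> t != 0 -> (x `^ t^-1) `^ (- t) = x^-1.
Proof. by move=> x0 t0; rewrite -powRrM mulrN mulVf// powR_inv1. Qed.

Let mul_powR_inv (c k t : R) : 0 < c -> 0 < k ->
  k * (c / k) `^ t^-1 = c `^ t^-1 * k `^ (- (t^-1 - 1)).
Proof.
move=> c0 k0; rewrite powRM ?invr_ge0 ?(ltW c0) ?(ltW k0)//.
rewrite mulrCA; congr (_ * _).
rewrite -{1}(powRr1 (ltW k0)) -(powR_inv1 (ltW k0)) -powRrM -powRD.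
  by congr powR; ring.
by rewrite (lt0r_neq0 k0) implybT.
Qed.

Let powR_inv_le (c e k t : R) : 0 < t -> 0 < c -> 0 < e -> 0 < k ->
  c / e `^ t <= k -> (c / k) `^ t^-1 <= e.
Proof.
move=> t0 c0 e0 k0 ck.
have -> : e = (e `^ t) `^ t^-1.
  by rewrite -powRrM mulfV ?powRr1 ?(ltW e0)// gt_eqF.
apply: ge0_ler_powR; rewrite ?nnegrE ?invr_ge0 ?powR_ge0 ?(ltW t0) ?divr_ge0 ?(ltW c0) ?(ltW k0)//.
by rewrite ler_pdivrMr// mulrC -ler_pdivrMr ?powR_gt0.
Qed.

Let nat_large (x : R) k : (Num.truncn x < k)%N -> x <= k%:R.
Proof.
move=> xk; apply/ltW/(lt_le_trans (truncnS_gt x)).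
by rewrite ler_nat.
Qed.

Lemma quant_err_of_cover_growth r t : 0 < r -> 0 < t -> cover_growth G s chi P r t ->
  exists C K, 0 < C /\ forall k, (K <= k)%N -> (0 < k)%N ->
    (quant_err_pow mu r k <= (C * k%:R `^ (- (t^-1 - 1)))%:E)%E.
Proof.
move=> r0 t0 [C [e0 [C0 e00 HL]]].
exists (D `^ r * C `^ t^-1), (Num.truncn (C / e0 `^ t)).+1; split.
  by rewrite mulr_gt0 ?powR_gt0.
move=> k Kk k0; have kR : 0 < k%:R :> R by rewrite ltr0n.
(* The solution of [C * e ^ (- t) = k]; then [k * e] is a constant times [k ^ (1 - 1 / t)]. *)
pose e := (C / k%:R) `^ t^-1.
have e_gt0 : 0 < e by rewrite powR_gt0// divr_gt0.
have ee0 : e <= e0 by apply: powR_inv_le => //; exact: nat_large.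
have [L [L0 LC Lpath Lcov Le]] := HL e e_gt0 ee0.
have Lk : (size L <= k)%N.
  rewrite -(ler_nat R); apply: (le_trans LC).
  rewrite powR_inv_exp ?gt_eqF ?divr_ge0 ?(ltW C0) ?(ltW kR)//.
  by rewrite invf_div mulrC divfK// gt_eqF.
have := err_le r0 _ Lpath Lcov Le; move=> /(_ k); rewrite L0 Lk => /(_ isT).
by rewrite /e mul_powR_inv// mulrA.
Qed.

Lemma quant_err_of_packing_growth r t : 0 < r -> 0 < t ->
  packing_growth s nu r t ->
  exists c K, 0 < c /\ forall k, (K <= k)%N -> (0 < k)%N ->
    ((c * k%:R `^ (- (t^-1 - 1)))%:E <= quant_err_pow mu r k)%E.
Proof.
move=> r0 t0 [c [c1 [e0 [c0 c10 e00 HL]]]].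
exists (d `^ r * c1 * ((c / 2) `^ t^-1)), (Num.truncn (c / e0 `^ t)).+1; split.
  by rewrite !mulr_gt0 ?powR_gt0// divr_gt0.
move=> k Kk k0; have kR : 0 < k%:R :> R by rewrite ltr0n.
(* The solution of [c * e ^ (- t) = 2 * k], so that the packing has the [2 k] words required. *)
pose e := (c / (2 * k%:R)) `^ t^-1.
have e_gt0 : 0 < e by rewrite powR_gt0// divr_gt0// mulr_gt0.
have ee0 : e <= e0.
  apply: powR_inv_le => //; first by rewrite mulr_gt0.
  by apply: (le_trans (nat_large Kk)); rewrite ler_peMl// ?ler1n// ltW.
have [L LP Lc] := HL e e_gt0 ee0.
have Lk : (2 * k <= size L)%N.
  rewrite -(ler_nat R); apply: le_trans Lc.
  rewrite powR_inv_exp ?gt_eqF ?divr_ge0 ?mulr_ge0 ?(ltW c0) ?(ltW kR)//.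
  by rewrite invf_div mulrC divfK ?gt_eqF// natrM.
apply: le_trans (err_ge r0 _ LP Lk); last by rewrite mulr_ge0 ?(ltW c10) ?(ltW e_gt0).
rewrite lee_fin -!mulrA ler_pM2l ?powR_gt0// [leRHS]mulrCA ler_pM2l//.
have -> : e = (c / 2 / k%:R) `^ t^-1 by rewrite /e invfM mulrA.
by rewrite mul_powR_inv// divr_gt0.
Qed.

Lemma quant_err_of_blowup r t c c1 m : 0 < r -> 0 < t -> 0 < c -> 0 < c1 ->
  0 < m -> m < 1 ->
  (forall M, (0 < M)%N -> exists2 L, packing s nu r (c1 * m ^+ M) L &
      c * (M%:R `^ t * (m ^+ M) `^ (- t)) <= (size L)%:R) ->
  forall (A : R) K, exists2 k, (K <= k)%N && (0 < k)%N &
    ((A * k%:R `^ (- (t^-1 - 1)))%:E <= quant_err_pow mu r k)%E.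
Proof.
move=> r0 t0 c0 c10 m0 m1 HL A K.
have dr : 0 < d `^ r by rewrite powR_gt0.
pose b := d `^ r * c1 * (c / 4) `^ t^-1.
have b0 : 0 < b by rewrite !mulr_gt0 ?powR_gt0// divr_gt0.
(* [M >= B] makes the packing so large that half its size exceeds [K]; [M >= A / b] makes the
   resulting constant at least [A]. *)
pose B := (4 * K.+1%:R / c) `^ t^-1 : R.
pose M := (maxn (Num.truncn (A / b)) (Num.truncn B)).+1.
have AM : A <= b * M%:R.
  by rewrite mulrC -ler_pdivrMr//; apply: nat_large; rewrite ltnS leq_maxl.
have BM : B <= M%:R by apply: nat_large; rewrite ltnS leq_maxr.
have [L LP Lc] := HL M (ltn0Sn _).
pose e := m ^+ M; have e0 : 0 < e by rewrite exprn_gt0.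
have MR : 0 < M%:R :> R by rewrite ltr0n.
have Mt : 4 * K.+1%:R / c <= M%:R `^ t.
  have -> : 4 * K.+1%:R / c = B `^ t.
    rewrite /B -powRrM mulVf ?gt_eqF// powRr1// divr_ge0 ?(ltW c0)// mulr_ge0//.
  by apply: ge0_ler_powR; rewrite ?nnegrE ?powR_ge0 ?(ltW t0).
have et : 1 <= e `^ (- t).
  rewrite powRN invf_ge1 ?powR_gt0//.
  have : e `^ t <= 1 `^ t.
    apply: ge0_ler_powR; rewrite ?nnegrE ?(ltW t0) ?(ltW e0)//.
    by apply: exprn_ile1; exact: ltW.
  by rewrite powR1.
have L4 : (4 * K.+1 <= size L)%N.
  rewrite -(ler_nat R); apply: le_trans Lc; rewrite natrM.
  have -> : 4%:R * K.+1%:R = c * (4 * K.+1%:R / c) by rewrite [RHS]mulrC divfK// gt_eqF.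
  rewrite ler_pM2l// -[leLHS]mulr1; apply: ler_pM => //.
  by rewrite divr_ge0 ?(ltW c0)// mulr_ge0.
pose k := (size L)./2.
have L2k : (2 * k <= size L)%N by rewrite mul2n -[leqRHS]odd_double_half leq_addl.
have Lk4 : (size L <= 4 * k)%N.
  have : (size L <= k.*2.+1)%N.
    by rewrite -[leqLHS]odd_double_half -add1n leq_add2r; case: odd.
  move=> Lk; rewrite (leq_trans Lk)// -mul2n.
  have k1 : (0 < k)%N.
    by rewrite half_gt0 (leq_trans _ L4)// mulnS ltnW.
  by rewrite -[4%N]/(2 + 2)%N mulnDl -addn1 leq_add2l muln_gt0.
have Kk : (K < k)%N by rewrite -(leq_pmul2l (m := 4))// (leq_trans L4).
exists k; first by rewrite (ltnW Kk) (leq_ltn_trans _ Kk).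
have kR : 0 < k%:R :> R by rewrite ltr0n (leq_ltn_trans _ Kk).
apply: le_trans (err_ge r0 _ LP L2k); last by rewrite mulr_ge0 ?(ltW c10) ?(ltW e0).
(* Taking the power [1 / t] of [(c / 4) M^t e^(-t) <= k] turns the gain [M ^ t] into a factor [M] of
   the error. *)
have key : (c / 4) `^ t^-1 * M%:R <= k%:R `^ t^-1 * e.
  have -> : (c / 4) `^ t^-1 * M%:R = ((c / 4) * (M%:R `^ t * e `^ (- t))) `^ t^-1 * e.
    rewrite [in RHS]powRM ?mulr_ge0 ?powR_ge0 ?divr_ge0 ?(ltW c0)//.
    rewrite [X in _ = _ * X * _]powRM ?powR_ge0// -!powRrM mulNr mulfV ?gt_eqF//.
    by rewrite powRr1 ?(ltW MR)// powR_inv1 ?(ltW e0)// -!mulrA mulVf ?mulr1// gt_eqF.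
  rewrite ler_pM2r//; apply: ge0_ler_powR; rewrite ?nnegrE ?invr_ge0 ?(ltW t0) ?(ltW kR)//.
    by rewrite !mulr_ge0 ?powR_ge0 ?divr_ge0 ?(ltW c0).
  rewrite mulrAC ler_pdivrMr// (le_trans Lc)// -natrM ler_nat mulnC.
  exact: Lk4.
have kE : k%:R = k%:R `^ t^-1 * k%:R `^ (- (t^-1 - 1)) :> R.
  rewrite -powRD; last by rewrite (lt0r_neq0 kR) implybT.
  by rewrite opprB addrC subrK powRr1 ?(ltW kR).
rewrite lee_fin [in leRHS]kE.
have x0 : 0 < k%:R `^ (- (t^-1 - 1)) by rewrite powR_gt0.
apply: (@le_trans _ _ (b * M%:R * k%:R `^ (- (t^-1 - 1)))).
  by rewrite ler_pM2r.
have := key; rewrite -(ler_pM2r x0) -(ler_pM2l c10) -(ler_pM2l dr).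
rewrite /b -/e; move: (k%:R `^ (- (t^-1 - 1))) (k%:R `^ t^-1) ((c / 4) `^ t^-1) (d `^ r) (M%:R) => *; lra.
Qed.

End Rates.

(** * Critical exponents and the dimensions defined by them *)

Section Dimensions.
Variables (R : realType) (N : nat) (G : digraph N).
Variables (s : 'I_N -> 'I_N -> R) (P : 'M[R]_(N + N)).
Hypothesis s_contr : forall i j, adm G i j -> 0 < s i j < 1.
Hypothesis P_ge0 : forall i j, 0 <= P i j.
Hypothesis P_sum : forall i, \sum_j P i j = 1.
Hypothesis P_edge : forall i j, 0 < P i j <-> G i j.

Let N_gt0 : (0 < N)%N. Proof. exact: ltnW (digraph_gt1 G). Qed.

Definition block (emb : 'I_N -> 'I_(N + N)) r : 'M[R]_N :=
  \matrix_(i, j) edge_weight s P r (emb i) (emb j).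

Lemma sum_lshift_le1 i : \sum_j P (lshift N i) (lshift N j) <= 1.
Proof. by rewrite -(P_sum (lshift N i)) big_split_ord /= lerDl sumr_ge0. Qed.

Lemma sum_rshift_le1 i : \sum_j P (rshift N i) (rshift N j) <= 1.
Proof. by rewrite -(P_sum (rshift N i)) big_split_ord /= lerDr sumr_ge0. Qed.

(** Row sums of the block are at most [k < 1], which forces the root below 1; two positive entries
    in each row make it exist above 0. *)
Lemma block_radius emb r : (forall i, \sum_j P (emb i) (emb j) <= 1) -> 0 < r ->
  irreducible_mx (\matrix_(i, j) P (emb i) (emb j)) ->
  (forall i : 'I_N, (1 < #|[pred j | (0 < P (emb i) (emb j))%R]|)%N) ->
  exists rad : R -> R,
  [/\ forall t, spectral_radius (pow_mx (block emb r) t) = rad t,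
      forall t, exists h, (forall i, 0 < h i) /\
        forall i, mulmv (pow_mx (block emb r) t) h i = rad t * h i,
      forall t t', 0 < t -> t < t' -> rad t' < rad t &
      exists t, [/\ 0 < t, t < 1 & rad t = 1]].
Proof.
move=> Psub r0 Pirr Prow.
have [k [k0 k1 wk]] := edge_weight_contraction s_contr P_ge0 P_edge r0.
have b0 i j : 0 <= block emb r i j by rewrite mxE edge_weight_ge0.
have bk i j : block emb r i j <= k.
  by rewrite mxE (le_trans (wk _ _))// ler_piMr ?(ltW k0) ?(P_le1 P_ge0 P_sum).
have bpos i j : 0 < P (emb i) (emb j) -> 0 < block emb r i j.
  by move=> /P_edge ij; rewrite mxE (edge_weight_gt0 s_contr P_edge).
have birr : irreducible_mx (block emb r).
  apply: (irreducible_support _ Pirr) => // i j; first by rewrite mxE.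
  by rewrite mxE => /bpos.
exists (pow_radius (block emb r)); split => //.
- exact: pow_perron.
- exact: (@pow_radius_decr _ _ _ k).
apply: (@pow_radius_root _ _ _ k) => // i.
  apply: leq_trans (Prow i) _; apply: subset_leq_card; apply/fintype.subsetP => j.
  by rewrite !inE => /bpos.
apply: (@le_lt_trans _ _ (k * \sum_j P (emb i) (emb j))).
  by rewrite mulr_sumr; apply: ler_sum => j _; rewrite mxE wk.
apply: (@le_lt_trans _ _ (k * 1)); last by rewrite mulr1.
by rewrite ler_pM2l.
Qed.

(** [u / (u + r)] maps the positive numbers bijectively onto the interval from 0 to 1, with inverse
    [t * r / (1 - t)]; strict decrease of [f] gives the uniqueness that determines the value of
    [xget]. *)
Lemma xget_dimension (f : R -> R) r t : 0 < r -> 0 < t -> t < 1 -> f t = 1 ->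
  (forall x y, 0 < x -> x < y -> f y < f x) ->
  xget 0 [set u | 0 < u /\ f (u / (u + r)) = 1] = t * r / (1 - t).
Proof.
move=> r0 t0 t1 ft fdecr; have t1' : 0 < 1 - t by rewrite subr_gt0.
have finj x y : 0 < x -> 0 < y -> f x = f y -> x = y.
  move=> x0 y0 fxy; apply/eqP; case: (ltgtP x y) => // xy.
    by have := fdecr x y x0 xy; rewrite fxy ltxx.
  by have := fdecr y x y0 xy; rewrite fxy ltxx.
apply: xget_unique => [|u [u0 fu]] /=.
  split; first by rewrite divr_gt0// mulr_gt0.
  have -> : t * r / (1 - t) / (t * r / (1 - t) + r) = t.
    by field; rewrite !gt_eqF// -?addrA ?subrK; nra.
  exact: ft.
have ur : 0 < u + r by rewrite addr_gt0.
have <- : u / (u + r) = t by apply: finj => //; [rewrite divr_gt0 | rewrite fu ft].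
by field; rewrite !gt_eqF//; lra.
Qed.

Hypothesis P4_eq0 : dlsubmx P = 0.

(** The maximum of two strictly decreasing radii takes the value 1 at the larger of their roots. *)
Lemma sdim_values r rad1 rad2 t1 t2 : 0 < r ->
  (forall t, spectral_radius (pow_mx (block (@lshift N N) r) t) = rad1 t) ->
  (forall t, spectral_radius (pow_mx (block (@rshift N N) r) t) = rad2 t) ->
  (forall t, exists h, (forall i, 0 < h i) /\
     forall i, mulmv (pow_mx (block (@lshift N N) r) t) h i = rad1 t * h i) ->
  (forall t, exists h, (forall i, 0 < h i) /\
     forall i, mulmv (pow_mx (block (@rshift N N) r) t) h i = rad2 t * h i) ->
  (forall t t', 0 < t -> t < t' -> rad1 t' < rad1 t) ->
  (forall t t', 0 < t -> t < t' -> rad2 t' < rad2 t) ->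
  0 < t1 -> t1 < 1 -> rad1 t1 = 1 -> 0 < t2 -> t2 < 1 -> rad2 t2 = 1 ->
  [/\ sdim1 P s r = t1 * r / (1 - t1), sdim2 P s r = t2 * r / (1 - t2) &
      sdim P s r = Num.max t1 t2 * r / (1 - Num.max t1 t2)].
Proof.
move=> r0 E1 E2 per1 per2 dec1 dec2 t10 t11 r1 t20 t21 r2.
have ul t : ulsubmx (weight_mx P s r t) = pow_mx (block (@lshift N N) r) t.
  by apply/matrixP => i j; rewrite !mxE.
have dr t : drsubmx (weight_mx P s r t) = pow_mx (block (@rshift N N) r) t.
  by apply/matrixP => i j; rewrite !mxE.
have dl t : 0 < t -> dlsubmx (weight_mx P s r t) = 0.
  move=> t0; apply/matrixP => i j; rewrite !mxE.
  have /matrixP/(_ i j) := P4_eq0; rewrite !mxE => ->.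
  by rewrite mul0r powR0// gt_eqF.
have rhoE t : 0 < t -> spectral_radius (weight_mx P s r t) = Num.max (rad1 t) (rad2 t).
  move=> t0; rewrite -[weight_mx P s r t]submxK ul dr dl//.
  have [h1 [h10 H1]] := per1 t; have [h2 [h20 H2]] := per2 t.
  by apply: spectral_radius_ublock h10 H1 _ h20 H2 => // i j; exact: pow_mx_ge0.
split.
- rewrite -(xget_dimension r0 t10 t11 r1 dec1) /sdim1; congr xget.
  by apply/seteqP; split=> u [u0 /= ru]; split => //; move: ru; rewrite /rho1 ul E1.
- rewrite -(xget_dimension r0 t20 t21 r2 dec2) /sdim2; congr xget.
  by apply/seteqP; split=> u [u0 /= ru]; split => //; move: ru; rewrite /rho2 dr E2.
rewrite -(@xget_dimension (fun t => Num.max (rad1 t) (rad2 t)) r (Num.max t1 t2))//.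
- rewrite /sdim; congr xget; apply/seteqP; split=> u [u0 /= ru]; split => //;
    by move: ru; rewrite /rho rhoE// divr_gt0// addr_gt0.
- by rewrite lt_max t10.
- by rewrite gt_max t11.
- case: (ltgtP t1 t2) => [t12|t21'|t12].
  + by rewrite r2; apply/max_idPr; rewrite -r1 ltW// dec1.
  + by rewrite r1; apply/max_idPl; rewrite -r2 ltW// dec2.
  + by rewrite r1 t12 r2 maxxx.
- by move=> x y x0 xy; rewrite gt_max !lt_max dec1// dec2// orbT.
Qed.

Hypothesis P1_exit : forall i, exists j, 0 < P (lshift N i) (rshift N j).
Hypothesis P2_row : forall i : 'I_N,
  (1 < #|[pred j | (0 < P (rshift N i) (rshift N j))%R]|)%N.

(** At the parameter [t = u / (u + r)] with [u] fixed and small, the second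
    block dominates the stochastic matrix [P_2], whereas the first block tends
    to the strictly substochastic matrix [P_1] as [r] tends to 0. *)
Lemma small_r_separation : exists r0, 0 < r0 /\ forall r, 0 < r -> r < r0 ->
  exists t, [/\ 0 < t,
    forall i, \sum_j edge_weight s P r (lshift N i) (lshift N j) `^ t < 1 &
    forall i, 1 <= \sum_j edge_weight s P r (rshift N i) (rshift N j) `^ t].
Proof.
(* A row with two positive entries and sum 1 has no entry equal to 1. *)
have [p [p0 p1 Pp]] : exists p, [/\ 0 < p, p < 1 &
    forall i j, 0 < P (rshift N i) (rshift N j) -> P (rshift N i) (rshift N j) <= p].
  apply: (contraction_bound (e := fun i j => 0 < P (rshift N i) (rshift N j))) => i j ij.
  rewrite ij /= lt_neqAle (P_le1 P_ge0 P_sum) andbT; apply/eqP => Pij1.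
  have [j' [jj' ij']] : exists j', j' != j /\ 0 < P (rshift N i) (rshift N j').
    have /card_gt1P[x [y [xi yi xy]]] := P2_row i.
    have [xj|xj] := eqVneq x j; last by exists x.
    by exists y; rewrite -xj eq_sym.
  have := P_sum (rshift N i).
  rewrite (bigD1 (rshift N j))//= Pij1 (bigD1 (rshift N j'))/=; last first.
    by rewrite (inj_eq (@rshift_inj _ _)).
  move=> /eqP; rewrite -subr_eq0 addrAC subrr add0r => /eqP H.
  have : 0 < P (rshift N i) (rshift N j') + \sum_(l | (l != rshift N j) &&
      (l != rshift N j')) P (rshift N i) l.
    by rewrite ltr_pwDl// sumr_ge0.
  by rewrite H ltxx.
have [sm [sm0 sm1 ssm]] : exists sm, [/\ 0 < sm, sm < 1 & forall i j, adm G i j -> sm <= s i j].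
  have [c [c0 cs]] : exists c, 0 < c /\ forall ij : 'I_N * 'I_N,
      adm G ij.1 ij.2 -> c <= s ij.1 ij.2.
    apply: finite_uniform_pos => [[i j] /=|ij c c' cc' cs /cs]; last exact: le_trans.
    have [ij|_] := boolP (adm G i j); last by exists 1.
    by exists (s i j); case/andP: (s_contr ij).
  exists (Num.min c 2^-1); split; first by rewrite lt_min c0 invr_gt0 ltr0n.
  - by rewrite gt_min invf_lt1 ?ltr1n ?orbT.
  - by move=> i j ij; rewrite ge_min (cs (i, j)).
have [eta [eta0 etaP]] : exists eta, 0 < eta /\ forall i,
    \sum_j P (lshift N i) (lshift N j) <= 1 - eta.
  apply: finite_uniform_pos => [i|i d d' dd' /le_trans]; last by apply; rewrite lerB.
  have [j ij] := P1_exit i; exists (P (lshift N i) (rshift N j)); split => //.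
  rewrite lerBrDr -(P_sum (lshift N i)) big_split_ord /= lerD2l.
  by rewrite (bigD1 j)//= lerDl sumr_ge0.
pose w := Num.max (1 - eta) 2^-1.
have w0 : 0 < w by rewrite lt_max invr_gt0 ltr0n orbT.
have w1 : w < 1 by rewrite gt_max ltrBlDr ltrDl eta0 invf_lt1 ?ltr1n.
have [pm [pm0 pm_half Ppm]] : exists m, [/\ 0 < m, m <= 2^-1 & forall i j, 0 < P i j -> m <= P i j].
  by apply: exists_entry_bound; rewrite invr_gt0.
have pm1 : pm < 1 by apply: (le_lt_trans pm_half); rewrite invf_lt1 ?ltr1n.
have ln_lt (x : R) : 0 < x -> x < 1 -> ln x < 0 by move=> x0 x1; rewrite ln_lt0// x0.
(* Chosen so that [sm ^ u = p]: on edges of the second block [s ^ u >= P], whence the weight to the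
   power [t], which equals [P^t * s^(u (1 - t))], is at least [P]. *)
pose u := ln p / ln sm; have u0 : 0 < u by rewrite nmulr_rgt0 ?invr_lt0 ?ln_lt.
have smu : sm `^ u = p by exact: powR_logarithm.
(* Chosen so that [pm ^ x = w]. For [1 - t < x] one has [P^t <= P / pm^(1 - t)] with
   [pm^(1 - t) > w], so the rows of the first block still sum to less than 1. As
   [1 - t = r / (u + r)], it suffices that [r < u * x]. *)
pose x := ln w / ln pm; have x0 : 0 < x by rewrite nmulr_rgt0 ?invr_lt0 ?ln_lt.
have pmx : pm `^ x = w by exact: powR_logarithm.
exists (u * x); split; first exact: mulr_gt0.
move=> r r0 rux; have ur0 : 0 < u + r by rewrite addr_gt0.
pose t := u / (u + r); have t0 : 0 < t by rewrite divr_gt0.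
have t1 : t < 1 by rewrite ltr_pdivrMr// mul1r ltrDl.
have t1x : 1 - t < x.
  have -> : 1 - t = r / (u + r) by rewrite /t; field; rewrite gt_eqF.
  rewrite ltr_pdivrMr//; apply: (lt_le_trans rux); rewrite mulrC ler_pM2l//.
  by rewrite lerDl ltW.
have rt : r * t = u * (1 - t) by rewrite /t; field; rewrite gt_eqF.
have wE i j : G i j -> edge_weight s P r i j `^ t =
    P i j `^ t * s (base i) (base j) `^ (u * (1 - t)).
  move=> ij; have /andP[s0 _] := s_contr (edge_adm ij).
  by rewrite powRM ?powR_ge0// -powRrM rt.
have Psplit i j : 0 < P i j -> P i j = P i j `^ t * P i j `^ (1 - t).
  move=> Pij; rewrite -powRD; last by rewrite (lt0r_neq0 Pij) implybT.
  by rewrite addrC subrK powRr1// ltW.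
have t1' : 0 < 1 - t by rewrite subr_gt0.
exists t; split => // i.
  apply: (@le_lt_trans _ _ (\sum_j P (lshift N i) (lshift N j) / pm `^ (1 - t))).
    apply: ler_sum => j _.
    have [ij|nij] := boolP (G (lshift N i) (lshift N j)); last first.
      rewrite (edge_weight_eq0 s P_ge0 P_edge)// powR0 ?gt_eqF//.
      by rewrite (not_edge_eq0 P_ge0 P_edge)// mul0r.
    have /P_edge Pij := ij.
    have /andP[s0 s1] := s_contr (edge_adm ij).
    rewrite wE// {2}(Psplit _ _ Pij) -mulrA; apply: ler_wpM2l; first exact: powR_ge0.
    apply: (@le_trans _ _ 1).
      have := @powR_decr _ _ 0 (u * (1 - t)) s0 (ltW s1); rewrite powRr0; apply.
      by rewrite mulr_ge0// ltW.
    rewrite ler_pdivlMr ?powR_gt0// mul1r.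
    by apply: ge0_ler_powR; rewrite ?nnegrE ?(ltW t1') ?(ltW pm0) ?(ltW Pij)// Ppm.
  rewrite -mulr_suml ltr_pdivrMr ?powR_gt0// mul1r.
  apply: (@le_lt_trans _ _ w); first by rewrite le_max etaP.
  rewrite -pmx /powR gt_eqF// ltr_expR ltr_nM2r// ln_lt//.
apply: (@le_trans _ _ (\sum_j P (rshift N i) (rshift N j))).
  rewrite -(P_sum (rshift N i)) big_split_ord /= big1 ?add0r// => j _.
  by have /matrixP/(_ i j) := P4_eq0; rewrite !mxE.
apply: ler_sum => j _.
have [ij|nij] := boolP (G (rshift N i) (rshift N j)); last first.
  by rewrite (not_edge_eq0 P_ge0 P_edge)// powR_ge0.
have /P_edge Pij := ij.
have ad := edge_adm ij; have /andP[s0 s1] := s_contr ad.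
rewrite wE// {1}(Psplit _ _ Pij); apply: ler_wpM2l; first exact: powR_ge0.
rewrite powRrM; apply: ge0_ler_powR; rewrite ?nnegrE ?(ltW t1') ?(ltW Pij) ?powR_ge0//.
apply: (le_trans (Pp _ _ Pij)); rewrite -smu.
by apply: ge0_ler_powR; rewrite ?nnegrE ?(ltW u0) ?(ltW sm0) ?(ltW s0)// ssm.
Qed.

End Dimensions.

(** * Combination of the bounds *)

Section MainForFixedExponent.
Variables (R : realType) (q N : nat) (G : digraph N).
Variables (s : 'I_N -> 'I_N -> R) (chi : 'I_(N + N) -> R) (P : 'M[R]_(N + N)).
Hypothesis s_contr : forall i j, adm G i j -> 0 < s i j < 1.
Hypothesis chi_gt0 : forall i, 0 < chi i.
Hypothesis chi_sum : \sum_i chi i = 1.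
Hypothesis P_ge0 : forall i j, 0 <= P i j.
Hypothesis P_sum : forall i, \sum_j P i j = 1.
Hypothesis P_edge : forall i j, 0 < P i j <-> G i j.
Hypothesis P4_eq0 : dlsubmx P = 0.
Hypothesis P1_irr : irreducible_mx (ulsubmx P).
Hypothesis P2_irr : irreducible_mx (drsubmx P).
Hypothesis P1_row : forall i : 'I_N, (1 < #|[pred j | (0 < ulsubmx P i j)%R]|)%N.
Hypothesis P2_row : forall i : 'I_N, (1 < #|[pred j | (0 < drsubmx P i j)%R]|)%N.
Hypothesis G_lifts : forall i j, adm G i j ->
  [/\ G (lshift N i) (lshift N j), G (lshift N i) (rshift N j) &
      G (rshift N i) (rshift N j)].
Variable nu : probability (borelType (path_space G)) R.
Hypothesis nuE : forall i w, sorted G (i :: w) ->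
     nu (cylinder G (i :: w)) = (chi i * path_prob P i w)%:E.
Variable mu : set (borelType 'rV[R]_q) -> \bar R.
Variables (D d : R).
Hypotheses (D_gt0 : 0 < D) (d_gt0 : 0 < d).
Hypothesis err_le : forall r k e (L : seq ('I_(N + N) * seq 'I_(N + N))), 0 < r ->
    (0 < size L <= k)%N ->
    (forall p, p \in L -> path G p.1 p.2) ->
    (forall x, exists2 p, p \in L & cylinder G (p.1 :: p.2) x) ->
    (forall p, p \in L -> chi p.1 * path_weight (edge_weight s P r) p.1 p.2 <= e) ->
  (quant_err_pow mu r k <= (D `^ r * (k%:R * e))%:E)%E.
Hypothesis err_ge : forall r k e L, 0 < r -> 0 <= e -> packing s nu r e L ->
    (2 * k <= size L)%N ->
  ((d `^ r * (k%:R * e))%:E <= quant_err_pow mu r k)%E.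

Let P4 i j : P (rshift N i) (lshift N j) = 0.
Proof. by have /matrixP/(_ i j) := P4_eq0; rewrite !mxE. Qed.

Let adm_out i : exists j, adm G i j.
Proof.
have /card_gt1P[j [_ [ij _ _]]] := P1_row i.
exists j; have : 0 < P (lshift N i) (lshift N j) by move: ij; rewrite inE !mxE.
by move=> /P_edge/edge_adm; rewrite !base_lshift.
Qed.

Let radius1 r : 0 < r -> exists rad : R -> R,
  [/\ forall t, spectral_radius (pow_mx (block s P (@lshift N N) r) t) = rad t,
      forall t, exists h, (forall i, 0 < h i) /\
        forall i, mulmv (pow_mx (block s P (@lshift N N) r) t) h i = rad t * h i,
      forall t t', 0 < t -> t < t' -> rad t' < rad t &
      exists t, [/\ 0 < t, t < 1 & rad t = 1]].
Proof.
move=> r0; apply: (block_radius s_contr P_ge0 P_sum P_edge) => //.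
- exact: sum_lshift_le1.
- rewrite (_ : matrix_of_fun _ _ = ulsubmx P)//.
  by apply/matrixP => i j; rewrite !mxE.
- move=> i; apply: leq_trans (P1_row i) _; apply: subset_leq_card.
  by apply/fintype.subsetP => j; rewrite !inE !mxE.
Qed.

Let radius2 r : 0 < r -> exists rad : R -> R,
  [/\ forall t, spectral_radius (pow_mx (block s P (@rshift N N) r) t) = rad t,
      forall t, exists h, (forall i, 0 < h i) /\
        forall i, mulmv (pow_mx (block s P (@rshift N N) r) t) h i = rad t * h i,
      forall t t', 0 < t -> t < t' -> rad t' < rad t &
      exists t, [/\ 0 < t, t < 1 & rad t = 1]].
Proof.
move=> r0; apply: (block_radius s_contr P_ge0 P_sum P_edge) => //.
- exact: sum_rshift_le1.
- rewrite (_ : matrix_of_fun _ _ = drsubmx P)//.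
  by apply/matrixP => i j; rewrite !mxE.
- move=> i; apply: leq_trans (P2_row i) _; apply: subset_leq_card.
  by apply/fintype.subsetP => j; rewrite !inE !mxE.
Qed.

Let mulmv_block emb r t h i :
  mulmv (pow_mx (block s P emb r) t) h i =
  \sum_j edge_weight s P r (emb i) (emb j) `^ t * h j.
Proof. by apply: eq_bigr => j _; rewrite !mxE. Qed.

Let exponent_dimension (r t : R) : 0 < r -> 0 < t -> t < 1 ->
  r / (t * r / (1 - t)) = t^-1 - 1.
Proof. by move=> r0 t0 t1; field; rewrite !gt_eqF// subr_gt0. Qed.

Lemma quantization_dichotomy r : 0 < r ->
  [/\ lower_quant_dim mu r = (sdim P s r)%:E,
      upper_quant_dim mu r = (sdim P s r)%:E,
      (0 < lower_quant_coef mu r (sdim P s r))%E &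
      (upper_quant_coef mu r (sdim P s r) < +oo)%E <-> sdim1 P s r <> sdim2 P s r].
Proof.
move=> r0.
have [rad1 [E1 per1 dec1 [t1 [t10 t11 r1]]]] := radius1 r0.
have [rad2 [E2 per2 dec2 [t2 [t20 t21 r2]]]] := radius2 r0.
have [-> -> ->] := sdim_values G P4_eq0 r0 E1 E2 per1 per2 dec1 dec2
  t10 t11 r1 t20 t21 r2.
set t := Num.max t1 t2.
have t0 : 0 < t by rewrite lt_max t10.
have tlt1 : t < 1 by rewrite gt_max t11.
have [h1 [h10 H1]] := per1 t; have [h2 [h20 H2]] := per2 t.
set u := t * r / (1 - t).
have u0 : 0 < u by rewrite divr_gt0 ?mulr_gt0// subr_gt0.
have ru : r / u = t^-1 - 1 by exact: exponent_dimension.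
have lower : exists c K, 0 < c /\ forall k, (K <= k)%N -> (0 < k)%N ->
    ((c * k%:R `^ (- (r / u)))%:E <= quant_err_pow mu r k)%E.
  rewrite ru; apply: (quant_err_of_packing_growth d_gt0 err_ge) => //.
  have [t12|t21'] := leP t1 t2.
    have tE : t = t2 by apply/max_idPr.
    apply: (packing_growth_block s_contr chi_gt0 P_ge0 P_sum P_edge nuE r0 t0
      (@base_rshift N) h20) => i.
    by rewrite -mulmv_block H2 tE r2 mul1r.
  have tE : t = t1 by apply/max_idPl/ltW.
  apply: (packing_growth_block s_contr chi_gt0 P_ge0 P_sum P_edge nuE r0 t0
    (@base_lshift N) h10) => i.
  by rewrite -mulmv_block H1 tE r1 mul1r.
(* [u < v] means [t < t'], and at [t'] both radii are below 1, whatever the order of [t1] and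
   [t2]. *)
have upper v : u < v -> exists C K, 0 < C /\ forall k, (K <= k)%N -> (0 < k)%N ->
    (quant_err_pow mu r k <= (C * k%:R `^ (- (r / v)))%:E)%E.
  move=> uv; have v0 : 0 < v by exact: lt_trans uv.
  pose t' := v / (v + r); have vr0 : 0 < v + r by rewrite addr_gt0.
  have t'0 : 0 < t' by rewrite divr_gt0.
  have -> : r / v = t'^-1 - 1 by rewrite /t'; field; rewrite !gt_eqF.
  have tt' : t < t'.
    rewrite ltr_pdivlMr// mulrDr -ltrBrDl.
    have -> : v - t * v = v * (1 - t) by rewrite mulrBr mulr1 [v * t]mulrC.
    by rewrite -ltr_pdivrMr// subr_gt0.
  have [g1 [g10 G1]] := per1 t'; have [g2 [g20 G2]] := per2 t'.
  have t1t' : t1 < t' by apply: le_lt_trans tt'; rewrite le_max lexx.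
  have t2t' : t2 < t' by apply: le_lt_trans tt'; rewrite le_max lexx orbT.
  apply: (quant_err_of_cover_growth D_gt0 err_le) => //.
  apply: (cover_growth_sub s_contr chi_gt0 chi_sum P_ge0 P_sum P_edge P4 r0 t'0
    g10 G1 g20 G2); first by rewrite -r1 dec1.
  by rewrite -r2 ltW// dec2.
have [lo up] := quant_dim_eq r0 u0 lower upper.
split => //.
  by have [c [K [c0 cE]]] := lower; exact: lower_quant_coef_gt0 c0 cE.
have inj_dim : t1 * r / (1 - t1) = t2 * r / (1 - t2) <-> t1 = t2.
  split=> [dim12|-> //].
  have := exponent_dimension r0 t10 t11; rewrite dim12 exponent_dimension//.
  by move=> /addIr/invr_inj ->.
split=> [fin /inj_dim t12|/inj_dim t12].
  have tE1 : t = t1 by rewrite /t -t12 maxxx.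
  have [|i|c [c1 [m [c0 c10 m0 m1 HL]]]] := @packing_blowup R N G s chi P s_contr
      chi_gt0 P_ge0 P_sum P_edge G_lifts adm_out nu nuE r t h1 h2 r0 t0 tlt1 h10 h20.
  - by move=> i; rewrite -mulmv_block H1 tE1 r1 mul1r.
  - by rewrite -mulmv_block H2 tE1 t12 r2 mul1r.
  apply: upper_quant_coef_infinite fin => A K; rewrite ru.
  exact: (quant_err_of_blowup d_gt0 err_ge r0 t0 c0 c10 m0 m1 HL).
have growth : cover_growth G s chi P r t.
  (* If [t1 < t2], the first block is strictly subcritical at [t]. If [t2 < t1], it is critical and
     has no slack; the loss term then works with its radius at [t2], which is above 1. *)
  case: (ltgtP t1 t2) => [t12'|t21'|//].
    have tE : t = t2 by apply/max_idPr/ltW.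
    apply: (cover_growth_sub s_contr chi_gt0 chi_sum P_ge0 P_sum P_edge P4 r0 t0
      h10 H1 h20 H2); first by rewrite tE -r1 dec1.
    by rewrite tE r2.
  have tE : t = t1 by apply/max_idPl/ltW.
  have [g [g0 Eg]] := per1 t2; have [g2 [g20 Eg2]] := per2 t2.
  rewrite tE; apply: (cover_growth_first s_contr chi_gt0 chi_sum P_ge0 P_sum P_edge P4
    r0 t20 t21' h10 _ g0 Eg _ g20).
  - by move=> i; rewrite -[in LHS]tE H1 tE r1 mul1r.
  - by rewrite -r1 dec1.
  - by move=> i; rewrite Eg2 r2 mul1r.
have [C [K [_ CE]]] := quant_err_of_cover_growth D_gt0 err_le r0 t0 growth.
by apply: (@upper_quant_coef_lty _ _ _ _ _ C K); rewrite ru.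
Qed.

(** At the parameter [t] of [small_r_separation] the constant vector 1 shows that the first radius
    is below 1 and the second at least 1, so that [t1 < t <= t2]. *)
Lemma dimensions_differ : exists r0 : R, 0 < r0 /\ forall r, 0 < r < r0 ->
  sdim1 P s r <> sdim2 P s r.
Proof.
have [|i|r0 [r00 sep]] := small_r_separation s_contr P_ge0 P_sum P_edge P4_eq0.
- move=> i; have [j /G_lifts[_ ij _]] := adm_out i; exists j; exact/P_edge.
- apply: leq_trans (P2_row i) _; apply: subset_leq_card.
  by apply/fintype.subsetP => j; rewrite !inE !mxE.
exists r0; split; [exact: r00 | move=> r /andP[r_gt0 rr0]].
have [rad1 [E1 per1 dec1 [t1 [t10 t11 r1]]]] := radius1 r_gt0.
have [rad2 [E2 per2 dec2 [t2 [t20 t21 r2]]]] := radius2 r_gt0.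
have [-> -> _] := sdim_values G P4_eq0 r_gt0 E1 E2 per1 per2 dec1 dec2
  t10 t11 r1 t20 t21 r2.
have [t [t0 row1 row2]] := sep r r_gt0 rr0.
have N0 : (0 < N)%N := ltnW (digraph_gt1 G).
have t1t : t1 < t.
  have rt : rad1 t < 1.
    have [h [h0 Eh]] := per1 t.
    apply: (collatz_wielandt_lt (A := pow_mx (block s P (@lshift N N) r) t)
      (g := fun=> 1) (h := h) N0 (@pow_mx_ge0 _ _ _ _)) => // i.
      by rewrite Eh.
    by rewrite mulmv_block mulr1; under eq_bigr do rewrite mulr1.
  rewrite ltNge; apply/negP => tt1; suff : rad1 t1 <= rad1 t by rewrite r1 leNgt rt.
  by move: tt1; rewrite le_eqVlt => /orP[/eqP ->|/(dec1 _ _ t0)/ltW].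
have tt2 : t <= t2.
  have rt : 1 <= rad2 t.
    have [h [h0 Eh]] := per2 t.
    apply: (collatz_wielandt_le (A := pow_mx (block s P (@rshift N N) r) t)
      (g := h) (h := fun=> 1) N0 (@pow_mx_ge0 _ _ _ _)) => // i.
      by rewrite mulmv_block mulr1; under eq_bigr do rewrite mulr1.
    by rewrite Eh.
  by rewrite leNgt; apply/negP => /(dec2 _ _ t20); rewrite r2 ltNge rt.
move=> dim12; have := exponent_dimension r_gt0 t10 t11.
rewrite dim12 exponent_dimension// => /addIr/invr_inj t12.
by have := lt_le_trans t1t tt2; rewrite t12 ltxx.
Qed.

End MainForFixedExponent.

Theorem theorem1p4 (R : realType) (q N : nat) (hq : (0 < q)%N)
  (G : digraph N)
  (J : 'I_N -> set 'rV[R]_q)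
  (J_neq0 : forall i, J i !=set0)
  (J_disj : trivIset setT J)
  (J_compact : forall i, compact (J i))
  (J_regular : forall i, closure (interior (J i)) = J i)
  (T : 'I_N -> 'I_N -> 'rV[R]_q -> 'rV[R]_q)
  (s : 'I_N -> 'I_N -> R)
  (s_contr : forall i j, admissible2 G i j -> 0 < s i j < 1)
  (T_sim : forall i j, admissible2 G i j -> similarity (s i j) (T i j))
  (T_sub : forall i, \bigcup_(j in [set j | admissible2 G i j]) (T i j @` J j)
                     `<=` J i)
  (T_disj : trivIset [set p : 'I_N * 'I_N | admissible2 G p.1 p.2]
                     (fun p => T p.1 p.2 @` J p.2))
  (chi : 'I_(N + N) -> R)
  (chi_gt0 : forall i, 0 < chi i)
  (chi_sum : \sum_i chi i = 1)
  (P : 'M[R]_(N + N))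
  (P_ge0 : forall i j, 0 <= P i j)
  (P_sum : forall i, \sum_j P i j = 1)
  (P_edge : forall i j, 0 < P i j <-> G i j)
  (nu : probability (borelType (path_space G)) R)
  (nuE : forall i w, sorted G (i :: w) ->
     nu (cylinder G (i :: w)) = (chi i * path_prob P i w)%:E)
  (P1_irr : irreducible_mx (ulsubmx P))
  (P2_irr : irreducible_mx (drsubmx P))
  (P4_eq0 : dlsubmx P = 0)
  (P1_row : forall i : 'I_N, (1 < #|[pred j | (0 < ulsubmx P i j)%R]|)%N)
  (P2_row : forall i : 'I_N, (1 < #|[pred j | (0 < drsubmx P i j)%R]|)%N)
  (hM : forall i j, lifts G i j = set0 \/
     lifts G i j = [set (lshift N i, lshift N j); (lshift N i, rshift N j);
                        (rshift N i, rshift N j)]) :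
  let mu := pushforward nu (coding G T J) in
  [/\ forall r : R, 0 < r ->
        [/\ lower_quant_dim mu r = (sdim P s r)%:E,
            upper_quant_dim mu r = (sdim P s r)%:E &
            (0 < lower_quant_coef mu r (sdim P s r))%E],
      forall r : R, 0 < r ->
        (upper_quant_coef mu r (sdim P s r) < +oo)%E
          <-> sdim1 P s r <> sdim2 P s r &
      exists r0 : R, 0 < r0 /\ forall r, 0 < r < r0 ->
        (upper_quant_coef mu r (sdim P s r) < +oo)%E].
Proof.
move=> mu.
have s_contr' i j : adm G i j -> 0 < s i j < 1 by move=> /asboolP; exact: s_contr.
have T_sim' i j : adm G i j -> similarity (s i j) (T i j) by move=> /asboolP; exact: T_sim.
have T_sub' i j : adm G i j -> T i j @` J j `<=` J i.
  by move=> /asboolP ij x Tx; apply: T_sub; exists j.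
have J_disj' i j : i != j -> J i `&` J j = set0.
  move=> ij; apply/eqP; apply: contraNT ij => /set0P JJ.
  by apply/eqP; exact: J_disj JJ.
have T_disj' i j k : adm G i j -> adm G i k -> j != k ->
    T i j @` J j `&` T i k @` J k = set0.
  move=> /asboolP ij /asboolP ik jk; apply/eqP; apply: contraNT jk => /set0P TT.
  by have := T_disj (i, j) (i, k) ij ik TT; case=> ->.
have G_lifts i j : adm G i j -> [/\ G (lshift N i) (lshift N j),
    G (lshift N i) (rshift N j) & G (rshift N i) (rshift N j)].
  move=> /asboolP[p ijp]; have [l0|l3] := hM i j; first by move: ijp; rewrite l0.
  have mem p' : (lifts G i j) p' -> G p'.1 p'.2 by case.
  have m1 : lifts G i j (lshift N i, lshift N j) by rewrite l3 /=; tauto.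
  have m2 : lifts G i j (lshift N i, rshift N j) by rewrite l3 /=; tauto.
  have m3 : lifts G i j (rshift N i, rshift N j) by rewrite l3 /=; tauto.
  by split; [exact: mem m1 | exact: mem m2 | exact: mem m3].
have [D [D0 err_le]] := quant_err_pow_coding_le J_neq0 J_compact s_contr' T_sim'
  T_sub' chi_gt0 P_ge0 nuE.
have [d [d0 err_ge']] := quant_err_pow_coding_ge J_neq0 J_disj' J_compact s_contr'
  T_sim' T_sub' T_disj' nu.
have err_ge r k e L : 0 < r -> 0 <= e -> packing s nu r e L -> (2 * k <= size L)%N ->
    ((d `^ r * (k%:R * e))%:E <= quant_err_pow mu r k)%E.
  by move=> r0 e0 [uL pL preL eL] kL; exact: err_ge' r0 e0 uL kL pL preL eL.
have main := quantization_dichotomy s_contr' chi_gt0 chi_sum P_ge0 P_sum P_edge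
  P4_eq0 P1_irr P2_irr P1_row P2_row G_lifts nuE D0 d0 err_le err_ge.
split=> [r /main[]//|r /main[]//|].
have [r0 [r00 dim12]] := dimensions_differ s_contr' P_ge0 P_sum P_edge
  P4_eq0 P1_irr P2_irr P1_row P2_row G_lifts.
exists r0; split; [exact: r00 | move=> r rr0]; have /andP[r_gt0 _] := rr0.
by have [_ _ _ [_]] := main r r_gt0; apply; exact: dim12.
Qed.
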